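(* If $\diamondsuit^{+}$ holds, then there exists a non-trivial, quasi-smooth graph on $\omega_1$.
   Context: $\diamondsuit^{+}$ is the statement: there is a sequence $\langle S_\alpha:\alpha<\omega_1\rangle$ of countable sets such that for each $X\subseteq\omega_1$ there is a closed unbounded $C\subseteq\omega_1$ with $X\cap\nu\in S_\nu$ and $C\cap\nu\in S_\nu$ for every $\nu\in C$. A graph $G=\langle V,E\rangle$ on an infinite set $V$ is non-trivial if it contains no clique and no independent set of size $|V|$. $G$ is quasi-smooth if for every $W\subseteq V$, $G$ is isomorphic to $G[W]$ or to $G[V\setminus W]$ (induced subgraphs). *)

(* Defs.v *)
From HB Require Import structures.
From mathcomp Require Import all_boot all_order.
From mathcomp Require Import all_classical.

Set Implicit Arguments.
Unset Strict Implicit.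
Unset Printing Implicit Defensive.

Import Order.TTheory.

Local Open Scope classical_set_scope.
Local Open Scope card_scope.
Local Open Scope order_scope.

Definition below (d : Order.disp_t) (T : orderType d) (nu : T) : set T :=
  [set a | a < nu].

(* Up to isomorphism, omega_1 is the unique uncountable well-order all of whose
   proper initial segments are countable; see is_omega1_inhabited below. *)
Definition is_omega1 (d : Order.disp_t) (T : orderType d) : Prop :=
  [/\ wochoice.well_order (<=%O : rel T),
      ~ countable [set: T] &
      forall nu : T, countable (below nu)].

Section Club.
Context {d : Order.disp_t} {T : orderType d}.
Implicit Types (C : set T) (nu : T).

Definition unbounded C : Prop := forall a, exists2 b, C b & a < b.

(* nu is a limit point of C. Because of the strict inequality a < b, such a nu
   is automatically a limit; the first conjunct excludes nu = 0. *)
Definition limit_point C nu : Prop :=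
  (exists a, a < nu) /\
  forall a, a < nu -> exists2 b, C b & a < b < nu.

Definition closed_in_order C : Prop := forall nu, limit_point C nu -> C nu.

Definition club C : Prop := closed_in_order C /\ unbounded C.

End Club.

(* Diamond-plus on T. Only the subsets of T among the members of S nu matter,
   so each S nu is taken to be a countable family of subsets of T. *)
Definition diamond_plus (d : Order.disp_t) (T : orderType d) : Prop :=
  exists S : T -> set (set T),
    (forall nu, countable (S nu)) /\
    forall X : set T, exists C : set T,
      club C /\
      forall nu, C nu -> S nu (X `&` below nu) /\ S nu (C `&` below nu).

Record graph (V : Type) := Graph {
  adj :> rel V;
  adj_sym : symmetric adj;
  adj_irr : irreflexive adj }.

Section Graph.
Context {V : Type}.
Implicit Types (G : graph V) (A W : set V).

Definition clique G A : Prop :=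
  forall x y, A x -> A y -> x <> y -> adj G x y.

Definition independent G A : Prop :=
  forall x y, A x -> A y -> ~ adj G x y.

Definition nontrivial_graph G : Prop :=
  ~ (exists2 A, A #= [set: V] & clique G A) /\
  ~ (exists2 A, A #= [set: V] & independent G A).

Definition induced G W : graph (set_type W) :=
  @Graph (set_type W) (fun x y => adj G (val x) (val y))
    (fun x y => adj_sym G (val x) (val y)) (fun x => adj_irr G (val x)).

End Graph.

Definition isomorphic (V V' : Type) (G : graph V) (H : graph V') : Prop :=
  exists2 f : V -> V', bijective f & {mono f : x y / adj G x y >-> adj H x y}.

Definition quasi_smooth (V : Type) (G : graph V) : Prop :=
  forall W : set V,
    isomorphic G (induced G W) \/ isomorphic G (induced G (~` W)).

(* is_omega1 is satisfiable: well-order the subsets of nat and keep those with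
   countably many predecessors. *)
Lemma is_omega1_inhabited :
  exists (d : Order.disp_t) (T : orderType d), is_omega1 T.
Proof.
have [R woR] := wochoice.well_ordering_principle (set nat).
have woC (C : {pred set nat}) : wochoice.wo_chain R C by move=> A _; exact: woR.
have Rtot : total R.
  by move=> x y; apply: (wochoice.wo_chainW (woC predT)).
have Rrefl : reflexive R.
  by move=> x; apply: (wochoice.wo_chain_reflexive (woC predT)).
have Ranti : antisymmetric R.
  by move=> x y; apply: (wochoice.wo_chain_antisymmetric (woC predT)).
have Rtrans : transitive R.
  move=> y x z xy yz.
  have [|m [[]]] := woR [pred t | (t == x) || (t == y) || (t == z)].
    by exists x; rewrite inE eqxx.
  rewrite !inE => /orP[/orP[]|] /eqP -> lb _.
  - by apply: lb; rewrite inE eqxx !orbT.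
  - have yx : R y x by apply: lb; rewrite inE eqxx.
    by rewrite (Ranti x y) // xy yx.
  - have zy : R z y by apply: lb; rewrite inE eqxx orbT.
    by rewrite -(Ranti y z) // yz zy.
pose pr x := [set y | R y x && (y != x)].
pose K : set (set nat) := [set x | countable (pr x)].
pose U := set_type K.
pose le (x y : U) := R (val x) (val y).
have le_anti : antisymmetric le by move=> x y /Ranti/val_inj.
have le_trans : transitive le by move=> y x z; exact: Rtrans.
have le_tot : total le by move=> x y; exact: Rtot.
pose chU : choiceType := HB.pack U (gen_eqMixin U) (gen_choiceMixin U).
pose mx := @Order.isOrder.Build Order.default_display chU le _ _ _
  (fun _ _ => erefl) (fun _ _ => erefl) (fun _ _ => erefl)
  le_anti le_trans le_tot.
pose T : orderType Order.default_display := HB.pack (chU : Type) chU mx.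
have valK (x : U) : K (val x) by apply/set_mem; exact: valP.
exists Order.default_display, T; split.
- apply: wochoice.antisymmetric_well_order => [|A [a Aa]]; first exact: le_anti.
  have [|m [[/asboolP[z /asboolP[Az zm]] lb] _]] :=
    woR (fun t => `[< exists z : U, `[< (z \in A) /\ val z = t >] >]).
    by exists (val (a : U)); apply/asboolP; exists a; apply/asboolP.
  exists z; split=> // t At; rewrite /Order.le /= /le zm.
  by apply: lb; apply/asboolP; exists t; apply/asboolP.
- move=> cU.
  have cK : countable K.
    have -> : K = (fun x : U => val x) @` [set: U].
      apply/seteqP; split=> [x Kx|_ [x _ <-]]; last exact: valK.
      by exists (SigSub (mem_set Kx)).
    exact: card_le_trans (card_image_le _ _) cU.
  have [|m [[]]] := woR [pred t | t \notin K].
    apply: contrapT => nx.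
    have KT : K = [set: set nat].
      apply/seteqP; split=> // x _; apply: contrapT => nKx.
      by apply: nx; exists x; rewrite inE; apply/negP => /set_mem.
    have := cK; rewrite KT => /pcard_injP[f finj].
    pose D := [set n | exists2 A, f A = n & ~ A n].
    have nD : ~ D (f D).
      by move=> /[dup] DfD [A /finj ->] //; rewrite ?inE.
    by apply: (nD); exists D.
  rewrite inE => /negP nKm lb _; apply: nKm; apply/mem_set.
  apply: sub_countable cK; apply: subset_card_le => y /andP[Rym yNm].
  apply: contrapT => nKy; move/eqP: yNm; apply; apply: Ranti; rewrite Rym /=.
  by apply: lb; rewrite inE; apply/negP => /set_mem.
- move=> nu; have := valK nu; rewrite /K /=.
  apply: sub_countable.
  have -> : below nu = (val : U -> set nat) @^-1` pr (val nu).
    apply/seteqP; split=> x; rewrite /below /pr /= lt_neqAle.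
      move=> /andP[xNnu xnu]; apply/andP; split; first exact: xnu.
      by apply: contra_not_neq (elimN eqP xNnu) => /val_inj.
    move=> /andP[xnu xNnu]; apply/andP; split; last exact: xnu.
    by apply: contra_not_neq (elimN eqP xNnu) => ->.
  by apply: (@card_ge_preimage _ _ (pr (val nu)) val) => x y _ _; exact: val_inj.
Qed.

(* Main.v *)
(** The graph lives on [T * nat], where [T] is omega_1: a vertex [(a, n)] of level
    [a] is joined to those vertices of lower level that belong to its trace, and
    the traces of level [a] form a countable family closed under restriction.

    Diamond-plus provides countably many guesses at each level [c] for a set [W]
    of vertices and a club [C]. Along [C] we build coherent isomorphisms from
    the graph below [c] onto the graph induced on the guessed set. For these to
    extend further, every trace [s] needs a partner: a trace of the same level
    that is the image of [s]. The traces of a level [b] and the isomorphisms at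
    [b] are constructed together, generically, by finite approximations: finite
    forests whose nodes are traces and whose edges are labelled by the guesses,
    saying that two traces are partners. Requirements on a node propagate along
    the edges, and do not conflict because a forest has no cycles, provided that
    the vertices added to the isomorphisms lie on no short closed walk of the
    maps defined so far. Such vertices exist (fresh_vertex): a short closed walk
    would induce a closed walk on the traces of a suitable lower level, where
    the partner relation is acyclic by induction.

    Genericity of the traces with respect to guessed sets of vertices excludes
    uncountable cliques and independent sets. Applied to the vertices whose
    traces have no extension in [W], it gives a level at which each trace either
    has no extension in [W] or is such that all of its extensions have further
    extensions in [W], and likewise for the complement. Either [W] or the
    complement then realizes all finite patterns over that level, and for that
    set the guesses along a club glue to an isomorphism. *)

Require Import Defs.
From HB Require Import structures.
From mathcomp Require Import all_boot all_order.
From mathcomp Require Import all_classical.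

Set Implicit Arguments.
Unset Strict Implicit.
Unset Printing Implicit Defensive.

Import Order.TTheory.

Local Open Scope order_scope.

(** * Walks *)

(** Level [b] has to know which earlier isomorphisms a given one must extend, and each initial
    segment of that list has to be guessed too; this is why the guessing of [C] next to [X] matters.
    Two kinds of labels then meet at [b]. If the closed levels are cofinal in [b], the map is
    inherited and only traces have to be matched; otherwise it has to be continued past its last
    closed level, one pair at a time. The obstacle is that a link between two vertices below a level
    [c'] may run through vertices above [c'], along maps that are not closed at [c'], so coherence
    at [c'] cannot be checked below [c'] alone. The induction therefore carries a finiteness
    statement: for finitely many letters and a bounded length, only finitely many vertices below
    [c'] start such an excursion ([Xfull], [Xlow]), and their bits can be prescribed ([extend]).
    Bounded length suffices because a reduced walk in a forest with [N] nodes has length at most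
    [2 * N]; this is the origin of every such constant. Freshness of an added pair is asked only for
    finitely many letters and one length at a time, and covers every choice of them eventually. *)

Definition enumerable (X : Type) (A : X -> Prop) :=
  exists e : nat -> option X, forall x, A x -> exists n, e n = Some x.

Lemma enumerable_nat : enumerable (fun _ : nat => True).
Proof. by exists Some => n _; exists n. Qed.

Lemma enumerable_countType (X : countType) (A : X -> Prop) : enumerable A.
Proof. by exists unpickle => x _; exists (pickle x); rewrite pickleK. Qed.

Lemma enumerable_sub (X : Type) (A B : X -> Prop) :
  (forall x, A x -> B x) -> enumerable B -> enumerable A.
Proof. by move=> AB [e eP]; exists e => x /AB /eP. Qed.

Lemma enumerable_bind (X Y : Type) (A : X -> Prop) (B : X -> Y -> Prop) :
  enumerable A -> (forall a, A a -> enumerable (B a)) ->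
  enumerable (fun y => exists2 a, A a & B a y).
Proof.
move=> [eA eAP] eB.
have /choice[g gP] : forall a, exists e : nat -> option Y,
    A a -> forall y, B a y -> exists n, e n = Some y.
  move=> a; have [Aa|nAa] := pselect (A a); last by exists (fun=> None).
  by have [e eP] := eB a Aa; exists e.
exists (fun k => if unpickle k is Some (n, m) then
                   if eA n is Some a then g a m else None else None).
move=> y [a Aa Bay]; have [n en] := eAP a Aa; have [m em] := gP a Aa y Bay.
by exists (pickle (n, m)); rewrite pickleK en.
Qed.

Lemma enumerable_image (X Y : Type) (A : X -> Prop) (f : X -> Y) :
  enumerable A -> enumerable (fun y => exists2 a, A a & f a = y).
Proof.
move=> eA; apply: enumerable_bind eA _ => a _.
by exists (fun=> Some (f a)) => y <-; exists 0%N.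
Qed.

Lemma enumerable_prod (X Y : Type) (A : X -> Prop) (B : Y -> Prop) :
  enumerable A -> enumerable B -> enumerable (fun p => A p.1 /\ B p.2).
Proof.
move=> eA eB.
apply: (@enumerable_sub _ _
  (fun p => exists2 a, A a & exists2 b, B b & (a, b) = p)) => [[a b] [/= ? ?]|].
  by exists a => //; exists b.
by apply: enumerable_bind eA _ => a _; apply: enumerable_image.
Qed.

Lemma enumerable_union (X : Type) (A B : X -> Prop) :
  enumerable A -> enumerable B -> enumerable (fun x => A x \/ B x).
Proof.
move=> eA eB; apply: (@enumerable_sub _ _
  (fun x => exists2 b : bool, True & if b then A x else B x)) => [x [?|?]|].
- by exists true.
- by exists false.
by apply: enumerable_bind => [|[]//]; apply: enumerable_countType.
Qed.

Lemma enumerable_seq (X : eqType) (A : X -> Prop) :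
  enumerable A -> enumerable (fun s : seq X => forall x, x \in s -> A x).
Proof.
move=> eA; apply: (@enumerable_sub _ _
  (fun s => exists2 n, True & size s = n /\ forall x, x \in s -> A x)) => [s ?|].
  by exists (size s).
apply: enumerable_bind enumerable_nat _ => n _.
elim: n => [|n IHn].
  by exists (fun=> Some [::]) => -[|? ?] [] //; exists 0%N.
apply: (@enumerable_sub _ _ (fun s => exists2 p,
  A p.1 /\ (size p.2 = n /\ forall x, x \in p.2 -> A x) & p.1 :: p.2 = s)).
  move=> [|x s] [] //= [sz] h; exists (x, s) => //=; split.
    by apply: h; rewrite mem_head.
  by split=> // y ys; apply: h; rewrite inE ys orbT.
exact: enumerable_image (enumerable_prod eA IHn).
Qed.

Lemma seq_union (I X : eqType) (s : seq I) (P : I -> X -> Prop) :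
  (forall i, i \in s -> exists t : seq X, forall y, P i y -> y \in t) ->
  exists t : seq X, forall i y, i \in s -> P i y -> y \in t.
Proof.
elim: s => [|i s IHs] h; first by exists [::].
have [t ht] : exists t : seq X, forall j y, j \in s -> P j y -> y \in t.
  by apply: IHs => j js; apply: h; rewrite inE js orbT.
have [u hu] := h i (mem_head _ _).
exists (u ++ t) => j y; rewrite inE mem_cat => /orP[/eqP ->|js] Py.
  by rewrite hu.
by rewrite (ht j) ?orbT.
Qed.

Section Walks.
Variables (A : eqType) (X : Type).
Implicit Types (R : A -> X -> X -> Prop) (a : A * bool) (l : seq (A * bool)).

Definition step R a x y := if a.2 then R a.1 x y else R a.1 y x.

Fixpoint walk R l x y :=
  if l is a :: l' then exists2 z, step R a x z & walk R l' z y else x = y.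

Definition inv a := (a.1, ~~ a.2).

Lemma invK : involutive inv.
Proof. by case=> a b; rewrite /inv /= negbK. Qed.

Definition reduced l := sorted (fun a b => b != inv a) l.

Definition on (Ls : seq A) l := all (fun a => a.1 \in Ls) l.

(** [step] ranges over both directions, so every [R k] becomes a partial injection; a walk is a word
    in these maps and their inverses. *)
Definition deterministic R := forall a x y z, step R a x y -> step R a x z -> y = z.

Definition wrev l := rev [seq inv a | a <- l].

Lemma step_inv R a x y : step R (inv a) x y <-> step R a y x.
Proof. by rewrite /step /=; case: a.2. Qed.

Lemma walk_cat R l1 l2 x y :
  walk R (l1 ++ l2) x y <-> exists2 z, walk R l1 x z & walk R l2 z y.
Proof.
elim: l1 x => [|a l1 IH] x /=; first by split=> [?|[z -> //]]; exists x.
split=> [[z az /IH[w zw wy]]|[w [z az zw] wy]].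
  by exists w => //; exists z.
by exists z => //; apply/IH; exists w.
Qed.

Lemma walk_rev R l x y : walk R l x y -> walk R (wrev l) y x.
Proof.
elim: l x => [|a l IH] x /=; first by move=> ->.
move=> [z az zy]; rewrite /wrev /= rev_cons -cats1; apply/walk_cat.
by exists z; [exact: IH | exists x => //; apply/step_inv].
Qed.

Lemma size_wrev l : size (wrev l) = size l.
Proof. by rewrite size_rev size_map. Qed.

Lemma on_wrev Ls l : on Ls (wrev l) = on Ls l.
Proof. by rewrite /on /wrev all_rev all_map; apply: eq_all => -[]. Qed.

Lemma reduced_wrev l : reduced l -> reduced (wrev l).
Proof.
rewrite /reduced /wrev rev_sorted sorted_map; move: l; apply: sub_sorted => a b /=.
by apply: contraNneq => ->; rewrite invK.
Qed.

Lemma reduced_cat l1 l2 : reduced (l1 ++ l2) -> reduced l1 /\ reduced l2.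
Proof.
rewrite /reduced; case: l1 => //= a l1; rewrite cat_path => /andP[-> /= h].
by split=> //; exact: path_sorted h.
Qed.

Lemma reduced_cons a l : reduced (a :: l) -> reduced l.
Proof. exact: path_sorted. Qed.

Lemma not_reduced l : ~~ reduced l ->
  exists l1 a l2, l = l1 ++ a :: inv a :: l2.
Proof.
elim: l => [//|a [//|b l] IH] /=; rewrite negb_and negbK => /orP[/eqP ->|h].
  by exists [::], a, l.
by have [l1 [c [l2 ->]]] := IH h; exists (a :: l1), c, l2.
Qed.

(** Cancelling a letter against its inverse keeps the endpoints, because determinism identifies the
    vertex before the pair with the vertex after it. *)
Lemma walk_reduce R l x y : deterministic R -> walk R l x y ->
  exists l', [/\ reduced l', (size l' <= size l)%N, {subset l' <= l}
               & walk R l' x y].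
Proof.
move=> dR; have [n] := ubnP (size l); elim: n l => // n IH l ln lxy.
have [rl|nrl] := boolP (reduced l); first by exists l; split.
have [l1 [a [l2 le]]] := not_reduced nrl; move: lxy ln; rewrite le.
move=> /walk_cat[z xz /= [u au [w uw wy]]].
have zw : z = w by apply: (dR _ _ _ _ _ uw); apply/step_inv.
subst w; move=> ln; have [||l' [rl' sl' subl' wl']] := IH (l1 ++ l2).
- by move: ln; rewrite !size_cat /= !addnS ltnS; apply: ltn_trans.
- by apply/walk_cat; exists z.
exists l'; split=> //.
  by apply: leq_trans sl' _; rewrite !size_cat /= leq_add2l !leqW.
by move=> b /subl'; rewrite !mem_cat !inE => /orP[->//|->]; rewrite !orbT.
Qed.

End Walks.

Lemma walk_map (A A' : eqType) (X X' : Type) (R : A -> X -> X -> Prop)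
    (R' : A' -> X' -> X' -> Prop) (m : A -> A') (f : X -> X')
    (Ls : seq A) l x y :
  (forall a x y, a \in Ls -> R a x y -> R' (m a) (f x) (f y)) ->
  on Ls l -> walk R l x y ->
  walk R' [seq (m a.1, a.2) | a <- l] (f x) (f y).
Proof.
move=> h; elim: l x => [|[a b] l IH] x /=; first by move=> _ ->.
move=> /andP[aL lL] [z az zy]; exists (f z); last exact: IH.
by case: b az; rewrite /step /=; apply: h.
Qed.

Lemma reduced_map (A A' : eqType) (m : A -> A') (Ls : seq A) l :
  {in Ls &, injective m} -> on Ls l -> reduced l ->
  reduced [seq (m a.1, a.2) | a <- l].
Proof.
move=> mi; rewrite /reduced sorted_map => lL.
apply: sub_in_sorted lL => -[a b] [a' b']; rewrite /in_mem /= => aL a'L.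
by apply: contraNneq => -[/mi -> // ->].
Qed.

(** Each letter has at most one outcome at a given point and there are finitely many letters, so
    balls of radius [n] are finite. *)
Lemma walk_fin (A X : eqType) (R : A -> X -> X -> Prop) (Ls : seq A) n (s : seq X) :
  deterministic R -> exists t : seq X, forall l x y,
    (size l <= n)%N -> on Ls l -> x \in s -> walk R l x y -> y \in t.
Proof.
move=> dR; elim: n s => [|n IH] s.
  by exists s => -[|? ?] x y //= _ _ xs <-.
have [t1 ht1] : exists t : seq X, forall (p : A * bool * X) y,
    p \in [seq (q, x) | q <- [seq (a, b) | a <- Ls, b <- [:: true; false]], x <- s] ->
    step R p.1 p.2 y -> y \in t.
  apply: seq_union => p _.
  have [[y py]|npy] := pselect (exists y, step R p.1 p.2 y).
    by exists [:: y] => z pz; rewrite inE (dR _ _ _ _ pz py).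
  by exists [::] => y py; case: npy; exists y.
have [t2 ht2] := IH t1.
exists (s ++ t2) => -[|[a b] l] x y /=; rewrite mem_cat.
  by move=> _ _ xs <-; rewrite xs.
rewrite ltnS => ln /andP[aL lL] xs [z az zy]; rewrite (ht2 l z) ?orbT //.
apply: (ht1 ((a, b), x)) az; apply/allpairsP; exists ((a, b), x).
by split=> //; apply/allpairsP; exists (a, b); split=> //; case: (b).
Qed.

(** * Forests *)

Section Forest.
Variable L : eqType.
Implicit Types (E : seq (nat * L * nat)) (k : L) (N i j : nat).

Definition nodeR E k i j : Prop := (i, k, j) \in E.

Definition edge (d : bool) i k j := if d then (i, k, j) else (j, k, i).

Lemma step_edge E i k d j : step (nodeR E) (k, d) i j <-> edge d i k j \in E.
Proof. by case: d. Qed.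

(** An edge always joins the newest node [N] to an old one. The last condition allows one edge per
    label and direction at a node, which makes the edge relations partial injections
    ([forest_det]). *)
Inductive forest : nat -> seq (nat * L * nat) -> Prop :=
| forest0 : forest 0 [::]
| forest_node N E : forest N E -> forest N.+1 E
| forest_leaf N E i k d : forest N E -> (i < N)%N ->
    (forall j, ~ edge d i k j \in E) -> forest N.+1 (edge d i k N :: E).

Lemma forest_bound N E : forest N E -> forall i k j, (i, k, j) \in E ->
  (i < N)%N /\ (j < N)%N.
Proof.
elim=> {N E} [//|N E _ IH i k j /IH[? ?]|N E i k d _ IH iN _ i' k' j'].
  by split; apply: ltnW.
rewrite inE => /orP[|/IH[? ?]]; last by split; apply: ltnW.
by case: d => /eqP[-> _ ->]; split=> //; apply: ltnW.
Qed.

Lemma edge_bound N E d i k j : forest N E -> edge d i k j \in E ->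
  (i < N)%N /\ (j < N)%N.
Proof. by move=> /forest_bound h; case: d => /h []. Qed.

Lemma forest_det N E : forest N E -> deterministic (nodeR E).
Proof.
elim=> {N E} [[k []]//|//|N E i k d F IH iN new [k' d'] x y z].
rewrite !step_edge !inE => /orP[/eqP e1|e1] /orP[/eqP e2|e2].
- by case: d d' e1 e2 {new} => -[] /= [? ? ?] [? ? ?]; congruence.
- have [xN yN] := edge_bound F e2; exfalso.
  case: d d' e1 e2 new => -[] [e1 e2 e3] e4 new; subst;
    solve [exact: new e4 | by move: xN; rewrite ltnn | by move: yN; rewrite ltnn].
- have [xN yN] := edge_bound F e1; exfalso.
  case: d d' e1 e2 new => -[] e4 [e1 e2 e3] new; subst;
    solve [exact: new e4 | by move: xN; rewrite ltnn | by move: yN; rewrite ltnn].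
- by apply: (IH (k', d') x); apply/step_edge.
Qed.

Lemma leaf_step N E i k d : forest N E -> (i < N)%N ->
  forall a x y, step (nodeR (edge d i k N :: E)) a x y ->
  [\/ step (nodeR E) a x y /\ x <> N,
      [/\ a = (k, d), x = i & y = N] | [/\ a = (k, ~~ d), x = N & y = i]].
Proof.
move=> F iN [k' d'] x y; rewrite step_edge inE => /orP[/eqP|e].
  by case: d d' => -[] [] -> -> ->; [apply: Or32|apply: Or33|apply: Or33|apply: Or32].
apply: Or31; rewrite step_edge; split=> // xN.
by have [] := edge_bound F e; rewrite xN ltnn.
Qed.

(** The leaf has a single edge, so leaving it after entering would backtrack: a reduced walk that
    starts elsewhere meets [N] at most at its end. *)
Lemma leaf_walk N E i k d : forest N E -> (i < N)%N ->
  forall l x y, x <> N -> reduced l -> walk (nodeR (edge d i k N :: E)) l x y ->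
  (y <> N /\ walk (nodeR E) l x y) \/
  (y = N /\ exists2 l', l = rcons l' (k, d) & walk (nodeR E) l' x i).
Proof.
move=> F iN; elim=> [|a l IH] x y xN rl /=; first by move=> <-; left.
move=> [z az zy]; case: (leaf_step F iN az) => [[az' _]|[ea ex ez]|[_ /xN]//].
- have zN : z <> N.
    by case: a az' {az rl} => k' d' /step_edge /(edge_bound F)[_ zN] ez; rewrite ez ltnn in zN.
  have [[yN w]|[yN [l' -> w]]] := IH z y zN (reduced_cons rl) zy.
    by left; split=> //; exists z.
  by right; split=> //; exists (a :: l') => //=; exists z.
- right; case: l rl zy {IH} => [|b l] /= rl.
    by move=> <-; split=> //; exists [::] => //=; rewrite ea.
  move=> [w bw _]; subst; case: (leaf_step F iN bw) => [[_ []]//|[_ e]|[eb _ _]].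
    by rewrite e ltnn in iN.
  by move: rl; rewrite eb /inv eqxx.
Qed.

(** A leaf can only be an end of a reduced walk, so each node adds at most two letters. A closed
    walk at the leaf leaves and re-enters by the same edge; the middle part is closed and reduced at
    [i], hence empty, and the two remaining letters cancel. *)
Lemma forest_walk N E : forest N E -> forall l i j, reduced l ->
  walk (nodeR E) l i j -> (size l <= 2 * N)%N /\ (i = j -> l = [::]).
Proof.
elim=> {N E} [|N E F IH|N E i k d F IH iN new] l x y rl.
- by case: l rl => //= -[k []] l _ [].
- by move=> /(IH _ _ _ rl)[sl h]; split=> //; apply: leq_trans sl _; rewrite leq_mul2l leqW.
have [-> {x}|xN] := pselect (x = N); last first.
  move=> /(leaf_walk F iN xN rl)[[yN w]|[-> [l' el w]]].
    by have [sl h] := IH _ _ _ rl w; split=> //; apply: leq_trans sl _; rewrite leq_mul2l leqW.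
  rewrite el -cats1 in rl; have [rl' _] := reduced_cat rl.
  have [sl h] := IH _ _ _ rl' w; split=> [|/xN//].
  by rewrite el size_rcons mulnS addSn ltnS leqW.
case: l rl => [//|a l] rl [z az zy].
case: (leaf_step F iN az) => [[_ []]//|[_ e _]|[ea _ ez]].
  by rewrite e ltnn in iN.
subst z; have iN' : i <> N by move=> e; rewrite e ltnn in iN.
have rl' := reduced_cons rl.
have [[yN w]|[yN [l' el w]]] := leaf_walk F iN iN' rl' zy.
  have [sl h] := IH _ _ _ rl' w; split=> [|e]; last by rewrite e in yN.
  by rewrite /= mulnS addSn ltnS leqW.
rewrite el -cats1 in rl'; have [rl1 _] := reduced_cat rl'.
have [sl h] := IH _ _ _ rl1 w; split=> [|_].
  by rewrite el /= size_rcons mulnS.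
by move: rl; rewrite el (h erefl) ea /reduced /= /inv negbK eqxx.
Qed.

End Forest.

(** * Operations on forests and product walks *)

Section ForestOps.

(** Used mainly to keep the labels closed at a level and restrict them to it. Restriction must not
    identify two kept labels, or a node could get two edges with the same label and direction. *)
Lemma forest_filter_map (L L' : eqType) (m : L -> L') (p : pred L) N
    (E : seq (nat * L * nat)) :
  (forall e e', e \in E -> e' \in E -> p e.1.2 -> p e'.1.2 ->
     m e.1.2 = m e'.1.2 -> e.1.2 = e'.1.2) ->
  forest N E ->
  forest N [seq (e.1.1, m e.1.2, e.2) | e <- E & p e.1.2].
Proof.
move=> h F; elim: F h => {N E} [_|N E F IH h|N E i k d F IH iN new h].
- exact: forest0.
- by apply: forest_node; apply: IH.
have IH' : forest N [seq (e.1.1, m e.1.2, e.2) | e <- E & p e.1.2].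
  by apply: IH => e e' eE e'E; apply: h; rewrite inE ?eE ?e'E orbT.
rewrite /=; have -> : (edge d i k N).1.2 = k by case: d {new h}.
case: ifP => pk; last exact: forest_node.
have -> : map (fun e => (e.1.1, m e.1.2, e.2)) (edge d i k N :: [seq e <- E | p e.1.2])
   = edge d i (m k) N :: [seq (e.1.1, m e.1.2, e.2) | e <- E & p e.1.2].
  by case: d {new h}.
apply: forest_leaf => // j /mapP[[[a k'] b]]; rewrite mem_filter /= => /andP[pk' eE] e.
have ek : k = k'.
  have /= := h (edge d i k N) (a, k', b); rewrite !inE eqxx eE orbT.
  have -> : (edge d i k N).1.2 = k by case: d {new h e}.
  by apply=> //; case: d e {new h} => -[].
by apply: (new j); case: d e {new h} => -[e1 _ e2]; rewrite /edge ek e1 e2.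
Qed.

Lemma forest_cat (L : eqType) N (E : seq (nat * L * nat)) M E' :
  forest N E -> forest M E' ->
  forest (N + M) ([seq ((N + e.1.1)%N, e.1.2, (N + e.2)%N) | e <- E'] ++ E).
Proof.
move=> F; elim=> {M E'} [|M E' F' IH|M E' i k d F' IH iM new].
- by rewrite addn0.
- by rewrite addnS; apply: forest_node.
rewrite addnS map_cons cat_cons.
have -> : ((N + (edge d i k M).1.1)%N, (edge d i k M).1.2, (N + (edge d i k M).2)%N) =
  edge d (N + i)%N k (N + M)%N by case: d {new}.
apply: forest_leaf => //; first by rewrite ltn_add2l.
move=> j; rewrite mem_cat => /orP[/mapP[[[a k'] b] eE]|].
  case: d new => new -[].
    by move=> /addnI ea ek _; apply: (new b); rewrite /edge ea ek.
  by move=> _ ek /addnI eb; apply: (new a); rewrite /edge eb ek.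
by move/(edge_bound F) => [+ _]; rewrite ltnNge leq_addr.
Qed.

End ForestOps.

Section Product.
Variables (L : eqType) (X : Type).
Implicit Types (R : L -> X -> X -> Prop) (E : seq (nat * L * nat)).

(** A pair [(i, x)] stands for the question whether [x] belongs to the trace at node [i]; a product
    step leads to a question that must have the same answer. *)
Definition prodR E R k (p q : nat * X) := nodeR E k p.1 q.1 /\ R k p.2 q.2.

Lemma prodR_det E R :
  deterministic (nodeR E) -> deterministic R -> deterministic (prodR E R).
Proof.
move=> dE dR [k d] [i x] [j y] [j' y'].
have h : forall a b, step (prodR E R) (k, d) a b ->
    step (nodeR E) (k, d) a.1 b.1 /\ step R (k, d) a.2 b.2.
  by move=> a b; case: d.
by move=> /h[/= ? ?] /h[/= ? ?]; congr pair; [apply: (dE (k, d) i)|apply: (dR (k, d) x)].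
Qed.

Lemma prodR_walk E R l p q : walk (prodR E R) l p q ->
  [/\ walk (nodeR E) l p.1 q.1, walk R l p.2 q.2
    & on [seq e.1.2 | e <- E] l].
Proof.
elim: l p => [|[k d] l IH] p /=; first by move=> ->.
move=> [r ar /IH[h1 h2 h3]]; split; last first.
  apply/andP; split=> //.
  by apply/mapP; case: d ar => -[e _]; [exists (p.1, k, r.1)|exists (r.1, k, p.1)].
by exists r.2 => //; case: d ar => -[].
by exists r.1 => //; case: d ar => -[].
Qed.

End Product.

(** * Traces and partial isomorphisms *)

Record omega1_like (d : Order.disp_t) (T : orderType d) : Prop := Omega1Like {
  ol_wf : well_founded (fun a b : T => a < b);
  ol_init : forall b : T, enumerable (fun a => a < b);
  ol_bounded : forall e : nat -> T, exists b, forall n, e n < b }.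

Section Defs.
Context {d : Order.disp_t} {T : orderType d}.

Notation V := (T * nat)%type.

Definition cut (b : T) (s : set V) : set V := fun v => s v /\ v.1 < b.

(* A guess: [lW] is the range of the isomorphism to be built, [lC] the set of
   levels at which it is already closed, and [l0] a level at which it is
   decided which traces extend to vertices of [lW]. *)
Record label := Label { lW : set V; lC : set T; l0 : T }.

HB.instance Definition _ := gen_eqMixin label.

Definition res (c : T) (k : label) : label :=
  Label (cut c (lW k)) (fun a => lC k a /\ a < c) (l0 k).

(* [T * nat] is the vertex set and [a] the level of [(a, n)]; [tr S x] is the set
   of neighbours of [x] of lower level, and [iso S c k] the graph of the
   isomorphism between the levels below [c] and [lW k]. *)
Record system := System {
  tr : V -> set V;
  iso : T -> label -> V -> V -> Prop;
  guess : T -> set label }.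

Implicit Types (S : system) (k : label) (s t : set V) (x y v : V) (a b c : T).

Definition Tr S c s := exists n, s = tr S (c, n).

Definition ext S b s : set V := fun y => b <= y.1 /\ cut b (tr S y) = s.

Definition joined S x y := (x.1 < y.1 /\ tr S y x) \/ (y.1 < x.1 /\ tr S x y).

Definition alive S k s := Tr S (l0 k) s /\ exists2 y, lW k y & ext S (l0 k) s y.

(* [limpt Y n.+1 b]: [b] is a limit of points at which [limpt Y n] holds. Having
   all finite ranks at hand lets [stable_limpt] find a limit point of [Y] near
   which each of finitely many closed sets is constantly present or absent. *)
Fixpoint limpt (Y : set V) n b : Prop :=
  if n is m.+1 then forall a, a < b -> exists c, [/\ a < c, c < b & limpt Y m c]
  else forall a (l : seq V), a < b ->
    exists y, [/\ Y y, a <= y.1, y.1 < b & y \notin l].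

(** All ranks at once, because the rank consumed in [no_loops] is one more than the number of labels
    in play, which is not known beforehand. *)
Definition big b (Y : set V) :=
  forall n a, a < b -> exists c, [/\ a < c, c < b & limpt Y n c].

(** Room for the construction at [c]: [rich_ext] supplies images in [lW k], [rich_level] supplies
    preimages, and [rich_bits] supplies a first partner of a trace while the label has no closed
    level yet. *)
Record rich S c k : Prop := Rich {
  rich_l0 : l0 k < c;
  rich_ext : forall b s, l0 k <= b -> b < c -> Tr S b s ->
    alive S k (cut (l0 k) s) -> big c (fun y => lW k y /\ ext S b s y);
  rich_bits : forall (q : seq V) (u : V -> Prop),
    (forall x, x \in q -> lW k x /\ x.1 < l0 k) ->
    exists2 s, alive S k s & forall x, x \in q -> (s x <-> u x);
  rich_level : forall b s, b < c -> Tr S b s -> big c (ext S b s) }.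

(* The labels whose isomorphism has to be defined at level [b]; the clauses pass
   to the restrictions [res c k], [c] in [lC k]. *)
Record legit S b k : Prop := Legit {
  legit_W : forall y, lW k y -> y.1 < b;
  legit_C : forall c, lC k c -> l0 k < c /\ c < b;
  legit_closed : forall c, c < b -> (exists2 a, lC k a & a < c) ->
    (forall a, a < c -> exists a', [/\ lC k a', a < a' & a' < c]) -> lC k c;
  legit_pt : forall c, lC k c \/ c = b ->
    [/\ guess S c (res c k), rich S c (res c k)
      & forall s, alive S (res c k) s <-> alive S k s] }.

(* The part of the isomorphism of [k] that is inherited from levels below. *)
Definition low S k x y := exists2 c, lC k c & iso S c (res c k) x y.

(* [t] is the image of the trace [s] under the partial isomorphism [R k]. *)
Definition sends S (R : label -> V -> V -> Prop) k s t :=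
  alive S k (cut (l0 k) t) /\ forall x y, R k x y -> (s x <-> t y).

(** At a lower level an edge is known only through the restriction of its label; labels that agree
    there would merge different edges. *)
Definition sep b (ks : seq label) :=
  forall k k', k \in ks -> k' \in ks -> res b k = res b k' -> k = k'.

Definition labs (E : seq (nat * label * nat)) := [seq e.1.2 | e <- E].

(* A finite forest of traces of level [c], together with a prediction [v] of
   their extensions to all levels that is coherent with the maps [R]. *)
Record fam S b (R : label -> V -> V -> Prop) N (E : seq (nat * label * nat))
    (t : nat -> set V) (c : T) (v : nat -> V -> Prop) : Prop := Fam {
  fam_forest : forest N E;
  fam_legit : forall k, k \in labs E -> legit S b k /\ l0 k <= c;
  fam_sep : sep c (labs E);
  fam_Tr : forall i, (i < N)%N -> Tr S c (t i);
  fam_alive : forall i k j, (i, k, j) \in E -> alive S k (cut (l0 k) (t j));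
  fam_inv : forall i k j x y, (i, k, j) \in E -> R k x y -> (v i x <-> v j y);
  fam_val : forall i x, (i < N)%N -> x.1 < c -> (v i x <-> t i x) }.

Definition letter := (T * label)%type.

(* The letters of the walks considered below level [b]: the whole isomorphism of
   a label at a level below [b], or the inherited part of one at [b]. *)
Definition letR S b (a : letter) x y :=
  (a.1 < b /\ legit S a.1 a.2 /\ iso S a.1 a.2 x y) \/
  (a.1 = b /\ legit S b a.2 /\ low S a.2 x y).

(** The first clause keeps [z] away from values that are already decided; the second lets the bits
    at [z] be chosen independently at the nodes of a forest ([free_values]). *)
Definition isolated (R : letter -> V -> V -> Prop) (Ls : seq letter) n
    (X : set V) z :=
  (forall l x, (size l <= n)%N -> on Ls l -> X x -> ~ walk R l x z) /\
  (forall l, (size l <= n)%N -> on Ls l -> reduced l -> walk R l z z -> l = [::]).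

(* What the traces [Tb] and isomorphisms [Phi] of level [b] must satisfy.
   [st_free] says that the partner relation on traces is acyclic, [st_dec] that
   traces are generic for guessed sets of vertices, and [st_new] that the pairs
   added at [b] are listed so that each brings in one vertex [z] which short
   walks do not link to lower levels, to earlier points or to itself. *)
Record stage S b (Tb : set (set V)) (Phi : label -> V -> V -> Prop) : Prop := Stage {
  st_ne : exists s, Tb s;
  st_sub : forall s x, Tb s -> s x -> x.1 < b;
  st_cut : forall s c, Tb s -> c < b -> Tr S c (cut c s);
  st_wf : forall k x y, legit S b k -> Phi k x y -> x.1 < b /\ lW k y;
  st_dom : forall k x, legit S b k -> x.1 < b -> exists y, Phi k x y;
  st_ran : forall k y, legit S b k -> lW k y -> exists x, Phi k x y;
  st_fun : forall k x y y', legit S b k -> Phi k x y -> Phi k x y' -> y = y';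
  st_inj : forall k x x' y, legit S b k -> Phi k x y -> Phi k x' y -> x = x';
  st_low : forall k x y, legit S b k -> low S k x y -> Phi k x y;
  st_adj : forall k x y x' y', legit S b k -> Phi k x y -> Phi k x' y' ->
    (joined S x x' <-> joined S y y');
  st_fwd : forall k s, legit S b k -> Tb s ->
    exists2 t, Tb t & sends S Phi k s t;
  st_bwd : forall k t, legit S b k -> Tb t -> alive S k (cut (l0 k) t) ->
    exists2 s, Tb s & sends S Phi k s t;
  st_uniq : forall k s t t', legit S b k -> Tb t -> Tb t' ->
    sends S Phi k s t -> sends S Phi k s t' -> t = t';
  st_free : forall l s, Tb s -> reduced l ->
    (forall e, e \in l -> legit S b e.1) ->
    walk (fun k s t => [/\ Tb s, Tb t & sends S Phi k s t]) l s s -> l = [::];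
  st_dec : forall k s, guess S b k -> Tb s -> (exists c, c < b) ->
    exists2 c, c < b & (exists v, [/\ lW k v, v.1 = c & tr S v = cut c s]) \/
      ~ (exists v, [/\ lW k v, v.1 < b & ext S c (cut c s) v]);
  st_fam : forall N E (t : nat -> set V) c (v : nat -> V -> Prop) (Q : seq (nat * V)),
    c < b -> fam S b Phi N E t c v ->
    exists t' : nat -> set V, [/\ forall i, (i < N)%N -> Tb (t' i) /\ cut c (t' i) = t i,
      forall i k j, (i, k, j) \in E -> sends S Phi k (t' i) (t' j)
      & forall i x, (i, x) \in Q -> (i < N)%N -> x.1 < b -> (t' i x <-> v i x)];
  st_new : exists es : nat -> option (label * bool * V * V),
    [/\ forall k x y, legit S b k -> Phi k x y -> low S k x y \/
          exists j d u z, [/\ es j = Some (k, d, u, z),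
            x = (if d then u else z) & y = (if d then z else u)],
        forall j k d u z, es j = Some (k, d, u, z) -> z <> u /\
          forall i k' d' u' z', (i < j)%N -> es i = Some (k', d', u', z') ->
            z <> u' /\ z <> z'
      & forall Ls n c, c < b -> exists J, forall j k d u z, (J <= j)%N ->
          es j = Some (k, d, u, z) ->
          isolated (letR S b) Ls n (fun w => w.1 < c \/ w = u \/
            exists i k' d' u' z', [/\ (i < j)%N, es i = Some (k', d', u', z')
              & w = u' \/ w = z']) z] }.

Definition good S b := stage S b (Tr S b) (iso S b).

End Defs.

(** * Restrictions of labels and inherited isomorphisms *)

Section Basics.
Context {d : Order.disp_t} {T : orderType d} (HT : omega1_like T).
Notation V := (T * nat)%type.
Implicit Types (S : @system d T) (k : @label d T) (s t : set V) (x y : V) (a b c : T).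

Lemma ol_min (P : T -> Prop) : (exists a, P a) ->
  exists m, P m /\ forall a, P a -> m <= a.
Proof.
move=> [a]; elim/(well_founded_ind (ol_wf HT)): a => a IH Pa.
have [[c ca Pc]|n] := pselect (exists2 c, c < a & P c); first exact: IH ca Pc.
by exists a; split=> // c Pc; case: (leP a c) => // ca; case: n; exists c.
Qed.

Lemma ol_ind (P : T -> Prop) :
  (forall b, (forall c, c < b -> P c) -> P b) -> forall b, P b.
Proof. by move=> h b; elim/(well_founded_ind (ol_wf HT)): b. Qed.

Lemma seq_bound (X : eqType) (s : seq X) (P : X -> T -> Prop) b a :
  a < b -> (forall z, z \in s -> exists2 c, c < b & P z c) ->
  (forall z c c', P z c -> c <= c' -> P z c') ->
  exists c, [/\ c < b, a <= c & forall z, z \in s -> P z c].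
Proof.
move=> ab h mP; elim: s h => [|x s IH] h; first by exists a; split.
have [|c [cb ac cP]] := IH; first by move=> y ys; apply: h; rewrite inE ys orbT.
have [c' c'b Pc'] := h x (mem_head _ _).
exists (Order.max c c'); split; first by rewrite gt_max cb.
  by rewrite le_max ac.
move=> y; rewrite inE => /orP[/eqP ->|/cP Py].
  by apply: mP Pc' _; rewrite le_max lexx orbT.
by apply: mP Py _; rewrite le_max lexx.
Qed.

Lemma set_eq (X : Type) (A B : set X) : (forall z, A z <-> B z) -> A = B.
Proof. by move=> h; apply: funext => z; apply: propext. Qed.

Lemma cut_cut a b s : a <= b -> cut a (cut b s) = cut a s.
Proof.
move=> ab; apply: set_eq => x; split=> [[[? _] ?] //|[? xa]]; split=> //.
by split=> //; exact: lt_le_trans xa ab.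
Qed.

Lemma cut_id b s : (forall x, s x -> x.1 < b) -> cut b s = s.
Proof. by move=> h; apply: set_eq => x; split=> [[]//|sx]; split=> //; exact: h. Qed.

Lemma res_res c c' k : c <= c' -> res c (res c' k) = res c k.
Proof.
move=> cc'; rewrite /res /= cut_cut //; congr Label; apply: set_eq => a.
by split=> [[[]]//|[? ac]]; do 2!split=> //; exact: lt_le_trans ac cc'.
Qed.

Lemma res_id S b k : legit S b k -> res b k = k.
Proof.
case=> hW hC _ _; case: k hW hC => W C l /= hW hC; rewrite /res /= cut_id //.
by congr Label; apply: set_eq => a; split=> [[]//|Ca]; split=> //; case: (hC a).
Qed.

Lemma legit_l0 S b k : legit S b k -> l0 k < b.
Proof. by case=> _ _ _ /(_ b (or_intror erefl)) [_ []]. Qed.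

Lemma legit_res S b k c : legit S b k -> lC k c -> legit S c (res c k).
Proof.
move=> L Cc; case: (L) => hW hC hcl hpt; split=> /=.
- by move=> y [].
- by move=> a [/hC[]].
- move=> a ac [a1 [Ca1 _] a1a] h; split=> //; apply: hcl.
  + by apply: lt_trans ac _; case: (hC c).
  + by exists a1.
  + by move=> a2 /h [a3 [[? _] ? ?]]; exists a3.
- move=> a h; have ac : a <= c by case: h => [[_ /ltW]|->].
  have /hpt [h1 h2 h3] : lC k a \/ a = b.
    by left; case: h => [[]|->].
  rewrite res_res //; split=> // s.
  have [_ _ h4] := hpt c (or_introl Cc).
  by rewrite h4 h3.
Qed.

Lemma alive_res S b k c s : legit S b k -> lC k c ->
  (alive S (res c k) s <-> alive S k s).
Proof. by move=> [_ _ _ h] Cc; case: (h c (or_introl Cc)). Qed.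

(** The least upper bound of the closed levels below [c] is itself closed, for otherwise it would be
    a limit of closed levels. The case [c = b] needs its own hypothesis because [legit_closed]
    speaks only of levels below [b]. *)
Lemma legit_max S b k c : legit S b k -> l0 k < c -> c <= b -> ~ lC k c ->
  (c = b -> ~ forall a, a < c -> exists a', [/\ lC k a', a < a' & a' < c]) ->
  exists a, [/\ l0 k <= a, a < c, forall a', lC k a' -> a' < c -> a' <= a
    & lC k a \/ (a = l0 k /\ forall a', lC k a' -> a' < c -> False)].
Proof.
move=> L lc cb nC ncof.
have [[c1 Cc1 c1c]|none] := pselect (exists2 c1, lC k c1 & c1 < c); last first.
  by exists (l0 k); split=> // [a' ? ?|]; [case: none; exists a'
    |right; split=> // a' ? ?; case: none; exists a'].
have [a0 a0c ha0] : exists2 a0, a0 < c & forall a', lC k a' -> a' < c -> a' <= a0.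
  apply: contrapT => n.
  have cof : forall a, a < c -> exists a', [/\ lC k a', a < a' & a' < c].
    move=> a ac; apply: contrapT => n'; apply: n; exists a => // a' Ca' a'c.
    by case: (leP a' a) => // aa'; case: n'; exists a'.
  move: cb; rewrite le_eqVlt => /orP[/eqP e|cb]; first exact: ncof.
  by apply: nC; apply: (legit_closed L) => //; exists c1.
have [m [hm mmin]] : exists m, (forall a', lC k a' -> a' < c -> a' <= m) /\
    forall a, (forall a', lC k a' -> a' < c -> a' <= a) -> m <= a.
  by apply: ol_min; exists a0.
have mc : m < c by apply: le_lt_trans (mmin _ ha0) a0c.
exists m; split=> //.
  by apply: le_trans (hm _ Cc1 c1c); apply: ltW; case: (legit_C L Cc1).
left; apply: contrapT => nm.
have Clt : forall a', lC k a' -> a' < c -> a' < m.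
  move=> a' Ca' a'c; rewrite lt_neqAle hm // andbT.
  by apply/eqP => e; apply: nm; rewrite -e.
apply: nm; apply: (legit_closed L).
- exact: lt_le_trans mc cb.
- by exists c1 => //; exact: Clt.
- move=> a am; apply: contrapT => n.
  have : m <= a; last by rewrite leNgt am.
  apply: mmin => a' Ca' a'c; case: (leP a' a) => // aa'; case: n; exists a'.
  by split=> //; exact: Clt.
Qed.

Section Below.
Variables (S : @system d T) (b : T).
Hypothesis G : forall c, c < b -> good S c.

Lemma Tr_cut c c' s : c < c' -> c' < b -> Tr S c' s -> Tr S c (cut c s).
Proof. by move=> cc' c'b hs; apply: (st_cut (G c'b)). Qed.

Lemma Tr_cut_le c c' s : c <= c' -> c' < b -> Tr S c' s -> Tr S c (cut c s).
Proof.
rewrite le_eqVlt => /orP[/eqP <-|cc'] c'b hs; last exact: Tr_cut hs.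
by rewrite cut_id // => x; apply: (st_sub (G c'b) hs).
Qed.

Lemma Tr_sub c s x : c < b -> Tr S c s -> s x -> x.1 < c.
Proof. by move=> cb hs; apply: (st_sub (G cb)). Qed.

Lemma tr_Tr y : Tr S y.1 (tr S y).
Proof. by exists y.2; case: y. Qed.

Lemma legit_lt k c : legit S b k -> lC k c -> c < b.
Proof. by move=> L /(legit_C L) []. Qed.

Lemma iso_mono k c c' x y : legit S b k -> lC k c -> lC k c' -> c <= c' ->
  iso S c (res c k) x y -> iso S c' (res c' k) x y.
Proof.
move=> L Cc Cc'; rewrite le_eqVlt => /orP[/eqP -> //|cc' h].
apply: (st_low (G (legit_lt L Cc')) (legit_res L Cc')).
by exists c => //; rewrite res_res // ltW.
Qed.

Lemma low_max k c x y : legit S b k -> lC k c -> low S k x y ->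
  exists c', [/\ lC k c', c <= c' & iso S c' (res c' k) x y].
Proof.
move=> L Cc [c1 Cc1 h]; case: (leP c c1) => cc1; first by exists c1.
by exists c; split=> //; apply: iso_mono h => //; exact: ltW.
Qed.

Lemma low_det k x y y' : legit S b k -> low S k x y -> low S k x y' -> y = y'.
Proof.
move=> L [c Cc h] /(low_max L Cc)[c' [Cc' cc' h']].
by apply: (st_fun (G (legit_lt L Cc')) (legit_res L Cc') _ h'); apply: iso_mono h.
Qed.

Lemma low_inj k x x' y : legit S b k -> low S k x y -> low S k x' y -> x = x'.
Proof.
move=> L [c Cc h] /(low_max L Cc)[c' [Cc' cc' h']].
by apply: (st_inj (G (legit_lt L Cc')) (legit_res L Cc') _ h'); apply: iso_mono h.
Qed.

Lemma low_deterministic :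
  deterministic (fun (k : @label d T) x y => legit S b k /\ low S k x y).
Proof.
move=> [k []] x y z [L h] [_ h']; first exact: low_det h h'.
exact: low_inj h h'.
Qed.

(** At a closed level [c] the map is already total below [c] and onto the part of [lW k] below [c];
    by uniqueness no later pair can have a coordinate there. *)
Lemma low_at k c x y : legit S b k -> lC k c -> low S k x y ->
  x.1 < c \/ y.1 < c -> iso S c (res c k) x y.
Proof.
move=> L Cc h h'; have Gc := G (legit_lt L Cc); have Lc := legit_res L Cc.
case: h' => h'.
  have [y' hy'] := st_dom Gc Lc h'.
  by rewrite (low_det L h (y' := y')) //; exists c.
have [c1 [Cc1 cc1 h1]] := low_max L Cc h.
have [_ /= [Wy _]] := st_wf (G (legit_lt L Cc1)) (legit_res L Cc1) h1.
have [x' hx'] := st_ran Gc Lc (conj Wy h').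
by rewrite (low_inj L h (x' := x')) //; exists c.
Qed.

Lemma low_wf k x y : legit S b k -> low S k x y ->
  [/\ x.1 < b, y.1 < b, lW k y & exists c, [/\ lC k c, x.1 < c & y.1 < c]].
Proof.
move=> L [c Cc h]; have cb := legit_lt L Cc.
have [xc [Wy yc]] := st_wf (G cb) (legit_res L Cc) h.
split=> //; first exact: lt_trans xc cb.
  exact: lt_trans yc cb.
by exists c.
Qed.

Lemma low_lt k c x y : legit S b k -> lC k c -> low S k x y ->
  (x.1 < c) = (y.1 < c).
Proof.
move=> L Cc h; apply/idP/idP => h'.
  have [_ [//]] := st_wf (G (legit_lt L Cc)) (legit_res L Cc) (low_at L Cc h (or_introl h')).
by have [] := st_wf (G (legit_lt L Cc)) (legit_res L Cc) (low_at L Cc h (or_intror h')).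
Qed.

Lemma low_dom k c x : legit S b k -> lC k c -> x.1 < c -> exists y, low S k x y.
Proof.
move=> L Cc xc; have [y h] := st_dom (G (legit_lt L Cc)) (legit_res L Cc) xc.
by exists y, c.
Qed.

Lemma low_ran k c y : legit S b k -> lC k c -> lW k y -> y.1 < c ->
  exists x, low S k x y.
Proof.
move=> L Cc Wy yc.
have [x h] := st_ran (G (legit_lt L Cc)) (legit_res L Cc) (conj Wy yc).
by exists x, c.
Qed.

Lemma low_adj k x y x' y' : legit S b k -> low S k x y -> low S k x' y' ->
  (joined S x x' <-> joined S y y').
Proof.
move=> L [c Cc h] /(low_max L Cc)[c' [Cc' cc' h']].
by apply: (st_adj (G (legit_lt L Cc')) (legit_res L Cc') _ h'); apply: iso_mono h.
Qed.

Lemma sends_low k c s t : legit S b k -> lC k c ->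
  (forall x, s x -> x.1 < c) -> (forall x, t x -> x.1 < c) ->
  (sends S (iso S c) (res c k) s t <->
   alive S k (cut (l0 k) t) /\
     forall x y, low S k x y -> x.1 < c -> (s x <-> t y)).
Proof.
move=> L Cc _ _; rewrite /sends /= (alive_res _ L Cc).
split=> -[h1 h2]; split=> // x y.
  by move=> h xc; apply: h2; apply: low_at => //; left.
move=> h; apply: h2; first by exists c.
by have [] := st_wf (G (legit_lt L Cc)) (legit_res L Cc) h.
Qed.

End Below.
End Basics.

(** * Walks leaving and re-entering a level *)

Section WalkMore.
Variables (A : eqType) (X : Type).
Implicit Types (R : A -> X -> X -> Prop) (a : A * bool) (l : seq (A * bool)).

Lemma step_mono R R' : (forall k x y, R k x y -> R' k x y) ->
  forall a x y, step R a x y -> step R' a x y.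
Proof. by move=> h [k []] x y; apply: h. Qed.

Lemma walk_mono R R' l x y : (forall k x y, R k x y -> R' k x y) ->
  walk R l x y -> walk R' l x y.
Proof.
move=> h; elim: l x => //= a l IH x [z az /IH zy].
by exists z => //; apply: step_mono az.
Qed.

Lemma walk_on_mono R R' (Ls : seq A) l x y :
  (forall k x y, k \in Ls -> R k x y -> R' k x y) -> on Ls l ->
  walk R l x y -> walk R' l x y.
Proof.
move=> h; elim: l x => //= -[k b] l IH x /andP[kL lL] [z az /(IH _ lL) zy].
by exists z => //; move: az; rewrite /step /=; case: (b); apply: h.
Qed.

Lemma walk_split R1 R2 l x y :
  walk (fun k x y => R1 k x y \/ R2 k x y) l x y ->
  walk R1 l x y \/ exists l1 a l2 p q, [/\ l = l1 ++ a :: l2, walk R1 l1 x p,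
    step R2 a p q & walk (fun k x y => R1 k x y \/ R2 k x y) l2 q y].
Proof.
elim: l x => [|a l IH] x /=; first by left.
move=> [z az zy]; have [az1|az2] : step R1 a x z \/ step R2 a x z.
- by case: a az => k [] /= [?|?]; [left|right|left|right].
- have [w|[l1 [b [l2 [p [q [-> w1 s w2]]]]]]] := IH z zy.
    by left; exists z.
  by right; exists (a :: l1), b, l2, p, q; split=> //; exists z.
- by right; exists [::], a, l, x, z.
Qed.

Lemma walk_restrict R (P : X -> Prop) l x y : walk R l x y ->
  (forall l1 l2 z, l = l1 ++ l2 -> walk R l1 x z -> P z) ->
  walk (fun k x y => [/\ R k x y, P x & P y]) l x y.
Proof.
elim: l x => //= a l IH x [z az zy] h.
have Px : P x by apply: (h [::] (a :: l)).
have Pz : P z by apply: (h [:: a] l) => //=; exists z.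
exists z; first by case: a az {h} => k [].
apply: IH => // l1 l2 w e w1; apply: (h (a :: l1) l2) => /=; first by rewrite e.
by exists z.
Qed.

Lemma walk_bigger (R : nat -> A -> X -> X -> Prop) l x y :
  (forall m m' k x y, (m <= m')%N -> R m k x y -> R m' k x y) ->
  walk (fun k x y => exists m, R m k x y) l x y -> exists m, walk (R m) l x y.
Proof.
move=> mR; elim: l x => [|[k b] l IH] x /=; first by exists 0%N.
move=> [z az /IH[m zy]]; have [m' az'] : exists m', step (R m') (k, b) x z.
  by case: b az => -[m' ?]; exists m'.
exists (maxn m m'), z.
  by apply: step_mono az' => *; apply: mR; [exact: leq_maxr|eassumption].
by apply: walk_mono zy => *; apply: mR; [exact: leq_maxl|eassumption].
Qed.

Lemma walk_mem R l x y a : walk R l x y -> a \in l -> exists p q, step R a p q.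
Proof.
elim: l x => //= b l IH x [z bz zy]; rewrite inE => /orP[/eqP ->|]; first by exists x, z.
exact: IH zy.
Qed.

Lemma on_cat (Ls : seq A) l1 l2 : on Ls (l1 ++ l2) = on Ls l1 && on Ls l2.
Proof. exact: all_cat. Qed.

End WalkMore.

Section Excursions.
Context {d : Order.disp_t} {T : orderType d} (HT : omega1_like T).
Notation V := (T * nat)%type.
Implicit Types (S : @system d T) (k : @label d T) (s t : set V) (x y : V) (a b c : T).
Implicit Types (Ls : seq (@letter d T)) (e : @letter d T).

Definition fullR S e x y := legit S e.1 e.2 /\ iso S e.1 e.2 x y.

Definition closedpt e c := lC e.2 c \/ c = e.1.

(** The region where the map of [e] is settled by a closed level that is at most [b]; [high] keeps
    the edges outside it. *)
Definition lower e b : set V := fun x => exists2 c, closedpt e c & c <= b /\ x.1 < c.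

Definition high (R : letter -> V -> V -> Prop) b e x y := R e x y /\ ~ lower e b x.

Definition excursion (R : letter -> V -> V -> Prop) Ls n b x l y :=
  [/\ [/\ l <> [::], reduced l, (size l <= n)%N & on Ls l],
      x.1 < b, y.1 < b & walk (high R b) l x y].

Definition finX R Ls n b := exists s : seq V, forall x l y,
  excursion R Ls n b x l y -> x \in s.

Definition sepL b Ls :=
  forall e e', e \in Ls -> e' \in Ls -> res b e.2 = res b e'.2 -> e = e'.

(** The induction alternates: [Xlow] at [b] follows from [Xfull] below [b], and [Xfull] at [b] from
    [Xlow] at [b] by adding the new pairs. Letters must stay distinct after restriction: for a
    letter and one of its own restrictions, one map followed by the inverse of the other could be a
    reduced excursion at infinitely many points. *)
Definition Xfull S c := forall Ls n b, (forall e, e \in Ls -> e.1 <= c) ->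
  sepL b Ls -> finX (fullR S) Ls n b.

Definition Xlow S b := forall Ls n c, c < b -> (forall e, e \in Ls -> e.1 <= b) ->
  sepL c Ls -> finX (letR S b) Ls n c.

Section At.
Variables (S : @system d T) (b : T).
Hypothesis G : forall c, c < b -> good S c.

Lemma letR_full e x y : e.1 < b -> letR S b e x y -> fullR S e x y.
Proof. by move=> h [[_ ?]|[e1 _]] //; rewrite e1 ltxx in h. Qed.

Lemma letR_low e x y : e.1 = b -> letR S b e x y -> legit S b e.2 /\ low S e.2 x y.
Proof. by move=> h [[e1 _]|[_ ?]] //; rewrite h ltxx in e1. Qed.

Lemma full_lt_gen c k c' x y : good S c -> (forall a, a < c -> good S a) ->
  legit S c k -> lC k c' -> iso S c k x y -> (x.1 < c') = (y.1 < c').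
Proof.
move=> Gc Gb L Cc' h; have [xc Wy] := st_wf Gc L h.
apply/idP/idP => h'.
  have [y' hy'] := low_dom Gb L Cc' h'.
  by rewrite (st_fun Gc L h (st_low Gc L hy')) -(low_lt Gb L Cc' hy').
have [x' hx'] := low_ran Gb L Cc' Wy h'.
by rewrite (st_inj Gc L h (st_low Gc L hx')) (low_lt Gb L Cc' hx').
Qed.

End At.

Lemma letR_lt S b e c x y : (forall c, c < b -> good S c) ->
  closedpt e c -> letR S b e x y -> (x.1 < c) = (y.1 < c).
Proof.
move=> G hc [[eb [L h]]|[eb [L h]]]; case: hc => hc.
- apply: (full_lt_gen (G _ eb) _ L hc h) => a ae.
  by apply: G; exact: lt_trans ae eb.
- by have [h1 /(legit_W L) h2] := st_wf (G _ eb) L h; rewrite hc h1 h2.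
- exact: (low_lt G L hc h).
- by have [h1 h2 _ _] := low_wf G L h; rewrite hc eb h1 h2.
Qed.

Lemma letR_det S b : (forall c, c < b -> good S c) -> deterministic (letR S b).
Proof.
move=> G [e []] x y z; rewrite /step /= => -[[e1 [L h]]|[e1 [L h]]] [[e2 [_ h']]|[e2 [_ h']]].
- exact: (st_fun (G _ e1) L h h').
- by rewrite e2 ltxx in e1.
- by rewrite e1 ltxx in e2.
- exact: (low_det G L h h').
- exact: (st_inj (G _ e1) L h h').
- by rewrite e2 ltxx in e1.
- by rewrite e1 ltxx in e2.
- exact: (low_inj G L h h').
Qed.

Lemma lower_sym S b e c x y : (forall c, c < b -> good S c) ->
  letR S b e x y -> lower e c x <-> lower e c y.
Proof.
by move=> G h; split=> -[c' hc' [c'c xc']]; exists c' => //; split=> //;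
  [rewrite -(letR_lt G hc' h)|rewrite (letR_lt G hc' h)].
Qed.

(** A letter of level below [b] is bounded by its level. A letter of level [b] is stopped by a
    closed level above [c] or at [c] if it has one, and otherwise its inherited map lives below
    [c]. *)
Lemma one_step_bound S b Ls c : (forall c, c < b -> good S c) -> c < b ->
  exists c', [/\ c' < b, c <= c' & forall e x y, e \in Ls -> letR S b e x y ->
    (x.1 < c -> y.1 < c') /\ (y.1 < c -> x.1 < c')].
Proof.
move=> G cb.
have [||c' [h1 h2 h3]] := @seq_bound _ _ _ Ls (fun e c' => forall x y, letR S b e x y ->
    (x.1 < c -> y.1 < c') /\ (y.1 < c -> x.1 < c')) b c cb.
- move=> e _; have [eb|eb] := ltP e.1 b.
    exists e.1 => // x y /(letR_full eb)[L h].
    by have [h1 /(legit_W L) h2] := st_wf (G _ eb) L h.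
  have [[c1 [Cc1 cc1 c1b]]|n] :=
      pselect (exists c1, [/\ lC e.2 c1, c <= c1 & c1 < b]).
    exists c1 => // x y h; have hc : closedpt e c1 by left.
    by split=> h'; [rewrite -(letR_lt G hc h)|rewrite (letR_lt G hc h)];
      exact: lt_le_trans h' cc1.
  exists c => // x y [[e1]|[_ [L h]]]; first by rewrite ltNge eb in e1.
  have [_ _ _ [c1 [Cc1 xc1 yc1]]] := low_wf G L h.
  have c1c : c1 < c.
    by rewrite ltNge; apply/negP => cc1; apply: n; exists c1; split=> //; exact: (legit_lt L Cc1).
  by split=> _; [exact: lt_trans yc1 c1c | exact: lt_trans xc1 c1c].
- move=> e c1 c2 h c12 x y /h[h1 h2]; split=> h'; first exact: lt_le_trans (h1 h') c12.
  exact: lt_le_trans (h2 h') c12.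
- by exists c'; split=> // e x y eL; apply: h3.
Qed.

Lemma ball_bound S b Ls n c : (forall c, c < b -> good S c) -> c < b ->
  exists c', [/\ c' < b, c <= c' & forall l x y, (size l <= n)%N -> on Ls l ->
    x.1 < c -> walk (letR S b) l x y -> y.1 < c'].
Proof.
move=> G; elim: n c => [|n IH] c cb.
  by exists c; split=> // -[|? ?] // x y _ _ h /= <-.
have [c1 [c1b cc1 h1]] := one_step_bound Ls G cb.
have [c2 [c2b c12 h2]] := IH c1 c1b.
exists c2; split=> //; first exact: le_trans cc1 c12.
move=> [|[e dd] l] x y /=.
  by move=> _ _ xc <-; apply: lt_le_trans xc _; exact: le_trans cc1 c12.
rewrite ltnS => ln /andP[eL lL] xc [z az zy]; apply: (h2 l z) => //.
by case: dd az => /h1 -/(_ eL)[]; auto.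
Qed.

(* A label closed cofinally below [b] may be replaced by one of its restrictions
   as long as only points below [g] matter. *)
Lemma low_cut S b k g : (forall c, c < b -> good S c) -> legit S b k -> g < b ->
  (exists2 c, lC k c & forall x y, low S k x y -> x.1 < g -> iso S c (res c k) x y) \/
  (forall x y, ~ low S k x y).
Proof.
move=> G L gb.
have [cof|ncof] := pselect (forall a, a < b -> exists a', [/\ lC k a', a < a' & a' < b]).
  have [c [Cc gc cb]] := cof g gb; left; exists c => // x y h xg.
  by apply: (low_at G L Cc h); left; exact: lt_trans xg gc.
have nCb : ~ lC k b by move=> /(legit_C L)[_]; rewrite ltxx.
have [a [_ ab amax [Ca|[_ none]]]] := legit_max HT L (legit_l0 L) (lexx b) nCb (fun _ => ncof).
  left; exists a => // x y [c Cc h] _.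
  by apply: (iso_mono G L Cc Ca _ h); apply: amax => //; exact: (legit_lt L Cc).
by right=> x y [c Cc _]; apply: (none c Cc); exact: (legit_lt L Cc).
Qed.

(** Walks of length at most [n] from below [c] stay below some [g < b]. Up to [g], a letter of level
    [b] either can be replaced by one of its restrictions or has no high edge, so the walk
    translates to an excursion of letters of lower level. *)
Lemma Xlow_of S b : (forall c, c < b -> good S c) ->
  (forall c, c < b -> Xfull S c) -> Xlow S b.
Proof.
move=> G XF Ls n c cb topL sepc.
have [g [gb cg hg]] := ball_bound Ls n G cb.
(* [e'] replaces [e] on high edges that start below [g]. Equality of the restrictions to [c] makes
   the replacement injective through [sepc], so reduced walks stay reduced. *)
pose Q e e' := [/\ e'.1 < b, res c e'.2 = res c e.2 &
  forall x y, high (letR S b) c e x y -> x.1 < g -> high (fullR S) c e' x y].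
have Qor e : e \in Ls -> (exists e', Q e e') \/
    (forall x y, high (letR S b) c e x y -> x.1 < g -> False).
  move=> eL; have := topL e eL; rewrite le_eqVlt => /orP[/eqP eb|eb]; last first.
    left; exists e; split=> // x y [h nl] _; split=> //; exact: letR_full h.
  have [L|nL] := pselect (legit S b e.2); last first.
    by right=> x y [/(letR_low eb)[L _]]; case: nL.
  have [[c1 Cc1 h1]|none] := low_cut G L gb; last first.
    by right=> x y [/(letR_low eb)[_ h] _] _; apply: none h.
  have [c1c|cc1] := leP c1 c.
    right=> x y [/(letR_low eb)[_ h] nl] xg; apply: nl; exists c1; first by left.
    split=> //; have h' := h1 _ _ h xg.
    by have [] := st_wf (G _ (legit_lt L Cc1)) (legit_res L Cc1) h'.
  left; exists (c1, res c1 e.2); split; first exact: legit_lt L Cc1.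
    by rewrite res_res // ltW.
  move=> x y [/(letR_low eb)[_ h] nl] xg; split.
    by split; [exact: (legit_res L Cc1) | exact: h1].
  move=> [c2 hc2 [c2c xc2]]; apply: nl; exists c2 => //; case: hc2 => /=.
    by move=> [? _]; left.
  by move=> c2e; move: cc1; rewrite -c2e ltNge c2c.
have /choice[m mP] : forall e, exists e', (exists e', Q e e') -> Q e e'.
  move=> e; have [[e' Qe]|n'] := pselect (exists e', Q e e'); first by exists e'.
  by exists e.
pose Ls1 := [seq e <- Ls | `[< exists e', Q e e' >]].
have Ls1P e : e \in Ls1 -> e \in Ls /\ Q e (m e).
  by rewrite mem_filter => /andP[/asboolP Qe eL]; split=> //; exact: mP.
have minj : {in Ls1 &, injective m}.
  move=> e e' /Ls1P[eL [_ Qe _]] /Ls1P[e'L [_ Qe' _]] em.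
  by apply: sepc => //; rewrite -Qe -Qe' em.
have [||c0 [c0b _ hc0]] := @seq_bound _ _ _ (map m Ls1) (fun e c0 => e.1 <= c0) b c cb.
- by move=> _ /mapP[e /Ls1P[_ [h _ _]] ->]; exists (m e).1.
- by move=> e c1 c2 h1 h2; exact: le_trans h1 h2.
have [|s hs] := XF c0 c0b (map m Ls1) n c hc0.
  move=> _ _ /mapP[e eL ->] /mapP[e' e'L ->] eq.
  have [eL1 [_ Qe _]] := Ls1P _ eL; have [e'L1 [_ Qe' _]] := Ls1P _ e'L.
  by congr m; apply: sepc => //; rewrite -Qe -Qe'.
exists s => x l y [[lne rl ln lL] xc yc w].
have wg := walk_restrict (P := fun z => z.1 < g) w.
have {}wg : walk (fun e x y => [/\ high (letR S b) c e x y, x.1 < g & y.1 < g]) l x y.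
  apply: wg => l1 l2 z el w1; apply: (hg l1 x) => //.
  - by apply: leq_trans ln; rewrite el size_cat leq_addr.
  - by move: lL; rewrite el on_cat => /andP[].
  - by apply: walk_mono w1 => ? ? ? [].
have lL1 : on Ls1 l.
  apply/allP => -[e dd] el; rewrite mem_filter (allP lL _ el) andbT; apply/asboolP.
  have [//|none] := Qor e (allP lL _ el); exfalso.
  by have [p [q]] := walk_mem wg el; case: dd {el} => -[h hp hq]; apply: none h _.
apply: (hs x [seq (m p.1, p.2) | p <- l] y); split=> //.
  split; [by case: (l) lne | exact: reduced_map minj lL1 rl | by rewrite size_map |].
  by apply/allP => _ /mapP[[e dd] el ->] /=; apply: map_f; exact: (allP lL1 _ el).
apply: (walk_map (f := id) (Ls := Ls1) _ lL1 wg) => e u z eL [h ug zg].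
by have [_ [_ _ hm]] := Ls1P e eL; apply: hm.
Qed.

End Excursions.

(** * Walks through the pairs added at a level *)

Section NewEdges.
Context {d : Order.disp_t} {T : orderType d} (HT : omega1_like T).
Notation V := (T * nat)%type.
Implicit Types (S : @system d T) (k : @label d T) (x y z u w : V) (a b c : T).
Implicit Types (Ls : seq (@letter d T)) (e : @letter d T).

Definition new_edge b (es : nat -> option (@label d T * bool * V * V)) i e x y :=
  exists k o u z, [/\ es i = Some (k, o, u, z), e = (b, k),
    x = (if o then u else z) & y = (if o then z else u)].

Definition old_or_new S b c (es : nat -> option (@label d T * bool * V * V)) m e x y :=
  high (letR S b) c e x y \/ exists2 i, (i < m)%N & new_edge b es i e x y.

Lemma step_new_edge b es i e o x y : step (new_edge b es i) (e, o) x y ->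
  exists k o' u z, [/\ es i = Some (k, o', u, z), e = (b, k) &
    (o = o' /\ x = u /\ y = z) \/ (o = ~~ o' /\ x = z /\ y = u)].
Proof.
rewrite /step /=; case: o => -[k [o' [u [z [h1 h2 -> ->]]]]];
  exists k, o', u, z; split=> //; by case: o' h1; auto.
Qed.

Lemma old_or_new_split S b c es m l x y : walk (old_or_new S b c es m) l x y ->
  walk (high (letR S b) c) l x y \/ exists l1 e o l2 p q i,
    [/\ l = l1 ++ (e, o) :: l2, walk (high (letR S b) c) l1 x p, (i < m)%N
      & step (new_edge b es i) (e, o) p q].
Proof.
move=> w; have [|[l1 [[e o] [l2 [p [q [el w1 st _]]]]]]] := walk_split
  (R1 := high (letR S b) c) (R2 := fun e x y => exists2 i, (i < m)%N & new_edge b es i e x y) w.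
  by left.
have {st}[i im st] : exists2 i, (i < m)%N & step (new_edge b es i) (e, o) p q.
  by case: o st {el} => -[i ij h]; exists i.
by right; exists l1, e, o, l2, p, q, i.
Qed.

Section Stage.
Variables (S : @system d T) (b : T).
Hypothesis G : forall c, c < b -> good S c.
Variables (es : nat -> option (@label d T * bool * V * V)) (Ls : seq (@letter d T)) (n j : nat) (c : T).
Variables (k0 : @label d T) (o0 : bool) (u0 z0 : V).
Hypothesis ej : es j = Some (k0, o0, u0, z0).
Hypothesis iso_z : isolated (letR S b) Ls n (fun w => w.1 < c \/ w = u0 \/
            exists i k' d' u' z', [/\ (i < j)%N, es i = Some (k', d', u', z')
              & w = u' \/ w = z']) z0.

(** Look at the first new pair on the walk after it has arrived at [z0]. An earlier pair, or the
    pair [j] met at [u0], gives a short link from a forbidden point to [z0]. The pair [j] met at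
    [z0] closes a reduced walk, which is then empty, so the walk turns back at once. *)
Lemma no_forward l y : reduced (((b, k0), o0) :: l) -> on Ls l ->
  (size l <= n)%N -> y.1 < c -> ~ walk (old_or_new S b c es j.+1) l z0 y.
Proof.
move=> rl lL ln yc /old_or_new_split[w|[l1 [e [o [l2 [p [q [i [el w1 ij s1]]]]]]]]].
  apply: (iso_z.1 (wrev l) y); rewrite ?size_wrev ?on_wrev //; first by left.
  by apply: walk_rev; apply: walk_mono w => ? ? ? [].
have [l1n l1L] : (size l1 <= n)%N /\ on Ls l1.
  split; first by apply: leq_trans ln; rewrite el size_cat leq_addr.
  by move: lL; rewrite el on_cat => /andP[].
have {}w1 : walk (letR S b) l1 z0 p by apply: walk_mono w1 => ? ? ? [].
have back : (p.1 < c \/ p = u0 \/ exists i k' d' u' z', [/\ (i < j)%N,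
    es i = Some (k', d', u', z') & p = u' \/ p = z']) -> False.
  move=> h; apply: (iso_z.1 (wrev l1) p); rewrite ?size_wrev ?on_wrev //.
  exact: walk_rev.
have [k [o' [u [z [ei eb dir]]]]] := step_new_edge s1.
move: ij; rewrite ltnS leq_eqVlt => /orP[/eqP ij|ij]; last first.
  apply: back; right; right; exists i, k, o', u, z; split=> //.
  by case: dir => -[_ [-> _]]; [left|right].
move: ei; rewrite ij ej => -[ek eo eu ez]; subst k o' u z.
case: dir => -[eo [ep eq]]; first by apply: back; right; left.
have rl1 : reduced l1.
  by move: (reduced_cons rl); rewrite el => /reduced_cat[].
have l1nil : l1 = [::] by apply: iso_z.2 => //; rewrite -{2}ep.
by move: rl; rewrite el l1nil /reduced /= eb eo /inv eqxx.
Qed.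

End Stage.

(** Late pairs in the list of [st_new] bring in isolated vertices. An excursion through such a pair
    would have to get from the new vertex back below [b], against [no_forward]. One that uses only
    early pairs starts within [n] old steps of their finitely many endpoints, and one without new
    pairs falls under [Xlow]. *)
Lemma Xfull_of S c : (forall c', c' < c -> good S c') -> good S c ->
  Xlow S c -> Xfull S c.
Proof.
move=> G Gc XL Ls n b topL sepb.
have [cb|bc] := leP c b.
  exists [::] => x l y [[lne _ _ lL] xb yb w]; exfalso.
  case: l lne lL w => // -[e o] l _ /andP[/= eL _] [z ez _].
  have eb : e.1 <= b by exact: le_trans (topL _ eL) cb.
  have hi p q : high (fullR S) b e p q -> False.
    move=> [[L h] nl]; apply: nl; exists e.1; first by right.
    split=> //; have Ge : good S e.1.
      by have := topL _ eL; rewrite le_eqVlt => /orP[/eqP ->|/G].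
    by have [] := st_wf Ge L h.
  by case: o ez => /hi.
have [s1 hs1] := XL Ls n b bc topL sepb.
have [es [es1 es2 es3]] := st_new Gc.
have [J hJ] := es3 Ls n b bc.
pose M := flatten [seq (if es i is Some (k, o, u, z) then [:: u; z] else [::]) | i <- iota 0 J].
have MP i k o u z w : (i < J)%N -> es i = Some (k, o, u, z) -> w = u \/ w = z -> w \in M.
  move=> iJ ei h; apply/flattenP; exists [:: u; z].
    by apply/mapP; exists i; rewrite ?mem_iota ?ei.
  by case: h => ->; rewrite !inE eqxx ?orbT.
have [s2 hs2] := @walk_fin _ _ (letR S c) Ls n M (letR_det G).
exists (s1 ++ s2) => x l y [[lne rl ln lL] xb yb w]; rewrite mem_cat.
have ex_m : exists m, walk (old_or_new S c b es m) l x y.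
  apply: (walk_bigger (R := old_or_new S c b es)) => [m m' e p q mm' [h|[i im h]]|].
  - by left.
  - by right; exists i => //; exact: leq_trans im mm'.
  apply: walk_on_mono lL w => e p q eL [[L h] nl].
  have := topL _ eL; rewrite le_eqVlt => /orP[/eqP ec|ec]; last first.
    by exists 0%N; left; split=> //; left.
  case: e ec nl L h {eL} => e k /= -> nl L h.
  have [lo|[i [o [u [z [ei ep eq]]]]]] := es1 _ _ _ L h.
    by exists 0%N; left; split=> //; right.
  by exists i.+1; right; exists i => //; exists k, o, u, z.
(* With [m] minimal, the new pair of largest index on the walk has index [m - 1]. *)
have [m [wm mmin]] : exists m, walk (old_or_new S c b es m) l x y /\
    forall m', (m' < m)%N -> ~ walk (old_or_new S c b es m') l x y.
  have exm : exists m, `[< walk (old_or_new S c b es m) l x y >].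
    by case: ex_m => m hm; exists m; apply/asboolP.
  case: (ex_minnP exm) => m /asboolP hm mmin; exists m; split=> // m' m'm hm'.
  by have := mmin m' (introT (asboolP _) hm'); rewrite leqNgt m'm.
have [mJ|] := leqP m J.
  have [wl|[l1 [e [o [l2 [p [q [i [el w1 im st]]]]]]]]] := old_or_new_split wm.
    by rewrite (hs1 x l y).
  have [k [o' [u [z [ei _ dir]]]]] := step_new_edge st.
  have pM : p \in M.
    apply: (MP i k o' u z) => //; first exact: leq_trans im mJ.
    by case: dir => -[_ [-> _]]; [left|right].
  rewrite (hs2 (wrev l1) p x) ?orbT ?size_wrev ?on_wrev //.
  - by apply: leq_trans ln; rewrite el size_cat leq_addr.
  - by move: lL; rewrite el on_cat => /andP[].
  - by apply: walk_rev; apply: walk_mono w1 => ? ? ? [].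
case: m wm mmin => // j wm mmin; rewrite ltnS => Jj; exfalso.
have wm' : walk (fun e p q => old_or_new S c b es j e p q \/ new_edge c es j e p q) l x y.
  apply: walk_mono wm => e p q [h|[i]]; first by left; left.
  rewrite ltnS leq_eqVlt => /orP[/eqP -> h|ij h]; first by right.
  by left; right; exists i.
have [wj|[l1 [[e o] [l2 [p [q [el w1 st w2]]]]]]] := walk_split
  (R1 := old_or_new S c b es j) (R2 := new_edge c es j) wm'.
  exact: mmin (ltnSn j) wj.
have [k [o' [u [z [ej ee dir]]]]] := step_new_edge st.
have iso_z := hJ _ _ _ _ _ Jj ej.
have up e' p' q' : old_or_new S c b es j e' p' q' \/ new_edge c es j e' p' q' ->
    old_or_new S c b es j.+1 e' p' q'.
  move=> [[h|[i ij h]]|h]; first by left.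
    by right; exists i => //; exact: leqW.
  by right; exists j.
(* If the pair is crossed towards the new vertex, the rest of the walk starts there; if it is
   crossed away from it, the reversed initial part does. *)
case: dir => -[eo [ep eq]]; subst.
- apply: (no_forward ej iso_z (l := l2) (y := y)) => //.
  + by have [_] := reduced_cat rl.
  + by move: lL; rewrite on_cat => /andP[_ /andP[]].
  + by apply: leq_trans ln; rewrite size_cat /= addnS leqW // leq_addl.
  + exact: walk_mono w2.
- apply: (no_forward ej iso_z (l := wrev l1) (y := x)) => //.
  + move: (rl); rewrite -cat_rcons => /reduced_cat[/reduced_wrev + _].
    by rewrite /wrev map_rcons rev_rcons /inv /= negbK.
  + by move: lL; rewrite on_wrev on_cat => /andP[].
  + by apply: leq_trans ln; rewrite size_wrev size_cat leq_addr.
  + by apply: walk_rev; apply: walk_mono w1 => e' p' q' h; apply: up; left.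
Qed.

Lemma Xfull_all S b : (forall c, c < b -> good S c) -> forall c, c < b -> Xfull S c.
Proof.
move=> G; apply: (ol_ind HT) => c IH cb.
have G' c' : c' < c -> good S c' by move=> c'c; apply: G; exact: lt_trans c'c cb.
apply: Xfull_of (G _ cb) _ => //; apply: Xlow_of => // c' c'c.
by apply: IH => //; exact: lt_trans c'c cb.
Qed.

Lemma Xlow_all S b : (forall c, c < b -> good S c) -> Xlow S b.
Proof. by move=> G; apply: Xlow_of => //; exact: Xfull_all. Qed.

End NewEdges.

(** * Vertices on no short loop *)

Lemma count_lt_in (X : eqType) (p q : pred X) (s : seq X) x :
  (forall x, x \in s -> p x -> q x) -> x \in s -> q x -> ~ p x ->
  (count p s < count q s)%N.
Proof.
move=> pq xs qx npx; have -> : count q s = count [predU p & [predD q & p]] s.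
  by apply: eq_in_count => y ys /=; rewrite !inE /in_mem /=; case: (boolP (p y)) => [py|_] /=; [rewrite pq | ].
have e0 : count [predI p & [predD q & p]] s = 0%N.
  by rewrite -[RHS](count_pred0 s); apply: eq_count => y /=; rewrite !inE /in_mem /=; case: (p y).
have := count_predUI p [predD q & p] s; rewrite e0 addn0 => ->.
rewrite -[X in (X < _)%N]addn0 ltn_add2l -has_count.
apply/hasP; exists x => //=; apply/andP; split; [exact/negP | exact: qx].
Qed.

Section Loops.
Context {d : Order.disp_t} {T : orderType d} (HT : omega1_like T).
Notation V := (T * nat)%type.
Implicit Types (k : @label d T) (x y z u w v : V) (a b c : T).
Implicit Types (Ls : seq (@letter d T)) (e : @letter d T) (Y : set V).

Lemma limpt_inf Y n b a (l : seq V) : limpt Y n b -> a < b ->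
  exists y, [/\ Y y, a <= y.1, y.1 < b & y \notin l].
Proof.
elim: n b a => [|n IH] b a /= h ab; first exact: h.
have [c [ac cb /IH hc]] := h a ab.
have [y [Yy ay yc yl]] := hc a ac; exists y; split=> //; exact: lt_trans yc cb.
Qed.

Lemma limpt_sub Y Y' n b : (forall y, Y y -> Y' y) -> limpt Y n b -> limpt Y' n b.
Proof.
move=> YY'; elim: n b => [|n IH] b /= h.
  by move=> a l /h-/(_ l) [y [/YY' ? ? ? ?]]; exists y.
by move=> a /h[c [ac cb /IH]]; exists c.
Qed.

Lemma big_sub b Y Y' : (forall y, Y y -> Y' y) -> big b Y -> big b Y'.
Proof.
by move=> YY' h n a /(h n)[c [ac cb /(limpt_sub YY')]]; exists c.
Qed.

Lemma adj_lt (S : @system d T) x y : x.1 < y.1 -> (joined S x y <-> tr S y x).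
Proof.
by move=> xy; split=> [[[]//|[yx]]|]; [rewrite ltNge ltW in yx | left].
Qed.

Variables (S : @system d T) (b : T).
Hypothesis G : forall c, c < b -> good S c.

(** Adjacency is preserved against all pairs below [c], so the cut of the trace of [x] goes to that
    of [y]. Walks of vertices thus project to walks of traces at [c], to which [st_free] applies. *)
Lemma trace_sends k c x y : legit S b k -> lC k c -> low S k x y -> c <= x.1 ->
  [/\ c <= y.1, Tr S c (cut c (tr S x)), Tr S c (cut c (tr S y))
    & sends S (iso S c) (res c k) (cut c (tr S x)) (cut c (tr S y))].
Proof.
move=> L Cc h cx; have cy : c <= y.1 by rewrite leNgt -(low_lt G L Cc h) -leNgt.
have [xb yb Wy _] := low_wf G L h.
have lc : l0 k < c by case: (legit_C L Cc).
have Tc z : z.1 < b -> c <= z.1 -> Tr S c (cut c (tr S z)).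
  by move=> zb cz; apply: (Tr_cut_le G cz zb); exact: tr_Tr.
split=> //; first exact: Tc; first exact: Tc.
split=> [|p q hpq].
  rewrite (alive_res _ L Cc) cut_cut ?ltW //; split.
    by apply: (Tr_cut_le G _ yb (tr_Tr S y)); exact: le_trans (ltW lc) cy.
  by exists y => //; split=> //; exact: le_trans (ltW lc) cy.
have lpq : low S k p q by exists c.
have [pc [_ qc]] := st_wf (G (legit_lt L Cc)) (legit_res L Cc) hpq.
have px := lt_le_trans pc cx; have qy := lt_le_trans qc cy.
have := low_adj G L lpq h; rewrite !adj_lt // => h1.
by split=> -[hh _]; split=> //; apply/h1.
Qed.

Lemma trace_walk ks c l x y : (forall k, k \in ks -> legit S b k /\ lC k c) ->
  on [seq (b, k) | k <- ks] l -> c <= x.1 -> walk (letR S b) l x y ->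
  c <= y.1 /\ walk (fun k s t => [/\ Tr S c s, Tr S c t & sends S (iso S c) k s t])
    [seq (res c p.1.2, p.2) | p <- l] (cut c (tr S x)) (cut c (tr S y)).
Proof.
move=> hks; elim: l x => [|[e o] l IH] x /=; first by move=> _ ? <-; split.
move=> /andP[/mapP[k kks /= ek] lL] cx [z ez zy].
have [L Cc] := hks k kks.
have eb : e.1 = b by rewrite ek.
have ek2 : e.2 = k by rewrite ek.
have [cz st] : c <= z.1 /\ step (fun k s t =>
    [/\ Tr S c s, Tr S c t & sends S (iso S c) k s t]) (res c k, o)
    (cut c (tr S x)) (cut c (tr S z)).
  case: o ez => /(letR_low eb)[_]; rewrite ek2 => h.
    by have [? ? ? ?] := trace_sends L Cc h cx.
  have cz : c <= z.1 by rewrite leNgt (low_lt G L Cc h) -leNgt.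
  by have [? ? ? ?] := trace_sends L Cc h cz.
have [cy w] := IH z lL cz zy; split=> //.
by exists (cut c (tr S z)) => //; rewrite ek2.
Qed.

Lemma first_return Ls c l x y : c <= x.1 -> y.1 < c -> walk (letR S b) l x y ->
  exists l1 l2 w, [/\ l = l1 ++ l2, walk (high (letR S b) c) l1 x w & w.1 < c].
Proof.
move=> + yc; elim: l x => [|[e o] l IH] x cx /=.
  by move=> xy; rewrite xy leNgt yc in cx.
move=> [z ez zy].
have nlx : ~ lower e c x by move=> [c' _ [c'c xc']]; rewrite leNgt (lt_le_trans xc' c'c) in cx.
have hz : step (high (letR S b) c) (e, o) x z.
  case: o ez => ez; split=> //.
  by move=> /(lower_sym c G ez).
have [zc|cz] := ltP z.1 c.
  by exists [:: (e, o)], l, z; split=> //; exists z.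
have [l1 [l2 [w [-> w1 wc]]]] := IH z cz zy.
by exists ((e, o) :: l1), l2, w; split=> //; exists z.
Qed.

(** [rich_bits] yields some trace, and [rich_level] then puts points arbitrarily close below [b]. So
    least and successor levels have no legitimate label. *)
Lemma legit_limit k a : legit S b k -> a < b -> exists c, a < c /\ c < b.
Proof.
move=> L ab; have [_ R _] := legit_pt L (or_intror erefl).
rewrite (res_id L) in R.
have [|s [Ts _] _] := @rich_bits _ _ _ _ _ R [::] (fun=> True); first by [].
have [c [ac cb _]] := rich_level R (rich_l0 R) Ts 0 ab.
by exists c.
Qed.

(** Since [b] is a limit, whatever distinguishes two labels, be it a vertex or a level, already lies
    below some level under [b]. *)
Lemma sep_eventually ks a : (forall k, k \in ks -> legit S b k) -> a < b ->
  exists c, [/\ c < b, a <= c & forall c', c <= c' -> sep c' ks].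
Proof.
move=> hL ab.
have sep2 k k' : legit S b k -> legit S b k' -> exists2 c, c < b &
    forall c', c <= c' -> res c' k = res c' k' -> k = k'.
  move=> L L'; apply: contrapT => n.
  have lim a1 : a1 < b -> exists c, a1 < c /\ c < b by apply: legit_limit L.
  case: k k' L L' n => W C l [W' C' l'] L L' n.
  have nn c : c < b -> exists c', c <= c' /\ res c' (Label W C l) = res c' (Label W' C' l').
    move=> cb; apply: contrapT => n'; apply: n; exists c => // c' cc' e.
    by case: n'; exists c'.
  apply: n; exists a => // _ _ _.
  have -> : l = l' by have [c' [_ [_ _ ->]]] := nn a ab.
  have -> : W = W'.
    apply: set_eq => v; split=> hv.
      have [c [vc cb]] := lim _ (legit_W L hv).
      have [c' [cc' [eW _ _]]] := nn c cb.
      have : cut c' W v by split=> //; exact: lt_le_trans vc cc'.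
      by rewrite eW => -[].
    have [c [vc cb]] := lim _ (legit_W L' hv).
    have [c' [cc' [eW _ _]]] := nn c cb.
    have : cut c' W' v by split=> //; exact: lt_le_trans vc cc'.
    by rewrite -eW => -[].
  have -> // : C = C'.
  apply: set_eq => a1; split=> hv.
    have [c [ac cb]] := lim _ (proj2 (legit_C L hv)).
    have [c' [cc' [_ eC _]]] := nn c cb.
    have : C a1 /\ a1 < c' by split=> //; exact: lt_le_trans ac cc'.
    by rewrite (congr1 (@^~ a1) eC) => -[].
  have [c [ac cb]] := lim _ (proj2 (legit_C L' hv)).
  have [c' [cc' [_ eC _]]] := nn c cb.
  have : C' a1 /\ a1 < c' by split=> //; exact: lt_le_trans ac cc'.
  by rewrite -(congr1 (@^~ a1) eC) => -[].
have [||c [cb ac hc]] := @seq_bound _ _ _ [seq (k, k') | k <- ks, k' <- ks]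
  (fun p c => forall c', c <= c' -> res c' p.1 = res c' p.2 -> p.1 = p.2) b a ab.
- by move=> _ /allpairsP[[k k'] [/= /hL L /hL L' ->]]; exact: sep2.
- by move=> p c1 c2 h c12 c' c2c'; apply: h; exact: le_trans c12 c2c'.
- exists c; split=> // c' cc' k k' kks k'ks.
  apply: (hc (k, k') _ c' cc').
  by apply/allpairsP; exists (k, k').
Qed.

(** Near [c], closedness allows no label that is not closed at [c] itself. If a label closed at [c]
    is missing at a limit point of the next lower rank, move to that point: fewer labels are closed
    there, and one unit of rank has paid for it. *)
Lemma stable_limpt ks Y m c1 : (forall k, k \in ks -> legit S b k) ->
  forall c, limpt Y m c -> c1 < c -> c < b ->
  (count (fun k => `[< lC k c >]) ks < m)%N ->
  exists c' a m', [/\ [/\ c1 <= a, a < c', c' < b & limpt Y m'.+1 c'],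
    forall k c'', k \in ks -> a < c'' -> c'' < c' -> lC k c'' -> lC k c'
    & forall k c'', k \in ks -> a < c'' -> c'' < c' -> limpt Y m' c'' ->
        lC k c' -> lC k c''].
Proof.
move=> hL; elim: m => [//|m IH] c lc c1c cb cnt.
have [||a [ac c1a ha]] := @seq_bound _ _ _ ks
  (fun k a => forall c'', a < c'' -> c'' < c -> lC k c'' -> lC k c) c c1 c1c.
- move=> k /hL L; have [Cc|nC] := pselect (lC k c); first by exists c1.
  have [[a Ca ac]|none] := pselect (exists2 a, lC k a & a < c); last first.
    by exists c1 => // c'' _ c''c Cc''; case: none; exists c''.
  apply: contrapT => n; apply: nC; apply: (legit_closed L) => //; first by exists a.
  move=> a1 a1c; apply: contrapT => n'; apply: n; exists a1 => // c'' h1 h2 h3.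
  by case: n'; exists c''.
- by move=> k a1 a2 h a12 c'' h1; apply: h; exact: le_lt_trans a12 h1.
have [[k [c'' [kks ac'' c''c lc'' [Cc nCc'']]]]|none] := pselect (exists k c'',
    [/\ k \in ks, a < c'', c'' < c, limpt Y m c'' & lC k c /\ ~ lC k c'']).
  apply: (IH c'') => //.
  - exact: le_lt_trans c1a ac''.
  - exact: lt_trans c''c cb.
  rewrite -ltnS; apply: leq_trans cnt; rewrite ltnS.
  apply: (@count_lt_in _ _ _ ks k) => //; [|exact/asboolP|by move=> /asboolP].
  by move=> k' k'ks /asboolP h; apply/asboolP; apply: ha h.
exists c, a, m; split=> // k c'' kks; first by apply: ha.
move=> ac'' c''c lc'' Cc; apply: contrapT => nC; apply: none.
by exists k, c''.
Qed.

(** At a stable limit point [cs], a loop through letters closed at [cs] projects to a loop of traces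
    at [c3], which [st_free] forbids. A loop with another letter contains an excursion at [cs], and
    only finitely many starting points of those exist. *)
Lemma no_loops ks Y n c : (forall k, k \in ks -> legit S b k) -> big b Y -> c < b ->
  exists y, [/\ Y y, c <= y.1, y.1 < b & forall l, (size l <= n)%N ->
    on [seq (b, k) | k <- ks] l -> reduced l -> walk (letR S b) l y y -> l = [::]].
Proof.
move=> hL bigY cb.
have [c1 [c1b cc1 hsep]] := sep_eventually hL cb.
have [c2 [c12 c2b lc2]] := bigY (size ks).+1 c1 c1b.
have [|cs [a [m [[c1a acs csb lcs] hdn hup]]]] := stable_limpt hL lc2 c12 c2b.
  by rewrite ltnS count_size.
have [c3 [ac3 c3cs lc3]] := lcs a acs.
pose Ls := [seq (b, k) | k <- ks].
have sepcs : sepL cs Ls.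
  move=> _ _ /mapP[k kks ->] /mapP[k' k'ks ->] /= e.
  by rewrite (hsep cs _ k k') //; exact: le_trans c1a (ltW acs).
have [|Z hZ] := (Xlow_all HT G : Xlow S b) Ls n cs csb _ sepcs.
  by move=> _ /mapP[k kks ->].
have [t ht] := @walk_fin _ _ (letR S b) Ls n Z (letR_det G).
(* The labels of [ks] closed at [c3] are those closed at [cs]. The vertex is taken between these
   levels and outside [t], the ball of radius [n] around the excursion starts [Z]. *)
have [y [Yy c3y ycs yt]] := limpt_inf t lcs c3cs.
exists y; split=> //.
- apply: le_trans c3y; apply: le_trans (ltW ac3); exact: le_trans cc1 c1a.
- exact: lt_trans ycs csb.
move=> l ln lL rl w.
pose P (p : letter * bool) := `[< lC p.1.2 cs >].
have inner l1 v : on Ls l1 -> all P l1 -> walk (letR S b) l1 y v -> c3 <= v.1 /\ v.1 < cs.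
  move=> lL1 P1 w1; split.
    pose ks1 := [seq k <- ks | `[< lC k c3 >]].
    have h1 k : k \in ks1 -> legit S b k /\ lC k c3.
      by rewrite mem_filter => /andP[/asboolP ? /hL].
    suff o1 : on [seq (b, k) | k <- ks1] l1 by have [] := trace_walk h1 o1 c3y w1.
    apply/allP => p pl; have /mapP[k kks ek] := allP lL1 _ pl; rewrite ek; apply: map_f.
    rewrite mem_filter kks andbT; apply/asboolP; apply: (hup k) => //.
    by have /asboolP := allP P1 _ pl; rewrite ek.
  elim: l1 y {Yy c3y yt w} ycs lL1 P1 w1 => [|[e o] l1 IH] y ycs /=; first by move=> _ _ <-.
  move=> /andP[_ lL1] /andP[/asboolP Ce P1] [z ez zv]; apply: (IH z) => //.
  case: o ez Ce => ez Ce; [rewrite -(letR_lt G (or_introl Ce) ez) | rewrite (letR_lt G (or_introl Ce) ez)]; exact: ycs.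
have [allP|nall] := boolP (all P l).
  pose ks1 := [seq k <- ks | `[< lC k c3 >]].
  have h1 k : k \in ks1 -> legit S b k /\ lC k c3.
    by rewrite mem_filter => /andP[/asboolP ? /hL].
  have o1 : on [seq (b, k) | k <- ks1] l.
    apply/seq.allP => p pl; have /mapP[k kks ek] := seq.allP lL _ pl; rewrite ek; apply: map_f.
    rewrite mem_filter kks andbT; apply/asboolP; apply: (hup k) => //.
    by have /asboolP := seq.allP allP _ pl; rewrite ek.
  have [_ w1] := trace_walk h1 o1 c3y w.
  have Gc3 := G (lt_trans c3cs csb).
  have sep3 : sep c3 ks by apply: hsep; exact: le_trans c1a (ltW ac3).
  have : [seq (res c3 p.1.2, p.2) | p <- l] = [::].
    apply: (st_free Gc3 _ _ _ w1).
    - exact: (Tr_cut_le G c3y (lt_trans ycs csb) (tr_Tr S y)).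
    - apply: (reduced_map (Ls := Ls) (m := fun e => res c3 e.2)) => //.
      move=> _ _ /mapP[k kks ->] /mapP[k' k'ks ->] /= e.
      by rewrite (sep3 k k').
    - move=> q /mapP[p pl ->] /=; have /mapP[k kks ->] := seq.allP o1 _ pl.
      by have [L C3] := h1 k kks; exact: (legit_res L C3).
  by case: (l).
exfalso.
have [l1 [[e o] [l2 [el P1 nP]]]] : exists l1 p l2, [/\ l = l1 ++ p :: l2, all P l1 & ~~ P p].
  elim: (l) nall => //= p l' IH; rewrite negb_and.
  have [Pp /= /IH[l1 [q [l2 [-> h1 h2]]]]|nP _] := boolP (P p).
    by exists (p :: l1), q, l2; split=> //=; rewrite Pp.
  by exists [::], p, l'.
move: w; rewrite el => /walk_cat[v w1 [w ew w2]].
have [lL1 /andP[/= eL lL2]] : on Ls l1 /\ on Ls ((e, o) :: l2).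
  by move: lL; rewrite el on_cat => /andP[].
have [c3v vcs] := inner _ _ lL1 P1 w1.
have nCe : ~ lC e.2 cs by move=> h; move/negP: nP; apply; apply/asboolP.
have /mapP[k kks ek] := eL.
have nlow : ~ lower e cs v.
  move=> [c4 [Cc4|c4e] [c4cs vc4]].
    move: c4cs; rewrite le_eqVlt => /orP[/eqP e4|c4cs]; first by rewrite e4 in Cc4.
    apply: nCe; rewrite ek in Cc4 *; apply: (hdn k c4) => //=.
    exact: lt_trans ac3 (le_lt_trans c3v vc4).
  by move: c4cs; rewrite c4e ek /= leNgt csb.
have hv : step (high (letR S b) cs) (e, o) v w.
  by case: o ew {el eL nP} => ew; split=> // /(lower_sym cs G ew).
have vZ : v \in Z.
  have rl2 : reduced ((e, o) :: l2) by move: rl; rewrite el => /reduced_cat[].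
  have sl2 : (size ((e, o) :: l2) <= n)%N.
    by apply: leq_trans ln; rewrite el size_cat leq_addl.
  have [wcs|csw] := ltP w.1 cs.
    apply: (hZ v [:: (e, o)] w); split=> //=; last by exists w.
    by split=> //=; [exact: leq_trans sl2 | rewrite andbT].
  have [m1 [m2 [w' [em wm w'cs]]]] := first_return Ls csw ycs w2.
  apply: (hZ v ((e, o) :: m1) w'); split=> //=; last by exists w.
  rewrite em in rl2 sl2 lL2; split=> //=.
  - by move: rl2; rewrite -cat_cons => /reduced_cat[].
  - by apply: leq_trans sl2; rewrite /= size_cat ltnS leq_addr.
  - by rewrite eL; have := lL2; rewrite -[X in is_true X]/(on Ls (m1 ++ m2)) on_cat => /andP[].
move/negP: yt; apply; apply: (ht (wrev l1) v) => //.
- by rewrite size_wrev; apply: leq_trans ln; rewrite el size_cat leq_addr.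
- by rewrite on_wrev.
- exact: walk_rev.
Qed.

(** [no_loops] handles letters of level [b]. The others act below [c0], so a vertex beyond the ball
    around that region cannot meet them, nor any vertex below [c], in [n] steps. *)
Lemma fresh_vertex Ls Y n c : (forall e, e \in Ls -> e.1 <= b) -> big b Y -> c < b ->
  exists y, [/\ Y y, c <= y.1, y.1 < b & isolated (letR S b) Ls n (fun w => w.1 < c) y].
Proof.
move=> topL bigY cb.
pose ks := [seq e.2 | e <- Ls & `[< e.1 = b /\ legit S b e.2 >]].
have hL k : k \in ks -> legit S b k.
  by case/mapP => e; rewrite mem_filter => /andP[/asboolP[_ ?] _ ->].
have [||c0 [c0b cc0 hc0]] := @seq_bound _ _ _ Ls (fun e c0 => e.1 < b -> e.1 <= c0) b c cb.
- move=> e _; have [eb|eb] := ltP e.1 b; first by exists e.1.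
  by exists c => // h; rewrite ltNge eb in h.
- by move=> e c1 c2 h c12 /h h'; exact: le_trans h' c12.
have [c1 [c1b c01 hc1]] := ball_bound Ls n G c0b.
have [y [Yy c1y yb hy]] := no_loops n hL bigY c1b.
have nreach l x : (size l <= n)%N -> on Ls l -> x.1 < c0 -> ~ walk (letR S b) l x y.
  by move=> ln lL xc /hc1 -/(_ ln lL xc); rewrite ltNge c1y.
exists y; split=> //; first by apply: le_trans c1y; exact: le_trans cc0 c01.
split=> [l x ln lL xc|l ln lL rl w]; first by apply: nreach => //; exact: lt_le_trans xc cc0.
apply: (hy l ln _ rl w); apply/allP => -[e o] el; have eL := allP lL _ el.
case/splitPr: el ln lL w {rl} => l1 l2 ln lL /walk_cat[p w1 /= [q epq w2]].
have [lL1 _] : on Ls l1 /\ on Ls ((e, o) :: l2) by move: lL; rewrite on_cat => /andP[].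
have nearp : p.1 < c0 -> False.
  move=> pc; apply: (nreach (wrev l1) p) => //; last exact: walk_rev.
    by rewrite size_wrev; apply: leq_trans ln; rewrite size_cat leq_addr.
  by rewrite on_wrev.
have [u [v [euv uv]]] : exists u v, letR S b e u v /\ (p = u \/ p = v).
  by case: o epq {lL ln eL} => h; [exists p, q | exists q, p]; split=> //; [left|right].
case: euv => -[eb [L h]].
  exfalso; apply: nearp; apply: lt_le_trans (hc0 e eL eb).
  have [h1 /(legit_W L) h2] := st_wf (G eb) L h; by case: uv => ->.
apply/mapP; exists e.2; last by rewrite -eb; case: (e).
by apply/mapP; exists e => //; rewrite mem_filter eL andbT; apply/asboolP.
Qed.

End Loops.

(** * Extending families of traces *)

Lemma walk_until (A : eqType) (X : Type) (R : A -> X -> X -> Prop) (P : X -> Prop)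
    (l : seq (A * bool)) x y : walk R l x y -> P y ->
  exists l1 l2 w, [/\ l = l1 ++ l2,
    walk (fun k x y => R k x y /\ (~ P x \/ ~ P y)) l1 x w, P w & walk R l2 w y].
Proof.
move=> + Py; elim: l x => [|a l IH] x w; first by exists [::], [::], x; rewrite w.
have [Px|nPx] := pselect (P x); first by exists [::], (a :: l), x.
have [z az /IH[l1 [l2 [u [-> w1 Pu w2]]]]] := w.
exists (a :: l1), l2, u; split=> //; exists z => //.
by move: az; rewrite /step; case: a.2 => ?; split; auto.
Qed.

Section Linked.
Context {d : Order.disp_t} {T : orderType d} (HT : omega1_like T).
Notation V := (T * nat)%type.
Notation label := (@label d T).
Implicit Types (k : label) (x y z : V) (a b c : T) (p q r : nat * V).
Implicit Types (E : seq (nat * label * nat)).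

Lemma sep_mono c c' (ks : seq label) : c <= c' -> sep c ks -> sep c' ks.
Proof.
move=> cc' h k k' kks k'ks e; apply: h => //.
by rewrite -(res_res k cc') e res_res.
Qed.

Variables (S : @system d T) (b : T).
Hypothesis G : forall c, c < b -> good S c.

Definition lowR k x y := legit S b k /\ low S k x y.

Definition linked E p q := exists l, walk (prodR E lowR) l p q.

Lemma linked_sym E p q : linked E p q -> linked E q p.
Proof. by move=> [l w]; exists (wrev l); exact: walk_rev. Qed.

Lemma linked_trans E p q r : linked E p q -> linked E q r -> linked E p r.
Proof. by move=> [l w] [l' w']; exists (l ++ l'); apply/walk_cat; exists q. Qed.

Lemma linked_edge E k p q : (p.1, k, q.1) \in E -> legit S b k ->
  low S k p.2 q.2 -> linked E p q.
Proof. by move=> e L h; exists [:: (k, true)]; exists q. Qed.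

Lemma walk_node N E R l p q : forest N E -> walk (prodR E R) l p q ->
  (p.1 < N)%N -> (q.1 < N)%N.
Proof.
move=> F; elim: l p => [|[k o] l IH] p /=; first by move=> ->.
move=> [r pr rq] _; apply: IH rq _.
by case: o pr => -[/(forest_bound F)[]].
Qed.

Lemma walk_val E (R : label -> V -> V -> Prop) (v : nat -> V -> Prop) :
  (forall i k j x y, (i, k, j) \in E -> R k x y -> (v i x <-> v j y)) ->
  forall l p q, walk (prodR E R) l p q -> (v p.1 p.2 <-> v q.1 q.2).
Proof.
move=> inv; elim=> [|[k o] l IH] p q /=; first by move=> ->.
move=> [r pr /IH <-].
by case: o pr => -[e h]; [|apply: iff_sym]; apply: inv e h.
Qed.

Lemma linked_reduced N E p q : forest N E -> linked E p q -> exists l,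
  [/\ reduced l, (size l <= 2 * N)%N, on (labs E) l & walk (prodR E lowR) l p q].
Proof.
move=> F [l w].
have [l' [rl _ _ w']] := walk_reduce (prodR_det (forest_det F) (low_deterministic G)) w.
have [w1 _ lE] := prodR_walk w'.
by exists l'; split=> //; have [] := forest_walk F rl w1.
Qed.

Lemma linked_fin N E (Q : seq (nat * V)) : forest N E ->
  exists Q' : seq (nat * V), forall p q, p \in Q -> linked E p q -> q \in Q'.
Proof.
move=> F.
have [t ht] := walk_fin (labs E) (2 * N) Q (prodR_det (forest_det F) (low_deterministic G)).
exists t => p q pQ /(linked_reduced F)[l [_ sl lE w]].
exact: ht sl lE pQ w.
Qed.

(** [st_fam] at [c'] can only respect labels closed at [c']. The remaining links are protected by
    prescribing finitely many bits: inside [c1] they are decided already, and beyond it they run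
    along excursions, whose endpoints form a finite set. *)
Lemma extend c' : c' < b -> forall N E (t : nat -> set V) c (v : nat -> V -> Prop)
    (Q : seq (nat * V)), c <= c' -> fam S b (low S) N E t c v ->
  exists (t' : nat -> set V) (v' : nat -> V -> Prop),
    [/\ fam S b (low S) N E t' c' v', forall i, (i < N)%N -> cut c (t' i) = t i
      & forall i x, (i, x) \in Q -> (i < N)%N -> (v' i x <-> v i x)].
Proof.
elim/(ol_ind HT): c' => c' IH c'b N E t c v Q.
rewrite le_eqVlt => /orP[/eqP e|cc'] Fm.
  subst c'; exists t, v; split=> // i iN; rewrite cut_id // => x.
  by apply: (Tr_sub G c'b); exact: (fam_Tr Fm iN).
have F := fam_forest Fm.
have L k : k \in labs E -> legit S b k by move=> /(fam_legit Fm)[].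
have lk k : k \in labs E -> l0 k <= c by move=> /(fam_legit Fm)[].
have labE i k j : (i, k, j) \in E -> k \in labs E by move=> e; apply/mapP; exists (i, k, j).
(* [c1] lies beyond all closed levels under [c'] of the labels that are not closed at [c']. *)
have [||c1 [c1c' cc1 hc1]] := @seq_bound _ _ _ (labs E)
    (fun k a => lC k c' \/ forall a', lC k a' -> a' <= c' -> a' <= a) c' c cc'.
- move=> k kE; have [Cc'|nC] := pselect (lC k c'); first by exists c => //; left.
  have [|a [_ ac' amax _]] := legit_max HT (L k kE) (le_lt_trans (lk k kE) cc') (ltW c'b) nC.
    by move=> e; rewrite e ltxx in c'b.
  exists a => //; right=> a' Ca'; rewrite le_eqVlt => /orP[/eqP e|]; first by rewrite -e in nC.
  exact: amax.
- by move=> k a1 a2 [h|h] a12; [left|right=> a' h1 h2; apply: le_trans a12; apply: h].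
have c1b := lt_trans c1c' c'b.
have [Q1 hQ1] := linked_fin Q F.
have [t1 [v1 [F1 t1t v1v]]] := IH c1 c1c' c1b N E t c v Q cc1 Fm.
pose Ls := [seq (b, k) | k <- labs E].
have sepc' : sep c' (labs E) by apply: sep_mono (fam_sep Fm); exact: ltW.
have [||Z hZ] := (Xlow_all HT G : Xlow S b) Ls (2 * N)%N c' c'b.
- by move=> _ /mapP[k _ ->].
- move=> _ _ /mapP[k kE ->] /mapP[k' k'E ->] /= e.
  by rewrite (sepc' k k').
pose cl k := `[< lC k c' >].
pose Ec := [seq (e.1.1, res c' e.1.2, e.2) | e <- E & cl e.1.2].
have EcP i k j : (i, k, j) \in Ec -> exists k', [/\ (i, k', j) \in E, lC k' c' & k = res c' k'].
  by case/mapP => -[[i' k'] j']; rewrite mem_filter => /andP[/asboolP /= Ck' e] [-> -> ->]; exists k'.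
have F2 : fam S c' (iso S c') N Ec t1 c1 v1.
  split.
  - apply: forest_filter_map F => -[[i k] j] [[i' k'] j'] /= /labE e /labE e' _ _.
    exact: sepc'.
  - move=> _ /mapP[[[i k] j] /EcP[k' [e Ck' ->]] ->] /=; split.
      exact: legit_res (L _ (labE _ _ _ e)) Ck'.
    exact: le_trans (lk _ (labE _ _ _ e)) cc1.
  - move=> _ _ /mapP[[[i k] j] /EcP[k1 [/labE e _ ->]] ->] /mapP[[[i' k'] j'] /EcP[k2 [/labE e' _ ->]] ->] /=.
    by rewrite !res_res ?(ltW c1c') // => h; congr res; apply: (fam_sep F1).
  - exact: fam_Tr F1.
  - move=> i k j /EcP[k' [e Ck' ->]].
    by rewrite (alive_res _ (L _ (labE _ _ _ e)) Ck'); exact: fam_alive F1 _ _ _ e.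
  - move=> i k j x y /EcP[k' [e Ck' ->]] h; apply: (fam_inv F1 e).
    by exists c'.
  - exact: fam_val F1.
(* The bits are copied from the prediction [v1] at all vertices linked to [Q] and, for every node,
   at all starting points of excursions. *)
have [t' [tT ts tv]] := st_fam (G c'b) (Q1 ++ [seq (i, z) | i <- iota 0 N, z <- Z]) c1c' F2.
have tZ i z : (i < N)%N -> z \in Z -> z.1 < c' -> (t' i z <-> v1 i z).
  move=> iN zZ zc; apply: tv => //; rewrite mem_cat; apply/orP; right.
  by apply/allpairsP; exists (i, z); rewrite mem_iota.
have tlow i z : (i < N)%N -> z.1 < c1 -> (t' i z <-> v1 i z).
  move=> iN zc; rewrite (fam_val F1 iN zc) -(tT i iN).2.
  by split=> [h|[]].
have v1L p q : linked E p q -> (v1 p.1 p.2 <-> v1 q.1 q.2).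
  by move=> [l w]; apply: (walk_val _ w) => i k j x y e [_]; exact: fam_inv F1 _ _ _ _ _ e.
(* Induction on the walk. A letter closed at [c'] is respected by [ts]; an edge below a closed level
   is decided at [c1]; any other edge begins an excursion, which is skipped as a whole because [t']
   and [v1] agree at both of its ends. *)
have key : forall l p q, reduced l -> (size l <= 2 * N)%N -> on (labs E) l ->
    walk (prodR E lowR) l p q -> (p.1 < N)%N -> p.2.1 < c' -> q.2.1 < c' ->
    (t' p.1 p.2 <-> t' q.1 q.2).
  move=> l; have [m] := ubnP (size l); elim: m l => // m IHl [|[k o] l] lm p q.
    by move=> _ _ _ ->.
  move=> rl sl lE w pN pc qc; have [r pr rq] := w; have [kE lE'] := andP lE.
  have Lk := L k kE.
  have rN : (r.1 < N)%N by apply: (walk_node (R := lowR) (l := [:: (k, o)]) F _ pN); exists r.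
  have IHr : r.2.1 < c' -> (t' r.1 r.2 <-> t' q.1 q.2).
    by move=> rc; exact: (IHl l lm r q (reduced_cons rl) (ltnW sl) lE' rq rN rc qc).
  have pv : v1 p.1 p.2 <-> v1 r.1 r.2 by apply: v1L; exists [:: (k, o)]; exists r.
  have prlow : letR S b (b, k) p.2 r.2 \/ letR S b (b, k) r.2 p.2.
    by case: (o) pr => -[_ [_ h]]; [left|right]; right.
  have lt_c2 c2 : lC k c2 -> (p.2.1 < c2) = (r.2.1 < c2).
    move=> C2; have h2 : closedpt (b, k) c2 by left.
    by case: prlow => /(letR_lt G h2).

  have [Cc'|nC] := pselect (lC k c').
    have rc : r.2.1 < c' by rewrite -lt_c2.
    rewrite -(IHr rc).
    case: o pr {w lE rl lm sl kE} => -[e [_ h]].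
      have e' : (p.1, res c' k, r.1) \in Ec.
        by apply/mapP; exists (p.1, k, r.1) => //; rewrite mem_filter e andbT; apply/asboolP.
      by have [_] := ts _ _ _ e'; apply; apply: (low_at G Lk Cc' h); left.
    have e' : (r.1, res c' k, p.1) \in Ec.
      by apply/mapP; exists (r.1, k, p.1) => //; rewrite mem_filter e andbT; apply/asboolP.
    by have [_ h'] := ts _ _ _ e'; apply: iff_sym; apply: h'; apply: (low_at G Lk Cc' h); left.
  have amax a' : lC k a' -> a' <= c' -> a' <= c1 by case: (hc1 k kE) => // h; exact: h.
  have [[a' [Ca' a'c' pa']]|nlow] := pselect (exists a', [/\ lC k a', a' <= c' & p.2.1 < a']).
    have ra' : r.2.1 < a' by rewrite -lt_c2.
    have rc1 := lt_le_trans ra' (amax _ Ca' a'c').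
    rewrite -(IHr (lt_trans rc1 c1c')) (tlow _ _ pN) ?(tlow _ _ rN) //.
    exact: lt_le_trans pa' (amax _ Ca' a'c').
  have nlow' : ~ lower (b, k) c' p.2.
    move=> [c2 [C2|->] [h1 h2]]; first by apply: nlow; exists c2.
    by move: h1; rewrite /= leNgt c'b.
  have [l1 [l2 [u [el w1 uc w2]]]] := walk_until (P := fun q => q.2.1 < c') rq qc.
  pose HR k0 (p0 q0 : nat * V) := prodR E lowR k0 p0 q0 /\ ~ lower (b, k0) c' p0.2.
  have low_lower k0 x y : lowR k0 x y -> (lower (b, k0) c' x <-> lower (b, k0) c' y).
    by move=> [L0 h0]; apply: (lower_sym c' G (e := (b, k0))); right.
  have wH : walk HR ((k, o) :: l1) p u.
    exists r; first by case: (o) pr => h; split=> //; case: h => _ /low_lower ->.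
    apply: walk_mono w1 => k0 p0 q0 [h nP]; split=> //; case: nP => nP.
      by move=> [c2 _ [h1 h2]]; apply: nP; exact: lt_le_trans h2 h1.
    case: h => _ /low_lower -> [c2 _ [h1 h2]]; apply: nP; exact: lt_le_trans h2 h1.
  have [rl1 rl2] : reduced ((k, o) :: l1) /\ reduced l2.
    by move: rl; rewrite el -cat_cons => /reduced_cat.
  have lE1 : on (labs E) ((k, o) :: l1) by move: lE; rewrite el -cat_cons on_cat => /andP[].
  have lE2 : on (labs E) l2 by move: lE; rewrite el -cat_cons on_cat => /andP[].
  have sl1 : (size ((k, o) :: l1) <= 2 * N)%N.
    by apply: leq_trans sl; rewrite el /= size_cat ltnS leq_addr.
  have uN : (u.1 < N)%N.
    have wH' : walk (prodR E lowR) ((k, o) :: l1) p u by apply: walk_mono wH => ? ? ? [].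
    exact: walk_node F wH' pN.
  have pu : v1 p.1 p.2 <-> v1 u.1 u.2.
    by apply: v1L; exists ((k, o) :: l1); apply: walk_mono wH => ? ? ? [].
  have exc l' p' q' : l' <> [::] -> reduced l' -> (size l' <= 2 * N)%N ->
      on (labs E) l' -> walk HR l' p' q' -> p'.2.1 < c' -> q'.2.1 < c' -> p'.2 \in Z.
    move=> ne rl' sl' lE3 wl' p'c q'c.
    apply: (hZ _ [seq ((b, e.1), e.2) | e <- l'] q'.2); split=> //.
      split; [by case: (l') ne | | by rewrite size_map |].
        by apply: (reduced_map (m := pair b) (Ls := labs E)) => // ? ? _ _ [].
      by apply/allP => _ /mapP[e el' ->] /=; apply: map_f; exact: (allP lE3).
    apply: (walk_map (Ls := labs E) (m := pair b) (f := snd) (R := HR)) => // k0 p0 q0 _ [[_ h] nl].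
    by split=> //; right.
  have pZ : p.2 \in Z by apply: (exc ((k, o) :: l1) p u).
  have uZ : u.2 \in Z.
    apply: (exc (wrev ((k, o) :: l1)) u p) => //.
    - by rewrite /wrev /= rev_cons; case: rev.
    - exact: reduced_wrev.
    - by rewrite size_wrev.
    - by rewrite on_wrev.
    - exact: walk_rev.
  rewrite (tZ _ _ pN) // pu -(tZ _ _ uN) //.
  apply: (IHl l2) => //.
    by apply: leq_trans (lm : (size l < m)%N); rewrite ltnS el size_cat leq_addl.
  by apply: leq_trans sl; rewrite el /= size_cat -addSn leq_addl.
have keyL p q : linked E p q -> (p.1 < N)%N -> p.2.1 < c' -> q.2.1 < c' ->
    (t' p.1 p.2 <-> t' q.1 q.2).
  by move=> /(linked_reduced F)[l [rl sl lE w]]; exact: key w.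
pose meets p := exists q, [/\ linked E p q, (q.1 < N)%N & q.2.1 < c'].
(* A question linked to one about a vertex below [c'] takes the answer of [t'], which by [keyL] does
   not depend on the link; all other questions keep the old prediction. *)
pose v' i x := (exists q, [/\ linked E (i, x) q, (q.1 < N)%N, q.2.1 < c' & t' q.1 q.2]) \/
  (~ meets (i, x) /\ v1 i x).
have v'P i x q : linked E (i, x) q -> (q.1 < N)%N -> q.2.1 < c' -> (v' i x <-> t' q.1 q.2).
  move=> lq qN qc; split=> [[[q' [lq' q'N q'c h]]|[n _]]|h]; last by left; exists q.
    by apply/(keyL q q') => //; apply: linked_trans lq'; exact: linked_sym.
  by case: n; exists q.
have v'E i x j y : linked E (i, x) (j, y) -> (v' i x <-> v' j y).
  move=> ll; have [[q [lq qN qc]]|nm] := pselect (meets (i, x)).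
    rewrite (v'P _ _ _ lq qN qc) (v'P j y q) //.
    by apply: linked_trans lq; exact: linked_sym.
  have nm' : ~ meets (j, y).
    by move=> [q [lq ? ?]]; apply: nm; exists q; split=> //; exact: linked_trans ll lq.
  have := v1L _ _ ll; split=> -[[q [lq qN qc _]]|[_ h]].
  - by case: nm; exists q.
  - by right; split=> //; apply/H.
  - by case: nm'; exists q.
  - by right; split=> //; apply/H.
exists t', v'; split.
- split=> //.
  + by move=> k kE; split; [exact: L|exact: le_trans (lk k kE) (ltW cc')].
  + by move=> i iN; exact: (tT i iN).1.
  + move=> i k j e; have [_ jN] := forest_bound F e.
    have := fam_alive F1 e; rewrite -(tT j jN).2 cut_cut //.
    exact: le_trans (lk _ (labE _ _ _ e)) cc1.
  + move=> i k j x y e h; apply: v'E; apply: (@linked_edge E k (i, x) (j, y)) h => //.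
    exact: L (labE _ _ _ e).
  + by move=> i x iN xc; apply: (v'P i x (i, x)) => //; exists [::].
- move=> i iN; rewrite -(t1t i iN) -(tT i iN).2 cut_cut //.
- move=> i x xQ iN; rewrite -(v1v i x xQ iN).
  have [[q [lq qN qc]]|nm] := pselect (meets (i, x)).
    rewrite (v'P _ _ _ lq qN qc) (v1L _ _ lq); case: q lq qN qc => j y lq qN qc.
    by apply: tv => //; rewrite mem_cat (hQ1 _ _ xQ lq).
  split=> [[[q [lq qN qc _]]|[]]|] //; last by right.
  by case: nm; exists q.
Qed.

End Linked.

(** * Meeting dense sets of traces along a forest *)

Section Dense.
Context {d : Order.disp_t} {T : orderType d} (HT : omega1_like T).
Notation V := (T * nat)%type.
Notation label := (@label d T).
Implicit Types (k : label) (x y z : V) (a b c : T) (p q r : nat * V) (o : bool).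
Implicit Types (E : seq (nat * label * nat)) (s u : set V).
Variables (S : @system d T) (b : T).
Hypothesis G : forall c, c < b -> good S c.

(** A forest with one node and no edge imposes no coherence, so [st_fam] realizes any finite
    pattern. *)
Lemma Tr_bits c c' s (Q : seq V) (f : V -> Prop) : c <= c' -> c' < b -> Tr S c s ->
  exists s', [/\ Tr S c' s', cut c s' = s
    & forall x, x \in Q -> c <= x.1 -> x.1 < c' -> (s' x <-> f x)].
Proof.
rewrite le_eqVlt => /orP[/eqP e|cc'] c'b Ts.
  subst c'; exists s; split=> //; first by apply: cut_id => x; apply: (Tr_sub G c'b Ts).
  by move=> x _ h1 h2; rewrite ltNge h1 in h2.
have cb := lt_trans cc' c'b.
pose v (_ : nat) x := (x.1 < c /\ s x) \/ (c <= x.1 /\ f x).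
have [|t' [h1 _ h3]] := @st_fam _ _ _ _ _ _ (G c'b) 1%N [::] (fun=> s) c v
    [seq (0%N, x) | x <- Q] cc'.
  split=> //; first exact: forest_node (forest0 _).
  move=> i x _ xc; rewrite /v; split=> [[[]//|[cx _]]|]; last by left.
  by rewrite ltNge cx in xc.
exists (t' 0%N); have [? ?] := h1 0%N erefl; split=> // x xQ cx xc'.
rewrite h3 //; last by apply: map_f.
rewrite /v; split=> [[[xc _]|[]//]|]; last by right.
by rewrite ltNge cx in xc.
Qed.

Lemma Tr_bits0 c' (Q : seq V) (f : V -> Prop) : c' < b ->
  exists s', Tr S c' s' /\ forall x, x \in Q -> x.1 < c' -> (s' x <-> f x).
Proof.
move=> c'b; have [m [_ hm]] : exists m : T, True /\ forall a, True -> m <= a.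
  by apply: (ol_min HT); exists b.
have mc' : m <= c' by apply: hm.
have mb := le_lt_trans mc' c'b.
have [s [s' [Ts' _ h]]] : exists s, exists s', [/\ Tr S c' s', cut m s' = s
    & forall x, x \in Q -> m <= x.1 -> x.1 < c' -> (s' x <-> f x)].
  have [s Ts] := st_ne (G mb); exists s.
  exact: Tr_bits.
by exists s'; split=> // x xQ; apply: h => //; exact: hm.
Qed.

Definition alive_dir o k s t := alive S k (cut (l0 k) (if o then t else s)).

(** A partnership tested only on inherited pairs starting below [c]. It makes sense also at levels
    not closed for [k]; at closed levels it is [sends] ([part_sends]). *)
Definition part o k c s t := alive_dir o k s t /\
  forall x y, step (low S) (k, o) x y -> x.1 < c -> (s x <-> t y).

Lemma step_low_lt k o c x y : legit S b k -> lC k c -> step (low S) (k, o) x y ->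
  (x.1 < c) = (y.1 < c).
Proof. by move=> L Cc; case: o => /(low_lt G L Cc). Qed.

Lemma part_sends o k c s t : legit S b k -> lC k c ->
  (forall x, s x -> x.1 < c) -> (forall x, t x -> x.1 < c) ->
  part o k c s t <-> (if o then sends S (iso S c) (res c k) s t
                      else sends S (iso S c) (res c k) t s).
Proof.
move=> L Cc hs ht; case: o.
  by rewrite (sends_low G L Cc hs ht).
rewrite (sends_low G L Cc ht hs) /part /alive_dir /step /=; split=> -[h1 h2]; split=> // x y h.
  by rewrite (low_lt G L Cc h) => yc; apply: iff_sym; apply: h2.
by rewrite -(low_lt G L Cc h) => xc; apply: iff_sym; apply: h2.
Qed.

Lemma part_ex o k c s : legit S b k -> lC k c -> Tr S c s ->
  (o = false -> alive S k (cut (l0 k) s)) -> exists t, Tr S c t /\ part o k c s t.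
Proof.
move=> L Cc Ts al; have cb := legit_lt L Cc; have Lc := legit_res L Cc.
have subT := fun u hu x => @Tr_sub _ _ _ _ G c u x cb hu.
case: o al => al.
  have [t Tt st] := st_fwd (G cb) Lc Ts; exists t; split=> //.
  by apply/part_sends => //; exact: subT.
have [|t Tt st] := st_bwd (G cb) Lc Ts; first by rewrite (alive_res _ L Cc); exact: al.
by exists t; split=> //; apply/part_sends => //; exact: subT.
Qed.

Lemma part_uniq o k c s t t' : legit S b k -> lC k c -> Tr S c s -> Tr S c t ->
  Tr S c t' -> part o k c s t -> part o k c s t' -> t = t'.
Proof.
move=> L Cc Ts Tt Tt' h h'; have cb := legit_lt L Cc; have Lc := legit_res L Cc.
have subT := fun u hu x => @Tr_sub _ _ _ _ G c u x cb hu.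
have hs := subT _ Ts; have ht := subT _ Tt; have ht' := subT _ Tt'.
case: o h h' => h h'.
  by apply: (st_uniq (G cb) Lc Tt Tt' (s := s)); [apply/(part_sends true L Cc hs ht)
    |apply/(part_sends true L Cc hs ht')].
apply: set_eq => x; have [xc|cx] := ltP x.1 c; last first.
  by split=> [/ht|/ht']; rewrite ltNge cx.
have [y hy] := low_dom G L Cc xc.
have yc : y.1 < c by rewrite -(low_lt G L Cc hy).
by rewrite -(h.2 y x hy yc) (h'.2 y x hy yc).
Qed.

Lemma part_cut o k c c' s t : l0 k <= c -> c <= c' ->
  (forall x y, step (low S) (k, o) x y -> (x.1 < c) = (y.1 < c)) ->
  part o k c' s t -> part o k c (cut c s) (cut c t).
Proof.
move=> lc cc' hlt [h1 h2]; split; first by move: h1; rewrite /alive_dir; case: o {h2 hlt}; rewrite cut_cut.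
move=> x y h xc; have xc' := lt_le_trans xc cc'.
have yc : y.1 < c by rewrite -(hlt _ _ h).
have := h2 x y h xc'; rewrite /cut => hh; split=> -[? _]; split=> //; exact/hh.
Qed.

Lemma fam_sub N E N' E' R t c (v : nat -> V -> Prop) :
  (N <= N')%N -> {subset E <= E'} -> forest N E -> fam S b R N' E' t c v ->
  fam S b R N E t c v.
Proof.
move=> NN' EE' F Fm.
have LL k : k \in labs E -> k \in labs E'.
  by case/mapP => e /EE' h ->; exact: map_f.
split=> //.
- by move=> k /LL /(fam_legit Fm).
- by move=> k k' /LL kE /LL; apply: (fam_sep Fm).
- by move=> i iN; apply: (fam_Tr Fm); exact: leq_trans iN NN'.
- by move=> i k j /EE' /(fam_alive Fm).
- by move=> i k j x y /EE' e; apply: (fam_inv Fm e).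
- by move=> i x iN; apply: (fam_val Fm); exact: leq_trans iN NN'.
Qed.

Definition upd (X : Type) (N : nat) (t : nat -> X) (u : X) i := if i == N then u else t i.

Lemma updE (X : Type) (N : nat) (t : nat -> X) (u : X) : upd N t u N = u. Proof. by rewrite /upd eqxx. Qed.

Lemma updN (X : Type) (N : nat) (t : nat -> X) (u : X) i : (i < N)%N -> upd N t u i = t i.
Proof. by move=> iN; rewrite /upd ltn_eqF. Qed.

Lemma fam_node N E R t c (v : nat -> V -> Prop) u : fam S b R N E t c v -> Tr S c u ->
  fam S b R N.+1 E (upd N t u) c (upd N v u).
Proof.
move=> Fm Tu; have F := fam_forest Fm; split=> //.
- exact: forest_node.
- exact: fam_legit Fm.
- exact: fam_sep Fm.
- move=> i; rewrite ltnS leq_eqVlt => /orP[/eqP ->|iN]; first by rewrite updE.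
  by rewrite updN //; exact: fam_Tr Fm _ iN.
- move=> i k j e; have [_ jN] := forest_bound F e.
  by rewrite updN //; exact: fam_alive Fm _ _ _ e.
- move=> i k j x y e; have [iN jN] := forest_bound F e.
  by rewrite !updN //; exact: (fam_inv Fm e).
- move=> i x; rewrite ltnS leq_eqVlt => /orP[/eqP ->|iN]; first by rewrite !updE.
  by rewrite !updN //; exact: (fam_val Fm iN).
Qed.

Lemma fam_leaf N E t c (v : nat -> V -> Prop) u i k o :
  fam S b (low S) N E t c v -> (i < N)%N -> legit S b k -> l0 k <= c ->
  sep c (k :: labs E) -> (forall j, ~ edge o i k j \in E) ->
  (forall x y, step (low S) (k, o) x y -> (x.1 < c) = (y.1 < c)) ->
  Tr S c u -> part o k c (t i) u ->
  exists v', fam S b (low S) N.+1 (edge o i k N :: E) (upd N t u) c (upd N v v').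
Proof.
move=> Fm iN L lc sp new hlt Tu [al hp]; have F := fam_forest Fm.
pose v' y := (exists2 x, step (low S) (k, o) x y & v i x) \/
  ((forall x, ~ step (low S) (k, o) x y) /\ u y).
have v'P x y : step (low S) (k, o) x y -> (v' y <-> v i x).
  move=> h; split=> [[[x' h' vx']|[n _]]|vx]; last by left; exists x.
    suff -> : x = x' by [].
    by case: o h h' {new hlt al hp v'} => h h'; [exact: (low_inj G L h h')|exact: (low_det G L h h')].
  by case: (n x).
have v'N y : (forall x, ~ step (low S) (k, o) x y) -> (v' y <-> u y).
  by move=> n; split=> [[[x /n]//|[]//]|uy]; right.
have labsE : labs (edge o i k N :: E) = k :: labs E by case: (o).
clearbody v'.
exists v'; split.
- exact: forest_leaf.
- rewrite labsE => k'; rewrite inE => /orP[/eqP ->|]; first by split.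
  exact: fam_legit Fm k'.
- by rewrite labsE.
- move=> j; rewrite ltnS leq_eqVlt => /orP[/eqP ->|jN]; first by rewrite updE.
  by rewrite updN //; exact: fam_Tr Fm _ jN.
- move=> i' k' j; rewrite inE => /orP[/eqP e|e].
    by move: al; rewrite /alive_dir; case: o e {new hlt hp v'P v'N labsE} => -[_ -> ->]; rewrite ?updE ?updN.
  have [_ jN] := forest_bound F e.
  by rewrite updN //; exact: fam_alive Fm _ _ _ e.
- move=> i' k' j x y; rewrite inE => /orP[/eqP e|e].
    case: o e v'P {new hlt hp al v'N labsE} => -[-> -> ->] h hl; rewrite updE updN //.
      exact: iff_sym (h x y hl).
    exact: h y x hl.
  have [i'N jN] := forest_bound F e.
  by rewrite !updN //; exact: (fam_inv Fm e).
- move=> j x; rewrite ltnS leq_eqVlt => /orP[/eqP ->|jN]; last first.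
    by rewrite !updN //; exact: (fam_val Fm jN).
  rewrite !updE => xc.
  have [[x' h]|n] := pselect (exists x', step (low S) (k, o) x' x).
    have x'c : x'.1 < c by rewrite (hlt _ _ h).
    by rewrite (v'P _ _ h) (fam_val Fm iN x'c) (hp _ _ h x'c).
  by apply: v'N => x' h; apply: n; exists x'.
Qed.

Definition upward (D : T -> set V -> Prop) := forall c c' s, c <= c' -> c' < b ->
  Tr S c' s -> D c (cut c s) -> D c' s.

Definition dense (D : T -> set V -> Prop) := forall c s, c < b -> Tr S c s ->
  exists c' s', [/\ c <= c', c' < b, Tr S c' s', cut c s' = s & D c' s'].

(** Induction on the forest, with the last leaf removed. If the leaf is not the target, its partner
    is found again at a higher closed level; if it is, the dense set is pulled back along its edge
    to the neighbour. *)
Lemma dense_fam N E t c (v : nat -> V -> Prop) i D :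
  (forall k, k \in labs E -> forall a, a < b -> exists2 a', lC k a' & a < a') ->
  fam S b (low S) N E t c v -> c < b -> (i < N)%N -> upward D -> dense D ->
  exists c' t' (v' : nat -> V -> Prop), [/\ c <= c', c' < b,
    fam S b (low S) N E t' c' v', forall j, (j < N)%N -> cut c (t' j) = t j & D c' (t' i)].
Proof.
move=> + Fm; have F := fam_forest Fm.
elim: F t c v i D Fm => {N E} [//|N E F IH|N E i0 k o F IH i0N new] t c v i D Fm hA cb iN upD dD.
- have Fm0 : fam S b (low S) N E t c v by apply: fam_sub Fm.
  have TN : Tr S c (t N) by apply: (fam_Tr Fm).
  move: iN; rewrite ltnS leq_eqVlt => /orP[/eqP ->|iN].
    have [c' [s' [cc' c'b Ts' es Ds]]] := dD c (t N) cb TN.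
    have [t' [v' [Fm' tt' _]]] := extend HT G c'b [::] cc' Fm0.
    exists c', (upd N t' s'), (upd N v' s'); split=> //; last by rewrite updE.
      exact: fam_node.
    move=> j; rewrite ltnS leq_eqVlt => /orP[/eqP ->|jN]; first by rewrite updE.
    by rewrite updN ?tt'.
  have [c' [t' [v' [cc' c'b Fm' tt' Di]]]] := IH t c v i D Fm0 hA cb iN upD dD.
  have [s' [Ts' es _]] := Tr_bits [::] (fun=> True) cc' c'b TN.
  exists c', (upd N t' s'), (upd N v' s'); split=> //; last by rewrite updN.
    exact: fam_node.
  move=> j; rewrite ltnS leq_eqVlt => /orP[/eqP ->|jN]; first by rewrite updE.
  by rewrite updN ?tt'.
have labsE : labs (edge o i0 k N :: E) = k :: labs E by case: (o).
have kE : k \in labs (edge o i0 k N :: E) by rewrite labsE mem_head.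
have [L lk] := fam_legit Fm kE.
have cofk a : a < b -> exists2 a', lC k a' & a < a' by apply: hA; rewrite labsE mem_head.
have [c1 C1 cc1] := cofk c cb; have c1b := legit_lt L C1.
have [t1 [v1 [Fm1 tt1 _]]] := extend HT G c1b [::] (ltW cc1) Fm.
have Fm0 : fam S b (low S) N E t1 c1 v1.
  by apply: fam_sub Fm1 => // e eE; rewrite inE eE orbT.
have part1 : part o k c1 (t1 i0) (t1 N).
  have NN : (N < N.+1)%N by []. have i0N' : (i0 < N.+1)%N by apply: ltnW.
  split.
    rewrite /alive_dir; have := fam_alive Fm1; case: (o) => h; [apply: (h i0 k N)|apply: (h N k i0)];
    exact: mem_head.
  move=> x y h xc; have yc : y.1 < c1 by rewrite -(step_low_lt L C1 h).
  rewrite -(fam_val Fm1 i0N' xc) -(fam_val Fm1 NN yc).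
  have hin := fam_inv Fm1; move: h; rewrite /step /=; case eo: o => h.
    by apply: (hin i0 k N) h; rewrite eo; exact: mem_head.
  by apply: iff_sym; apply: (hin N k i0) h; rewrite eo; exact: mem_head.
have Ti0 : Tr S c1 (t1 i0) by apply: (fam_Tr Fm1); exact: ltnW.
have TN : Tr S c1 (t1 N) by apply: (fam_Tr Fm1).
have hlt c2 : lC k c2 -> forall x y, step (low S) (k, o) x y -> (x.1 < c2) = (y.1 < c2).
  by move=> C2 x y; exact: step_low_lt.
have lC2 c2 : lC k c2 -> l0 k <= c2 by move=> /(legit_C L)[/ltW].
(* By uniqueness of partners at [c1], the partner of an extension of [t1 i0]
   extends [t1 N]. *)
have part_ext c2 s u : lC k c2 -> c1 <= c2 -> Tr S c2 s -> cut c1 s = t1 i0 ->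
    Tr S c2 u -> part o k c2 s u -> cut c1 u = t1 N.
  move=> C2 c12 Ts es Tu pu; have c2b := legit_lt L C2.
  have Tu1 := Tr_cut_le G c12 c2b Tu.
  apply: (part_uniq L C1 Ti0 Tu1 TN _ part1); rewrite -es.
  by apply: part_cut pu => //; [exact: lC2|exact: hlt].
have al_ext c2 s : c1 <= c2 -> cut c1 s = t1 i0 -> o = false -> alive S k (cut (l0 k) s).
  move=> c12 es eo; have := part1.1; rewrite /alive_dir eo -es cut_cut //; exact: lC2.
have fin c2 t2 v2 : lC k c2 -> c1 <= c2 -> fam S b (low S) N E t2 c2 v2 ->
    cut c1 (t2 i0) = t1 i0 -> exists u v', [/\ cut c1 u = t1 N, part o k c2 (t2 i0) u &
    fam S b (low S) N.+1 (edge o i0 k N :: E) (upd N t2 u) c2 (upd N v2 v')].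
  move=> C2 c12 Fm2 e2; have T2 := fam_Tr Fm2 i0N.
  have [u [Tu pu]] := part_ex L C2 T2 (al_ext _ _ c12 e2).
  have [|v' Fm3] := fam_leaf Fm2 i0N L (lC2 _ C2) _ new (hlt _ C2) Tu pu.
    by rewrite -labsE; apply: sep_mono (fam_sep Fm1).
  by exists u, v'; split=> //; apply: part_ext pu.
have hA' k' : k' \in labs E -> forall a, a < b -> exists2 a', lC k' a' & a < a'.
  by move=> k'E; apply: hA; rewrite labsE inE k'E orbT.
have wrap c2 t2 u : c1 <= c2 -> (forall j, (j < N)%N -> cut c1 (t2 j) = t1 j) ->
    cut c1 u = t1 N -> forall j, (j < N.+1)%N -> cut c (upd N t2 u j) = t j.
  move=> c12 e2 eu j jN; rewrite -(tt1 j jN) -(cut_cut _ (ltW cc1)).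
  move: jN; rewrite ltnS leq_eqVlt => /orP[/eqP ->|jN]; first by rewrite updE eu.
  by rewrite updN ?e2.
move: iN; rewrite ltnS leq_eqVlt => /orP[/eqP ei|iN]; last first.
  have [c' [t' [v' [cc' c'b Fm' tt' Di]]]] := IH t1 c1 v1 i D Fm0 hA' c1b iN upD dD.
  have [c2 C2 c'2] := cofk c' c'b; have c2b := legit_lt L C2.
  have [t2 [v2 [Fm2 tt2 _]]] := extend HT G c2b [::] (ltW c'2) Fm'.
  have c12 := le_trans cc' (ltW c'2).
  have e12 j : (j < N)%N -> cut c1 (t2 j) = t1 j.
    by move=> jN; rewrite -(tt' j jN) -(tt2 j jN) cut_cut.
  have [u [v3 [eu pu Fm3]]] := fin c2 t2 v2 C2 c12 Fm2 (e12 _ i0N).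
  exists c2, (upd N t2 u), (upd N v2 v3); split=> //.
  - exact: le_trans (ltW cc1) c12.
  - exact: wrap.
  - rewrite updN //; apply: (upD c') => //; [exact: ltW|exact: fam_Tr Fm2 _ iN|].
    by rewrite tt2.
(* [D'] is [D] seen through the edge: the partner of [s] at some closed level is in [D]. It is void
   for traces that do not extend [t1 i0], since only the extensions of [t1 i0] have partners over
   [t1 N]. *)
pose D' g s := c1 <= g /\ (cut c1 s = t1 i0 -> exists c2 u, [/\ lC k c2, c1 <= c2, c2 <= g &
  [/\ Tr S c2 u, part o k c2 (cut c2 s) u & D c2 u]]).
have upD' : upward D'.
  move=> g g' s gg' g'b Ts [c1g h]; split; first exact: le_trans c1g gg'.
  move=> es; have [|c2 [u [C2 c12 c2g [Tu pu Du]]]] := h; first by rewrite cut_cut.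
  exists c2, u; split=> //; first exact: le_trans c2g gg'.
  by move: pu; rewrite cut_cut.
have dD' : dense D'.
  move=> g s gb Ts.
  have [g1 C1' hg1] : exists2 g1, lC k g1 & c1 <= g1 /\ g <= g1.
    have mb : Order.max c1 g < b by rewrite gt_max c1b gb.
    have [g1 C1' h] := cofk _ mb; exists g1 => //; move: h; rewrite gt_max => /andP[? ?].
    by split; exact: ltW.
  have [c1g gg1] := hg1; have g1b := legit_lt L C1'.
  have [s1 [Ts1 es1 _]] := Tr_bits [::] (fun=> True) gg1 g1b Ts.
  have [e1|ne1] := pselect (cut c1 s1 = t1 i0); last by exists g1, s1; split.
  have [u1 [Tu1 pu1]] := part_ex L C1' Ts1 (al_ext _ _ c1g e1).
  have [g2 [u2 [g12 g2b Tu2 eu2 Du2]]] := dD g1 u1 g1b Tu1.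
  have [g3 C3 g23] := cofk g2 g2b; have g3b := legit_lt L C3.
  have [u3 [Tu3 eu3 _]] := Tr_bits [::] (fun=> True) (ltW g23) g3b Tu2.
  have eu31 : cut g1 u3 = u1 by rewrite -eu2 -eu3 cut_cut.
  have g13 := le_trans g12 (ltW g23).
  have flip o' c2 s' u' : lC k c2 -> part o' k c2 s' u' -> part (~~ o') k c2 u' s'.
    move=> C2 [h1 h2]; split; first by move: h1; rewrite /alive_dir; case: o' {h2}.
    move=> x y h xc; apply: iff_sym; apply: h2; first by move: h; case: o' {h1}.
    by rewrite -(step_low_lt L C2 h).
  have [|s3 [Ts3 ps3]] := part_ex (o := ~~ o) L C3 Tu3.
    move=> eo; have := pu1.1; rewrite /alive_dir; have -> : o = true by case: (o) eo.
    by rewrite -eu31 cut_cut //; exact: lC2.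
  have es3 : cut g1 s3 = s1.
    have Ts31 := Tr_cut_le G g13 g3b Ts3.
    apply: (part_uniq (o := ~~ o) L C1' Tu1 Ts31 Ts1); last exact: flip.
    rewrite -eu31; apply: part_cut ps3 => //; first exact: lC2.
    by move=> x y; exact: step_low_lt.
  exists g3, s3; split=> //; first exact: le_trans gg1 g13.
    by rewrite -es1 -es3 cut_cut.
  split; first exact: le_trans c1g g13.
  move=> _; exists g3, u3; split=> //; first exact: le_trans c1g g13.
  rewrite cut_id; last by move=> x; exact: (Tr_sub G g3b Ts3).
  split=> //; first by have := flip _ _ _ _ C3 ps3; rewrite negbK.
  by apply: (upD g2) => //; [exact: ltW|rewrite eu3].
have [c' [t' [v' [cc' c'b Fm' tt' [_ Di]]]]] := IH t1 c1 v1 i0 D' Fm0 hA' c1b i0N upD' dD'.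
have [c2 [u [C2 c12 c2c' [Tu pu Du]]]] := Di (tt' _ i0N).
have [c3 C3 c'3] := cofk c' c'b; have c3b := legit_lt L C3.
have [t3 [v3 [Fm3 tt3 _]]] := extend HT G c3b [::] (ltW c'3) Fm'.
have c13 := le_trans cc' (ltW c'3).
have e13 j : (j < N)%N -> cut c1 (t3 j) = t1 j.
  by move=> jN; rewrite -(tt' j jN) -(tt3 j jN) cut_cut.
have [u3 [v4 [eu3 pu3 Fm4]]] := fin c3 t3 v3 C3 c13 Fm3 (e13 _ i0N).
exists c3, (upd N t3 u3), (upd N v3 v4); split=> //.
- exact: le_trans (ltW cc1) c13.
- exact: wrap.
rewrite ei updE; have c23 := le_trans c2c' (ltW c'3).
have Tu3 : Tr S c3 u3 by have := fam_Tr Fm4 (ltnSn N); rewrite updE.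
apply: (upD c2) => //.
suff -> : cut c2 u3 = u by [].
have c2b := legit_lt L C2.
have T3 := fam_Tr Fm3 i0N.
apply: (part_uniq L C2 (Tr_cut_le G c23 c3b T3) (Tr_cut_le G c23 c3b Tu3) Tu).
  by apply: part_cut pu3 => //; [exact: lC2|exact: hlt].
have -> // : cut c2 (t3 i0) = cut c2 (t' i0).
by rewrite -(tt3 _ i0N) cut_cut.
Qed.

End Dense.

(** * Finite approximations *)

Section States.
Context {d : Order.disp_t} {T : orderType d} (HT : omega1_like T).
Notation V := (T * nat)%type.
Notation label := (@label d T).
Implicit Types (k : label) (x y z : V) (a b c : T) (p q r : nat * V) (o : bool).
Implicit Types (E : seq (nat * label * nat)) (s u w : set V).
Variables (S : @system d T) (b : T).
Hypothesis G : forall c, c < b -> good S c.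

Definition cofinal k := forall a, a < b -> exists2 a', lC k a' & a < a'.

Definition pairs (P : seq (label * bool * V * V)) k x y :=
  (k, true, x, y) \in P \/ (k, false, y, x) \in P.

Definition Rp P k x y := low S k x y \/ pairs P k x y.

(* A forest [sE] on the nodes below [sN], with traces [sT] of level [sc]. An entry
   [(k, o, u, z)] of [sP] records that [z] was added as the image of [u] under
   the isomorphism of [k] if [o], and as its preimage otherwise. *)
Record state := State {
  sN : nat; sE : seq (nat * label * nat); sT : nat -> set V; sc : T;
  sP : seq (label * bool * V * V) }.

Implicit Types sg : state.

(** By [i_clos], a label on an edge either is cofinal, and then never receives a pair
    ([cofinal_nopair]), or has all its inherited pairs below the current level, where the values are
    decided. *)
Record sound sg : Prop := Sound {
  i_c : sc sg < b;
  i_fam : exists v, fam S b (low S) (sN sg) (sE sg) (sT sg) (sc sg) v;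
  i_clos : forall k, k \in labs (sE sg) -> cofinal k \/ forall c, lC k c -> c <= sc sg;
  i_P : forall k x y, pairs (sP sg) k x y ->
    [/\ legit S b k, x.1 < sc sg /\ y.1 < sc sg, lW k y
      & forall c, lC k c -> c <= x.1 /\ c <= y.1];
  i_inj : forall k x y x' y', pairs (sP sg) k x y -> pairs (sP sg) k x' y' ->
    (x = x' <-> y = y');
  i_adj : forall k x y x' y', pairs (sP sg) k x y -> Rp (sP sg) k x' y' ->
    (joined S x x' <-> joined S y y');
  i_t : forall i k j x y, (i, k, j) \in sE sg -> pairs (sP sg) k x y ->
    (sT sg i x <-> sT sg j y) }.

Record le_st sg sg' : Prop := LeSt {
  le_N : (sN sg <= sN sg')%N;
  le_E : {subset sE sg <= sE sg'};
  le_c : sc sg <= sc sg';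
  le_T : forall i, (i < sN sg)%N -> cut (sc sg) (sT sg' i) = sT sg i }.

Lemma le_st_trans sg1 sg2 sg3 : le_st sg1 sg2 -> le_st sg2 sg3 -> le_st sg1 sg3.
Proof.
case=> N1 E1 c1 T1 [N2 E2 c2 T2]; split.
- exact: leq_trans N1 N2.
- by move=> e /E1 /E2.
- exact: le_trans c1 c2.
- by move=> i iN; rewrite -T1 // -T2 ?cut_cut //; exact: leq_trans iN N1.
Qed.

Lemma cut_at c s s' x : cut c s' = s -> x.1 < c -> (s' x <-> s x).
Proof. by move=> <- xc; split=> [|[]]. Qed.

Lemma fam_ext N E t c (v : nat -> V -> Prop) t' c' (v' : nat -> V -> Prop) (R R' : label -> V -> V -> Prop) :
  fam S b R N E t c v -> c <= c' ->
  (forall i, (i < N)%N -> Tr S c' (t' i) /\ cut c (t' i) = t i) ->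
  (forall i k j x y, (i, k, j) \in E -> R' k x y -> (v' i x <-> v' j y)) ->
  (forall i x, (i < N)%N -> x.1 < c' -> (v' i x <-> t' i x)) ->
  fam S b R' N E t' c' v'.
Proof.
move=> Fm cc' ht hi hv; have F := fam_forest Fm; split=> //.
- by move=> k /(fam_legit Fm)[? lk]; split=> //; exact: le_trans lk cc'.
- exact: sep_mono cc' (fam_sep Fm).
- by move=> i /ht[].
- move=> i k j e; have [_ jN] := forest_bound F e.
  have kE : k \in labs E by apply/mapP; exists (i, k, j).
  have := fam_alive Fm e; rewrite -(ht j jN).2 cut_cut //.
  by have [] := fam_legit Fm kE.
Qed.

Lemma inv_ext sg t' c' v' : sound sg -> sc sg <= c' -> c' < b ->
  fam S b (low S) (sN sg) (sE sg) t' c' v' ->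
  (forall i, (i < sN sg)%N -> cut (sc sg) (t' i) = sT sg i) ->
  sound (State (sN sg) (sE sg) t' c' (sP sg)) /\
  le_st sg (State (sN sg) (sE sg) t' c' (sP sg)).
Proof.
move=> I cc' c'b Fm' tt'; split; last by split.
have [v Fm] := i_fam I; have F := fam_forest Fm.
split=> //=.
- by exists v'.
- move=> k /(i_clos I)[|h]; [by left|right=> c /h h'; exact: le_trans h' cc'].
- move=> k x y /(i_P I)[? [h1 h2] ? ?]; split=> //.
  by split; [exact: lt_le_trans h1 cc'|exact: lt_le_trans h2 cc'].
- exact: i_inj I.
- exact: i_adj I.
- move=> i k j x y e h; have [iN jN] := forest_bound F e.
  have [_ [xc yc] _ _] := i_P I h.
  by rewrite (cut_at (tt' i iN) xc) (cut_at (tt' j jN) yc); exact: (i_t I e h).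
Qed.

Lemma raise_v sg c' v (Q : seq (nat * V)) : sound sg ->
  fam S b (low S) (sN sg) (sE sg) (sT sg) (sc sg) v -> sc sg <= c' -> c' < b ->
  exists t', [/\ sound (State (sN sg) (sE sg) t' c' (sP sg)),
    le_st sg (State (sN sg) (sE sg) t' c' (sP sg))
    & forall i x, (i, x) \in Q -> (i < sN sg)%N -> x.1 < c' -> (t' i x <-> v i x)].
Proof.
move=> I Fm cc' c'b.
have [t' [v' [Fm' tt' vv']]] := extend HT G c'b Q cc' Fm.
have [I' L'] := inv_ext I cc' c'b Fm' tt'.
exists t'; split=> // i x xQ iN xc.
by rewrite -(vv' i x xQ iN) (fam_val Fm' iN xc).
Qed.

Lemma raise sg c' : sound sg -> sc sg <= c' -> c' < b ->
  exists t', sound (State (sN sg) (sE sg) t' c' (sP sg)) /\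
    le_st sg (State (sN sg) (sE sg) t' c' (sP sg)).
Proof.
move=> I cc' c'b; have [v Fm] := i_fam I.
by have [t' [? ? _]] := raise_v [::] I Fm cc' c'b; exists t'.
Qed.

Lemma cofinal_or k : legit S b k -> cofinal k \/
  exists a, [/\ a < b, l0 k <= a, forall c, lC k c -> c <= a &
    lC k a \/ (a = l0 k /\ forall c, ~ lC k c)].
Proof.
move=> L; have [cof|ncof] := pselect (cofinal k); [by left|right].
have nCb : ~ lC k b by move=> /(legit_C L)[_]; rewrite ltxx.
have [|a [la ab amax h]] := legit_max HT L (legit_l0 L) (lexx b) nCb.
  move=> _ h; apply: ncof => a ab.
  by have [a' [Ca' aa' _]] := h a ab; exists a'.
exists a; split=> // [c Cc|]; first by apply: amax => //; exact: (legit_lt L Cc).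
case: h => [|[-> h]]; [by left|right; split=> // c Cc].
by apply: (h c Cc); exact: (legit_lt L Cc).
Qed.

Lemma low_lt_bound k a o x y : legit S b k -> (forall c, lC k c -> c <= a) ->
  step (low S) (k, o) x y -> x.1 < a /\ y.1 < a.
Proof.
move=> L ha h.
suff h1 : forall x y, low S k x y -> x.1 < a /\ y.1 < a.
  by case: o h => /h1 [].
move=> {o x y h} x y h; have [_ _ _ [c [Cc xc yc]]] := low_wf G L h.
by split; [exact: lt_le_trans xc (ha c Cc)|exact: lt_le_trans yc (ha c Cc)].
Qed.

End States.

(** * Amalgamation of families and free values at isolated vertices *)

Section Amalgamation.
Context {d : Order.disp_t} {T : orderType d} (HT : omega1_like T).
Notation V := (T * nat)%type.
Notation label := (@label d T).
Notation state := (@state d T).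
Implicit Types (k : label) (x y z : V) (a b c : T) (p q r : nat * V) (o : bool).
Implicit Types (E : seq (nat * label * nat)) (s u w : set V) (sg : state).
Variables (S : @system d T) (b : T).
Hypothesis G : forall c, c < b -> good S c.
Notation sound := (sound S b).

Definition shift N E := [seq ((N + e.1.1)%N, e.1.2, (N + e.2)%N) | e <- E].

Definition glue (X : Type) (N : nat) (f g : nat -> X) i := if (i < N)%N then f i else g (i - N)%N.

Lemma glueL (X : Type) (N : nat) (f g : nat -> X) i : (i < N)%N -> glue N f g i = f i.
Proof. by rewrite /glue => ->. Qed.

Lemma glueR (X : Type) (N : nat) (f g : nat -> X) i : glue N f g (N + i)%N = g i.
Proof. by rewrite /glue ltnNge leq_addr addKn. Qed.

Lemma mem_shift N E i k j : (i, k, j) \in shift N E ->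
  exists i' j', [/\ (i', k, j') \in E, i = (N + i')%N & j = (N + j')%N].
Proof. by case/mapP => -[[i' k'] j'] e [-> -> ->]; exists i', j'. Qed.

Lemma shift_mem N E i k j : (i, k, j) \in E -> ((N + i)%N, k, (N + j)%N) \in shift N E.
Proof. by move=> e; apply/mapP; exists (i, k, j). Qed.

Lemma labs_shift N E : labs (shift N E) = labs E.
Proof. by rewrite /labs -map_comp. Qed.

Lemma fam_cat N E t c (v : nat -> V -> Prop) N' E' t' (v' : nat -> V -> Prop) R :
  fam S b R N E t c v -> fam S b R N' E' t' c v' -> sep c (labs E' ++ labs E) ->
  fam S b R (N + N') (shift N E' ++ E) (glue N t t') c (glue N v v').
Proof.
move=> Fm Fm' sp; have F := fam_forest Fm; have F' := fam_forest Fm'.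
have labsE : labs (shift N E' ++ E) = labs E' ++ labs E by rewrite -(labs_shift N E') /labs -map_cat.
have split_lt i : (i < N + N')%N -> (i < N)%N \/ exists2 i', (i' < N')%N & i = (N + i')%N.
  move=> iN; have [?|Ni] := ltnP i N; [by left|right].
  by exists (i - N)%N; [rewrite ltn_subLR|rewrite subnKC].
split.
- exact: forest_cat.
- rewrite labsE => k; rewrite mem_cat => /orP[]; [exact: (fam_legit Fm')|exact: (fam_legit Fm)].
- by rewrite labsE.
- move=> i /split_lt[iN|[i' iN ->]]; first by rewrite glueL //; exact: (fam_Tr Fm).
  by rewrite glueR; exact: (fam_Tr Fm').
- move=> i k j; rewrite mem_cat => /orP[/mem_shift[i' [j' [e _ ->]]]|e].
    by rewrite glueR; exact: (fam_alive Fm' e).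
  by have [_ jN] := forest_bound F e; rewrite glueL //; exact: (fam_alive Fm e).
- move=> i k j x y; rewrite mem_cat => /orP[/mem_shift[i' [j' [e -> ->]]]|e].
    by rewrite !glueR; exact: (fam_inv Fm' e).
  by have [iN jN] := forest_bound F e; rewrite !glueL //; exact: (fam_inv Fm e).
- move=> i x /split_lt[iN|[i' iN ->]]; first by rewrite !glueL //; exact: (fam_val Fm).
  by rewrite !glueR; exact: (fam_val Fm').
Qed.

Lemma fam_mono N E t c (v : nat -> V -> Prop) (R R' : label -> V -> V -> Prop) :
  (forall k x y, R' k x y -> R k x y) -> fam S b R N E t c v -> fam S b R' N E t c v.
Proof.
by move=> RR' [? ? ? ? ? h ?]; split=> // i k j x y e /RR'; exact: h.
Qed.

Lemma sep_raise (ks : seq label) a : (forall k, k \in ks -> legit S b k) -> a < b ->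
  exists c, [/\ c < b, a <= c & sep c ks].
Proof. by move=> hL ab; have [c [cb ac h]] := sep_eventually hL ab; exists c; split=> //; exact: h. Qed.

Lemma closed_raise (ks : seq label) a : (forall k, k \in ks -> legit S b k) -> a < b ->
  exists c, [/\ c < b, a <= c & forall k, k \in ks -> cofinal b k \/
    forall c', lC k c' -> c' <= c].
Proof.
move=> hL ab; have [||c [cb ac h]] := @seq_bound _ _ _ ks
    (fun k c => cofinal b k \/ forall c', lC k c' -> c' <= c) b a ab.
- move=> k /hL L; have [cof|[a' [a'b _ h _]]] := cofinal_or HT L; first by exists a => //; left.
  by exists a' => //; right.
- move=> k c1 c2 [h|h] c12; [by left|right=> c' /h h']; exact: le_trans h' c12.
by exists c.
Qed.

Lemma pts_raise (Q : seq V) a : a < b -> exists c, [/\ c < b, a <= c &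
  forall x, x \in Q -> x.1 < b -> x.1 <= c].
Proof.
move=> ab; have [||c [cb ac h]] := @seq_bound _ _ _ Q
    (fun x c => x.1 < b -> x.1 <= c) b a ab.
- move=> x _; have [xb|bx] := ltP x.1 b; first by exists x.1.
  by exists a => // h; rewrite ltNge bx in h.
- by move=> x c1 c2 h c12 /h h'; exact: le_trans h' c12.
by exists c.
Qed.

Hypothesis lim : forall a, a < b -> exists c, a < c /\ c < b.

(** The new family becomes a disjoint component of the forest, so no edge links it to the old part;
    a level at which all labels involved are separated is needed first. *)
Lemma handle_fam sg N E t c (v : nat -> V -> Prop) (Q : seq (nat * V)) :
  sound sg -> c < b -> fam S b (Rp S (sP sg)) N E t c v ->
  exists sg' M, [/\ sound sg', le_st sg sg', sP sg' = sP sg &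
    [/\ c <= sc sg', (M + N <= sN sg')%N,
      forall i, (i < N)%N -> cut c (sT sg' (M + i)%N) = t i,
      forall i k j, (i, k, j) \in E -> ((M + i)%N, k, (M + j)%N) \in sE sg'
    & forall i x, (i, x) \in Q -> (i < N)%N -> x.1 < b ->
        x.1 < sc sg' /\ (sT sg' (M + i)%N x <-> v i x)]].
Proof.
move=> I cb FmP; have F := fam_forest FmP.
have Fm : fam S b (low S) N E t c v by apply: fam_mono FmP => k x y; left.
have [v0 Fm0] := i_fam I.
have hL k : k \in labs E ++ labs (sE sg) -> legit S b k.
  by rewrite mem_cat => /orP[/(fam_legit Fm)|/(fam_legit Fm0)] [].
have mb : Order.max (sc sg) c < b by rewrite gt_max (i_c I) cb.
have [c1 [c1b hc1 sp1]] := sep_raise hL mb.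
have [c2 [c2b c12 cl2]] := closed_raise hL c1b.
have [c3 [c3b c23 h3]] := pts_raise (map snd Q) c2b.
have [c4 [c34 c4b]] := lim c3b.
have c14 : c1 <= c4 by apply: le_trans (ltW c34); exact: le_trans c12 c23.
have [sc1 cc1] : sc sg <= c1 /\ c <= c1 by move: hc1; rewrite ge_max => /andP.
have [t1 [Is Ls]] := raise HT G I (le_trans sc1 c14) c4b.
(* The vertices of the pairs already added are included, so that the extended traces keep the
   coherence with these pairs that the prediction [v] has. *)
have Q2 : exists Q2 : seq (nat * V), {subset Q <= Q2} /\
    forall i k x y, (i < N)%N -> pairs (sP sg) k x y -> (i, x) \in Q2 /\ (i, y) \in Q2.
  exists (Q ++ [seq (i, x) | i <- iota 0 N, x <- [seq e.1.2 | e <- sP sg] ++ [seq e.2 | e <- sP sg]]).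
  split=> [q qQ|i k x y iN h]; first by rewrite mem_cat qQ.
  have memQ z : z \in [seq e.1.2 | e <- sP sg] ++ [seq e.2 | e <- sP sg] ->
     (i, z) \in [seq (i, x) | i <- iota 0 N, x <- [seq e.1.2 | e <- sP sg] ++ [seq e.2 | e <- sP sg]].
    by move=> zP; apply/allpairsP; exists (i, z); rewrite mem_iota.
  have [xP yP] : x \in [seq e.1.2 | e <- sP sg] ++ [seq e.2 | e <- sP sg] /\
      y \in [seq e.1.2 | e <- sP sg] ++ [seq e.2 | e <- sP sg].
    by rewrite !mem_cat; case: h => h; split; apply/orP; [left|right|right|left];
      apply/mapP; (eexists; first exact: h).
  by split; rewrite mem_cat memQ ?orbT.
have [{}Q2 [QQ2 hQ2]] := Q2.
have [t2 [v2 [Fm2 tt2 vv2]]] := extend HT G c4b Q2 (le_trans cc1 c14) Fm.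
have [v1 Fm1] := i_fam Is.
have Fm3 := fam_cat Fm1 Fm2 (sep_mono c14 sp1).
exists (State (sN sg + N) (shift (sN sg) E ++ sE sg) (glue (sN sg) t1 t2) c4 (sP sg)), (sN sg).
have F1 := fam_forest Fm1.
have hT i : (i < sN sg)%N -> cut (sc sg) (t1 i) = sT sg i by move=> iN; exact: (le_T Ls iN).
have tv2 i x : (i < N)%N -> (i, x) \in Q2 -> x.1 < c4 -> (t2 i x <-> v i x).
  by move=> iN xQ xc; rewrite -(fam_val Fm2 iN xc); exact: vv2.
have labsE : labs (shift (sN sg) E ++ sE sg) = labs E ++ labs (sE sg).
  by rewrite -(labs_shift (sN sg) E) /labs -map_cat.
split=> //; last first.
- split=> /=.
  + exact: le_trans cc1 c14.
  + by [].
  + by move=> i iN; rewrite glueR; exact: tt2.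
  + by move=> i k j e; rewrite mem_cat shift_mem.
  + move=> i x xQ iN xb; have xc : x.1 < c4.
      by apply: le_lt_trans c34; apply: h3 => //; apply/mapP; exists (i, x).
    by split=> //; rewrite glueR; apply: tv2 => //; exact: QQ2.
- split=> /=; [exact: leq_addr | by move=> e eE; rewrite mem_cat eE orbT
    | exact: le_trans sc1 c14 | by move=> i iN; rewrite glueL ?hT].
- split=> //=.
  + by exists (glue (sN sg) v1 v2).
  + rewrite labsE => k /cl2[|h]; [by left|right=> c' /h h'].
    by apply: le_trans h' _; apply: le_trans (ltW c34).
  + exact: (i_P Is).
  + exact: (i_inj I).
  + exact: (i_adj I).
  + move=> i k j x y; rewrite mem_cat => /orP[/mem_shift[i' [j' [e -> ->]]] h|e h]; last first.
      have [iN jN] := forest_bound F1 e.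
      by rewrite !glueL //; exact: (i_t Is e h).
    have [iN jN] := forest_bound F e.
    have [_ [xc yc] _ _] := i_P Is h.
    have [xi _] := hQ2 i' k x y iN h; have [_ yj] := hQ2 j' k x y jN h.
    by rewrite !glueR (tv2 i' x) // (tv2 j' y) //; apply: (fam_inv FmP e); right.
Qed.

(** Overwriting the answer at [(j, z)] forces the answers at all linked questions. By isolation no
    two nodes are linked at [z], so the choices do not clash, and no link leads below [c], so
    decided values are untouched. *)
Lemma free_values N E t c (v : nat -> V -> Prop) z (f : nat -> Prop) :
  fam S b (low S) N E t c v -> c < b -> c <= z.1 ->
  isolated (letR S b) [seq (b, k) | k <- labs E] (2 * N) (fun x => x.1 < c) z ->
  exists v', fam S b (low S) N E t c v' /\ forall j, (j < N)%N -> (v' j z <-> f j).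
Proof.
move=> Fm cb cz [iso1 iso2]; have F := fam_forest Fm.
pose Ls := [seq (b, k) | k <- labs E].
have proj p q : linked S b E p q -> exists l, [/\ reduced l, (size l <= 2 * N)%N, on Ls l,
    walk (letR S b) l p.2 q.2 & l = [::] -> p = q].
  move=> /(linked_reduced G F)[l [rl sl lE w]].
  exists [seq (b, e.1, e.2) | e <- l]; split.
  - by apply: (reduced_map (m := pair b) (Ls := labs E)) => // ? ? _ _ [].
  - by rewrite size_map.
  - by apply/allP => _ /mapP[e el ->] /=; apply: map_f; exact: (allP lE).
  - apply: (walk_map (Ls := labs E) (m := pair b) (f := snd) (R := prodR E (lowR S b))) => //.
    by move=> k p0 q0 _ [_ h]; right.
  - by case: (l) w.
have noV i x j : linked S b E (i, x) (j, z) -> ~ x.1 < c.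
  by move=> /proj[l [_ sl lL w _]] xc; exact: (iso1 l x sl lL xc w).
have uniq i j : linked S b E (i, z) (j, z) -> i = j.
  by move=> /proj[l [rl sl lL w h]]; have [] := h (iso2 l sl lL rl w).
pose hit i x j := (j < N)%N /\ linked S b E (i, x) (j, z).
pose v' i x := (exists2 j, hit i x j & f j) \/ ((forall j, ~ hit i x j) /\ v i x).
have v'P i x j : hit i x j -> (v' i x <-> f j).
  move=> h; split=> [[[j' h' fj']|[n _]]|fj]; last by left; exists j.
    suff -> : j = j' by [].
    by apply: uniq; apply: linked_trans h'.2; apply: linked_sym; exact: h.2.
  by case: (n j).
have v'N i x : (forall j, ~ hit i x j) -> (v' i x <-> v i x).
  by move=> n; split=> [[[j /n]//|[]//]|?]; right.
exists v'; split; last by move=> j jN; apply: v'P; split=> //; exists [::].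
apply: (fam_ext Fm) => //.
- move=> i iN; have Ti := fam_Tr Fm iN; split=> //; apply: cut_id => x.
  exact: (Tr_sub G cb Ti).
- move=> i k j x y e h.
  have ll : linked S b E (i, x) (j, y).
    apply: (@linked_edge _ _ S b E k (i, x) (j, y)) => //.
    have kE : k \in labs E by apply/mapP; exists (i, k, j).
    by have [] := fam_legit Fm kE.
  have hh m : hit i x m <-> hit j y m.
    split=> -[mN l]; split=> //; apply: linked_trans l => //; exact: linked_sym.
  have [[m hm]|n] := pselect (exists m, hit i x m).
    by rewrite (v'P _ _ _ hm) (v'P j y m) //; apply/hh.
  rewrite v'N; last by move=> m hm; apply: n; exists m.
  rewrite v'N; last by move=> m /hh hm; apply: n; exists m.
  exact: (fam_inv Fm e h).
- move=> i x iN xc; rewrite v'N; first exact: (fam_val Fm).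
  by move=> j [_ l]; exact: noV l xc.
Qed.

End Amalgamation.

(** * Labels with a last closed level *)

Section Bases.
Context {d : Order.disp_t} {T : orderType d} (HT : omega1_like T).
Notation V := (T * nat)%type.
Notation label := (@label d T).
Notation state := (@state d T).
Implicit Types (k : label) (x y z : V) (a b c : T) (p q r : nat * V) (o : bool).
Implicit Types (E : seq (nat * label * nat)) (s u w : set V) (sg : state).
Variables (S : @system d T) (b : T).
Hypothesis G : forall c, c < b -> good S c.
Hypothesis lim : forall a, a < b -> exists c, a < c /\ c < b.
Notation sound := (sound S b).

Lemma adj_symP x y : joined S x y <-> joined S y x.
Proof. by split=> -[]; [right|left|right|left]. Qed.

(* For a label that is not closed cofinally below [b], [a] is its last closed
   level, or [l0 k] if there is none. *)
Record base k a : Prop := Base {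
  b_b : a < b; b_l0 : l0 k <= a; b_max : forall c, lC k c -> c <= a;
  b_or : lC k a \/ (a = l0 k /\ forall c, ~ lC k c) }.

Definition farpts o k (Q : seq V) := forall z, z \in Q ->
  (o = true -> lW k z) /\ forall c, lC k c -> c <= z.1.

(** At a closed [a] the partner of [s] is the start; with no closed level there are no inherited
    pairs, and [rich_bits] or an arbitrary trace will do. Above [a] the label imposes nothing, so
    the bits at the points of [Q], which lie above all closed levels, are free. *)
Lemma base_extend k a c o s (Q : seq V) (f : V -> Prop) : legit S b k -> base k a ->
  a <= c -> c < b -> farpts o k Q ->
  (lC k a -> Tr S a s /\ (o = false -> alive S k (cut (l0 k) s))) ->
  exists u, [/\ Tr S c u, o = true -> alive S k (cut (l0 k) u),
    forall x y, step (low S) (k, o) x y -> (s x <-> u y)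
    & forall z, z \in Q -> z.1 < c -> (u z <-> f z)].
Proof.
move=> L [ab la amax aor] ac cb hQ hs.
have [u0 [Tu0 al0 h0 f0]] : exists u, [/\ Tr S a u, o = true -> alive S k (cut (l0 k) u),
    forall x y, step (low S) (k, o) x y -> (s x <-> u y)
    & forall z, z \in Q -> z.1 < a -> (u z <-> f z)].
  have [Ca|nCa] := pselect (lC k a).
    have [Ts als] := hs Ca.
    have [u [Tu [al pu]]] := part_ex G L Ca Ts als.
    exists u; split=> //; first by move=> eo; move: al; rewrite /alive_dir eo.
      by move=> x y h; apply: pu => //; have [] := low_lt_bound G L amax h.
    by move=> z /hQ[_ /(_ a Ca)]; rewrite leNgt => /negbTE ->.
  case: aor => [//|[ea none]].
  have nolow x y : ~ step (low S) (k, o) x y by case: (o) => -[c' Cc' _]; exact: none Cc'.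
  case: o hQ {hs} nolow => hQ nolow.
    have [_ R _] := legit_pt L (or_intror erefl); rewrite (res_id L) in R.
    have [|u al hu] := rich_bits R (q := [seq x <- Q | x.1 < l0 k]) f.
      by move=> x; rewrite mem_filter => /andP[xl /hQ[/(_ erefl)]].
    have Tu : Tr S a u by rewrite ea; case: al.
    have eu : cut (l0 k) u = u by rewrite -ea; apply: cut_id => x; exact: (Tr_sub G ab Tu).
    exists u; split=> //; [by rewrite eu | by move=> x y /nolow|].
    by move=> z qQ qa; apply: hu; rewrite mem_filter qQ -ea qa.
  have [u [Tu hu]] := Tr_bits0 HT G Q f ab.
  by exists u; split=> // x y /nolow.
have [u [Tu eu fu]] := Tr_bits G Q f ac cb Tu0.
have ua x : x.1 < a -> (u x <-> u0 x) by move=> xa; exact: cut_at eu xa.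
exists u; split=> //.
- by move=> /al0; rewrite -eu cut_cut.
- by move=> x y h; have [_ ya] := low_lt_bound G L amax h; rewrite (ua y ya); exact: h0.
- move=> z qQ qc; have [qa|aq] := ltP z.1 a; first by rewrite ua // f0.
  exact: fu.
Qed.

Lemma base_part k a c o s (Q : seq V) (f : V -> Prop) : legit S b k -> base k a ->
  a <= c -> c < b -> farpts o k Q -> Tr S c s ->
  (o = false -> alive S k (cut (l0 k) s)) ->
  exists u, [/\ Tr S c u, part S o k c s u
    & forall z, z \in Q -> z.1 < c -> (u z <-> f z)].
Proof.
move=> L B ac cb hQ Ts als; have [ab la amax aor] := B.
have [|u [Tu al hu fu]] := base_extend (s := cut a s) f L B ac cb hQ.
  by move=> _; split; [exact: (Tr_cut_le G ac cb Ts)|rewrite cut_cut].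
exists u; split=> //; split; first by rewrite /alive_dir; case: o als al {hQ hu} => [_|] h; auto.
move=> x y h xc; rewrite -(hu x y h); have [xa _] := low_lt_bound G L amax h.
by split=> [|[]].
Qed.

(** Provides the trace for a partner of the vertex [x]. Any inherited pair starts below [a] and
    below [x], so its adjacency to [x] can be read from the cut of [tr S x] at [a]. *)
Lemma base_vertex k a c o x (Q : seq V) (f : V -> Prop) : legit S b k -> base k a ->
  a <= c -> c < b -> farpts o k Q -> x.1 < b -> (o = false -> lW k x) ->
  (forall c', lC k c' -> c' <= x.1) ->
  exists u, [/\ Tr S c u, o = true -> alive S k (cut (l0 k) u),
    forall x' y', step (low S) (k, o) x' y' -> (joined S x x' <-> u y')
    & forall z, z \in Q -> z.1 < c -> (u z <-> f z)].
Proof.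
move=> L B ac cb hQ xb Wx hx; have [ab la amax aor] := B.
have [|u [Tu al hu fu]] := base_extend (s := cut a (tr S x)) f L B ac cb hQ.
  move=> Ca; split; first by apply: (Tr_cut_le G (hx a Ca) xb); exact: tr_Tr.
  move=> /Wx Wx'; rewrite cut_cut //; split.
    by apply: (Tr_cut_le G _ xb (tr_Tr S x)); exact: le_trans la (hx a Ca).
  by exists x => //; split=> //; exact: le_trans la (hx a Ca).
exists u; split=> // x' y' h; rewrite -(hu x' y' h).
have [x'a _] := low_lt_bound G L amax h.
have x'x : x'.1 < x.1.
  case: aor => [Ca|[_ none]]; first exact: lt_le_trans x'a (hx a Ca).
  by case: (o) h => -[c' /none].
by rewrite (adj_symP x x') adj_lt //; split=> [|[]].
Qed.

End Bases.

(** * Meeting single requirements *)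

Section Steps.
Context {d : Order.disp_t} {T : orderType d} (HT : omega1_like T).
Notation V := (T * nat)%type.
Notation label := (@label d T).
Notation state := (@state d T).
Implicit Types (k : label) (x y z : V) (a b c : T) (p q r : nat * V) (o : bool).
Implicit Types (E : seq (nat * label * nat)) (s u w : set V) (sg : state).
Variables (S : @system d T) (b : T).
Hypothesis G : forall c, c < b -> good S c.
Hypothesis lim : forall a, a < b -> exists c, a < c /\ c < b.
Notation sound := (sound S b).

Lemma step_pairs P k o x y : step (pairs P) (k, o) x y -> 
  (k, o, x, y) \in P \/ (k, ~~ o, y, x) \in P.
Proof. by case: o => -[]; [left|right|right|left]. Qed.

Definition pairpts (P : seq (label * bool * V * V)) := [seq e.1.2 | e <- P] ++ [seq e.2 | e <- P].

Lemma pairptsP P k o x y : step (pairs P) (k, o) x y -> x \in pairpts P /\ y \in pairpts P.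
Proof.
move=> h; suff : forall o x y, (k, o, x, y) \in P -> x \in pairpts P /\ y \in pairpts P.
  by move=> h1; case: (step_pairs h) => /h1 [].
move=> o' x' y' h'; rewrite !mem_cat; split; apply/orP; [left|right];
  by apply/mapP; exists (k, o', x', y').
Qed.

Lemma i_Pstep sg k o x y : sound sg -> step (pairs (sP sg)) (k, o) x y ->
  [/\ legit S b k, x.1 < sc sg /\ y.1 < sc sg, o = true -> lW k y, o = false -> lW k x
    & forall c, lC k c -> c <= x.1 /\ c <= y.1].
Proof.
by move=> I; case: o => /(i_P I)[h1 [h2 h3] h4 h5]; split=> // c /h5[].
Qed.

Lemma cofinal_nopair sg k o x y : sound sg -> cofinal b k ->
  step (pairs (sP sg)) (k, o) x y -> False.
Proof.
move=> I cof /(i_Pstep I)[_ [xc _] _ _ h].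
have [a' Ca' ha'] := cof x.1 (lt_trans xc (i_c I)).
by have [h' _] := h a' Ca'; rewrite leNgt ha' in h'.
Qed.

Lemma farpts_pairs sg k o : sound sg ->
  exists Q, farpts o k Q /\ forall x y, step (pairs (sP sg)) (k, o) x y -> y \in Q.
Proof.
move=> I; exists [seq y <- pairpts (sP sg) | `[< exists x, step (pairs (sP sg)) (k, o) x y >]].
split=> [y|x y h]; rewrite mem_filter.
  by case/andP => /asboolP[x /(i_Pstep I)[_ _ h1 _ h2]] _; split=> // c /h2 [].
by have [_ ->] := pairptsP h; rewrite andbT; apply/asboolP; exists x.
Qed.

Lemma i_inj_step sg k o x y x' y' : sound sg -> step (pairs (sP sg)) (k, o) x y ->
  step (pairs (sP sg)) (k, o) x' y' -> (x = x' <-> y = y').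
Proof.
move=> I; case: o => h h'; first exact: (i_inj I h h').
by apply: iff_sym; exact: (i_inj I h h').
Qed.

Lemma add_leaf sg i k o u : sound sg -> (i < sN sg)%N -> legit S b k -> l0 k <= sc sg ->
  sep (sc sg) (k :: labs (sE sg)) -> (forall j, ~ edge o i k j \in sE sg) ->
  (forall x y, step (low S) (k, o) x y -> (x.1 < sc sg) = (y.1 < sc sg)) ->
  Tr S (sc sg) u -> part S o k (sc sg) (sT sg i) u ->
  (cofinal b k \/ forall c, lC k c -> c <= sc sg) ->
  (forall x y, step (pairs (sP sg)) (k, o) x y -> (sT sg i x <-> u y)) ->
  let sg' := State (sN sg).+1 (edge o i k (sN sg) :: sE sg) (upd (sN sg) (sT sg) u) (sc sg) (sP sg) in
  sound sg' /\ le_st sg sg'.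
Proof.
move=> I iN L lk sp new hlt Tu pu clos hP sg'.
have [v Fm] := i_fam I; have F := fam_forest Fm.
have [v' Fm'] := fam_leaf G Fm iN L lk sp new hlt Tu pu.
have labsE : labs (edge o i k (sN sg) :: sE sg) = k :: labs (sE sg) by case: (o).
split; last first.
  split=> //=; first by move=> e eE; rewrite inE eE orbT.
  move=> j jN; rewrite updN // cut_id // => x.
  by apply: (Tr_sub G (i_c I)); exact: (fam_Tr Fm).
split=> //=.
- exact: (i_c I).
- by exists (upd (sN sg) v v').
- move=> k' k'E; have : k' \in labs (edge o i k (sN sg) :: sE sg) by exact: k'E.
  by rewrite labsE inE => /orP[/eqP -> //|]; exact: (i_clos I).
- exact: (i_P I).
- exact: (i_inj I).
- exact: (i_adj I).
- move=> i' k' j x y; rewrite inE => /orP[/eqP e|e] h; last first.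
    have [i'N jN] := forest_bound F e; rewrite !updN //; exact: (i_t I e h).
  case: o e h hP {new hlt pu Fm' sg' labsE} => -[-> -> ->] h hP; rewrite updE updN //.
    exact: hP.
  by apply: iff_sym; exact: hP.
Qed.

(** A cofinal label has no added pairs, so its partner comes from a closed level. For any other
    label the partner is built over the last closed level, with bits copied from node [i] along the
    added pairs. *)
Lemma handle_nbr sg i k o : sound sg -> (i < sN sg)%N -> legit S b k ->
  exists sg', [/\ sound sg', le_st sg sg', sP sg' = sP sg & l0 k <= sc sg' /\
    ((o = false -> alive S k (cut (l0 k) (sT sg' i))) ->
      exists j, edge o i k j \in sE sg')].
Proof.
move=> I iN L; have [v Fm] := i_fam I.
have [[j ej]|none] := pselect (exists j, edge o i k j \in sE sg).
  have kE : k \in labs (sE sg).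
    by apply/mapP; exists (edge o i k j) => //; case: (o).
  exists sg; split=> //; first by split=> // j' jN; apply: cut_id => x;
    apply: (Tr_sub G (i_c I)); exact: (fam_Tr Fm).
  by split; [have [] := fam_legit Fm kE|move=> _; exists j].
have new j : ~ edge o i k j \in sE sg by move=> h; apply: none; exists j.
have hL k' : k' \in k :: labs (sE sg) -> legit S b k'.
  by rewrite inE => /orP[/eqP -> //|/(fam_legit Fm)[]].
have mb : Order.max (sc sg) (l0 k) < b by rewrite gt_max (i_c I) (legit_l0 L).
have [c1 [c1b hc1 sp1]] := sep_raise hL mb.
have [sc1 lk1] : sc sg <= c1 /\ l0 k <= c1 by move: hc1; rewrite ge_max => /andP[].
suff [c2 [c12 c2b clos hlt hu]] : exists c2, [/\ c1 <= c2, c2 < b,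
    (cofinal b k \/ forall c, lC k c -> c <= c2),
    forall x y, step (low S) (k, o) x y -> (x.1 < c2) = (y.1 < c2)
    & forall s, Tr S c2 s -> (o = false -> alive S k (cut (l0 k) s)) ->
      forall Q f, farpts o k Q ->
      exists u, [/\ Tr S c2 u, part S o k c2 s u & 
        ~ cofinal b k -> forall z, z \in Q -> z.1 < c2 -> (u z <-> f z)]].
  have sc2 := le_trans sc1 c12.
  have [t' [I' L']] := raise HT G I sc2 c2b.
  have [v' Fm'] := i_fam I'.
  have [al|nal] := pselect (o = false -> alive S k (cut (l0 k) (t' i))); last first.
    eexists; split; [exact: I'|exact: L'|by []|].
    by split; [exact: le_trans lk1 c12|move=> al; case: nal].
  have [Q [hQ QP]] := farpts_pairs k o I.
  have Ti : Tr S c2 (t' i) by exact: (fam_Tr Fm' (i := i)).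
  (* The new trace must contain [z] exactly when [t' i] contains its mate; mates are unique by
     [i_inj_step]. *)
  pose f z := exists2 x, step (pairs (sP sg)) (k, o) x z & t' i x.
  have [u [Tu pu fu]] := hu _ Ti al Q f hQ.
  have [|I2 L2] := add_leaf I' iN L (le_trans lk1 c12) (sep_mono c12 sp1) new hlt Tu pu clos.
    move=> x y h /=; rewrite fu; first last.
    - by have [_ [_ yc] _ _ _] := i_Pstep I' h.
    - exact: QP h.
    - by move=> cof; exact: cofinal_nopair I cof h.
    split=> [tx|[x' h' tx']]; first by exists x.
    by have /(_ erefl) -> := (i_inj_step I h h').2.
  exists (State (sN sg).+1 (edge o i k (sN sg) :: sE sg) (upd (sN sg) t' u) c2 (sP sg)).
  split=> //; first exact: le_st_trans L' L2.
  split; first exact: le_trans lk1 c12.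
  by move=> _; exists (sN sg); rewrite mem_head.
have [cof|[a [ab la amax aor]]] := cofinal_or HT L.
  have [c2 C2 c12] := cof c1 c1b; exists c2; split=> //; [exact: ltW|exact: legit_lt L C2|by left|..].
    by move=> x y; exact: (step_low_lt G L C2).
  move=> s Ts al Q f _; have [u [Tu pu]] := part_ex G L C2 Ts al.
  by exists u; split.
have mb' : Order.max c1 a < b by rewrite gt_max c1b ab.
exists (Order.max c1 a); split=> //; first by rewrite le_max lexx.
- by right=> c /amax h; rewrite le_max h orbT.
- move=> x y /(low_lt_bound G L amax)[xa ya].
  by rewrite !lt_max xa ya !orbT.
move=> s Ts al Q f hQ.
have ac : a <= Order.max c1 a by rewrite le_max lexx orbT.
have [u [Tu pu fu]] := base_part HT G f L (Base ab la amax aor) ac mb' hQ Ts al.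
by exists u; split.
Qed.

(** For labels that are not cofinal, all inherited and added pairs lie below the current level and
    are decided. Hence the dense set needs to be met only along the subforest of cofinal labels. *)
Lemma handle_dec sg i k : sound sg -> (i < sN sg)%N ->
  exists sg', [/\ sound sg', le_st sg sg', sP sg' = sP sg & exists c, c <= sc sg' /\
    ((exists v, [/\ lW k v, v.1 = c & tr S v = cut c (sT sg' i)]) \/
      ~ (exists v, [/\ lW k v, v.1 < b & ext S c (cut c (sT sg' i)) v]))].
Proof.
move=> I iN; have [v Fm] := i_fam I; have F := fam_forest Fm.
pose D c s := exists c', c' <= c /\
    ((exists v, [/\ lW k v, v.1 = c' & tr S v = cut c' s]) \/
      ~ (exists v, [/\ lW k v, v.1 < b & ext S c' (cut c' s) v])).
have upD : upward S b D.
  move=> c c' s cc' c'b Ts [c1 [c1c h]]; exists c1; split; first exact: le_trans c1c cc'.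
  by rewrite cut_cut // in h.
have dD : dense S b D.
  move=> c s cb Ts.
  have es : cut c s = s by apply: cut_id => x; exact: (Tr_sub G cb Ts).
  have [[z [Wz zb [cz ez]]]|n] := pselect (exists z, [/\ lW k z, z.1 < b & ext S c s z]).
    exists z.1, (tr S z); split=> //; first exact: tr_Tr.
    exists z.1; split=> //; left; exists z; split=> //.
    by rewrite cut_id // => x; apply: (Tr_sub G zb (tr_Tr S z)).
  by exists c, s; split=> //; exists c; split=> //; right; rewrite es.
pose cl k := `[< cofinal b k >].
pose EA := [seq e <- sE sg | cl e.1.2].
have FA : forest (sN sg) EA.
  have := forest_filter_map (m := id) (p := cl) _ F.
  have -> : [seq (e.1.1, id e.1.2, e.2) | e <- sE sg & cl e.1.2] = EA.
    by rewrite -[RHS]map_id; apply: eq_map => -[[]].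
  by apply.
have FmA : fam S b (low S) (sN sg) EA (sT sg) (sc sg) v.
  by apply: fam_sub FA Fm => // e; rewrite mem_filter => /andP[].
have hA k' : k' \in labs EA -> forall a, a < b -> exists2 a', lC k' a' & a < a'.
  by case/mapP => e; rewrite mem_filter => /andP[/asboolP cof _] -> a /cof.
have [c' [t' [v' [cc' c'b Fm' tt' [c1 [c1c' Dc]]]]]] := dense_fam HT G hA FmA (i_c I) iN upD dD.
have Fm2 : fam S b (low S) (sN sg) (sE sg) t' c' v'.
  apply: (fam_ext Fm cc').
  - by move=> j jN; split; [exact: (fam_Tr Fm')|exact: tt'].
  - move=> i' k' j x y e h; have kE : k' \in labs (sE sg) by apply/mapP; exists (i', k', j).
    have [cof|bdd] := i_clos I kE.
      by apply: (fam_inv Fm' _ h); rewrite mem_filter e andbT; apply/asboolP.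
    have [L _] := fam_legit Fm kE; have [i'N jN] := forest_bound F e.
    have [xc yc] := low_lt_bound (o := true) G L bdd h.
    rewrite (fam_val Fm' i'N (lt_le_trans xc cc')) (fam_val Fm' jN (lt_le_trans yc cc')).
    rewrite (cut_at (tt' _ i'N) xc) (cut_at (tt' _ jN) yc).
    by rewrite -(fam_val Fm i'N xc) -(fam_val Fm jN yc); exact: (fam_inv Fm e h).
  - by move=> j x jN xc; exact: (fam_val Fm').
have [I' L'] := inv_ext I cc' c'b Fm2 tt'.
by eexists; split; [exact: I'|exact: L'|by []|exists c1].
Qed.

Lemma isolated_sub Ls Ls' n n' (X X' : set V) z : {subset Ls <= Ls'} -> (n <= n')%N ->
  (forall x, X x -> X' x) -> isolated (letR S b) Ls' n' X' z -> isolated (letR S b) Ls n X z.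
Proof.
move=> LL nn XX [h1 h2].
have onL l : on Ls l -> on Ls' l by apply: sub_all => e /LL.
split=> [l x ln lL /XX Xx|l ln lL]; first exact: h1 (leq_trans ln nn) (onL _ lL) Xx.
exact: h2 (leq_trans ln nn) (onL _ lL).
Qed.

Lemma handle_fresh sg (Y : set V) (f : nat -> Prop) Ls n : sound sg -> big b Y ->
  (forall e, e \in Ls -> e.1 <= b) ->
  exists z t' c', [/\ Y z, sc sg <= z.1 /\ z.1 < c',
    isolated (letR S b) Ls n (fun x => x.1 < sc sg) z,
    sound (State (sN sg) (sE sg) t' c' (sP sg)) /\
      le_st sg (State (sN sg) (sE sg) t' c' (sP sg))
    & forall j, (j < sN sg)%N -> (t' j z <-> f j)].
Proof.
move=> I bY topL; have [v Fm] := i_fam I.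
pose Ls2 := [seq (b, k) | k <- labs (sE sg)].
have [|z [Yz cz zb iz]] := fresh_vertex HT G (Ls := Ls ++ Ls2) (maxn n (2 * sN sg)) _ bY (i_c I).
  by move=> e; rewrite mem_cat => /orP[/topL //|/mapP[k _ ->]].
have iz2 : isolated (letR S b) Ls2 (2 * sN sg) (fun x => x.1 < sc sg) z.
  by apply: isolated_sub iz => //; [move=> e; rewrite mem_cat => ->; rewrite orbT|exact: leq_maxr].
have [v' [Fm' hf]] := free_values G f Fm (i_c I) cz iz2.
have [c' [zc' c'b]] := lim zb.
have [t' [I' L' tv]] := raise_v HT G [seq (j, z) | j <- iota 0 (sN sg)] I Fm' (ltW (le_lt_trans cz zc')) c'b.
exists z, t', c'; split=> //.
  by apply: isolated_sub iz => //; [move=> e; rewrite mem_cat => ->|exact: leq_maxl].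
move=> j jN; rewrite tv //; first exact: hf.
by apply/mapP; exists j => //; rewrite mem_iota.
Qed.

Lemma big_W k : legit S b k -> big b (lW k).
Proof.
move=> L; have [_ R _] := legit_pt L (or_intror erefl); rewrite (res_id L) in R.
have [|u al _] := rich_bits R (q := [::]) (fun=> True); first by [].
have [Tu _] := al.
have eu : cut (l0 k) u = u.
  by apply: cut_id => x; exact: (Tr_sub G (legit_l0 L) Tu).
have := rich_ext R (lexx _) (rich_l0 R) Tu; rewrite eu => /(_ al).
by apply: big_sub => y [].
Qed.

(** The bits of a fresh vertex of [lW k] are free at all nodes, so it can be put into the trace at
    [i] alone. *)
Lemma handle_sep sg i j k : sound sg -> (i < sN sg)%N -> (j < sN sg)%N -> i <> j ->
  legit S b k ->
  exists sg', [/\ sound sg', le_st sg sg', sP sg' = sP sg & exists y,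
    [/\ lW k y, y.1 < sc sg', sT sg' i y & ~ sT sg' j y]].
Proof.
move=> I iN jN ij L.
have [|z [t' [c' [Wz [_ zc'] _ [I' L'] tf]]]] :=
  handle_fresh (fun m => m = i) (Ls := [::]) 0 I (big_W L); first by [].
eexists; split; [exact: I'|exact: L'|by []|].
exists z; split=> //=; first exact/tf.
by move/tf => /(_ jN) /esym.
Qed.

(** The mate [z] must have the right neighbours among the points already mapped, which fixes its
    trace [u] at [c0], and the right bits at the nodes, which a fresh vertex with trace extending
    [u] can take. *)
Lemma handle_pair sg k o x Ls n : sound sg -> legit S b k -> ~ cofinal b k -> x.1 < b ->
  (o = false -> lW k x) -> (forall y, ~ step (Rp S (sP sg)) (k, o) x y) ->
  (forall e, e \in Ls -> e.1 <= b) ->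
  exists sg' z, [/\ sound sg', le_st sg sg', sP sg' = (k, o, x, z) :: sP sg
    & exists c, [/\ sc sg <= c, x.1 < c, c <= z.1
    & isolated (letR S b) Ls n (fun y => y.1 < c) z]].
Proof.
move=> I0 L ncof xb Wx nox topL.
have [//|[a [ab la amax aor]]] := cofinal_or HT L.
have [c0 [hc0 c0b]] : exists c0, Order.max (sc sg) (Order.max x.1 a) < c0 /\ c0 < b.
  by apply: lim; rewrite !gt_max (i_c I0) xb ab.
move: hc0; rewrite !gt_max => /andP[/ltW sc0 /andP[xc0 /ltW ac0]].
have [t0 [I L0]] := raise HT G I0 sc0 c0b.
(* If [x] were below a closed level, the inherited map would already give it a mate. *)
have hx c' : lC k c' -> c' <= x.1.
  move=> Cc'; rewrite leNgt; apply/negP => xc'.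
  case: o Wx nox => Wx nox.
    by have [y h] := low_dom G L Cc' xc'; apply: (nox y); left.
  by have [y h] := low_ran G L Cc' (Wx erefl) xc'; apply: (nox y); left.
have [Q [hQ QP]] := farpts_pairs k o I.
pose f y := exists2 x', step (pairs (sP sg)) (k, o) x' y & joined S x x'.
have [u [Tu al lu fu]] := base_vertex HT G f L (Base ab la amax aor) ac0 c0b hQ xb Wx hx.
have [_ R _] := legit_pt L (or_intror erefl).
rewrite (res_id L) in R.
pose Y y := (o = true -> lW k y) /\ ext S c0 u y.
have bY : big b Y.
  have lc0 := le_trans la ac0.
  rewrite /Y; case: (o) al => al.
    have := rich_ext R lc0 c0b Tu; rewrite /alive => /(_ (al erefl)).
    by apply: big_sub => y [Wy ey]; split.
  by apply: big_sub (rich_level R c0b Tu) => y ey; split.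
(* Across an edge from [i] to [j] in direction [o], membership of [z] at [j] must copy membership of
   [x] at [i]; a node without such an edge gets the default [False]. *)
pose fv j := exists2 i, edge o i k j \in sE sg & t0 i x.
have [z [t' [c' [[Wz [cz ez]] [_ zc'] iz [I' L'] tf]]]] :=
  handle_fresh fv n I bY topL.
rewrite /= in cz iz zc' tf L'.
have [v Fm] := i_fam I0; have F := fam_forest Fm.
have trz y : y.1 < c0 -> (joined S z y <-> u y).
  move=> yc; have yz := lt_le_trans yc cz.
  by rewrite adj_symP adj_lt // -ez; split=> [|[]].
have xc' := lt_trans (lt_le_trans xc0 cz) zc'.
have Pc0 k' x' y' : pairs (sP sg) k' x' y' -> x'.1 < c0 /\ y'.1 < c0.
  by move=> h; have [_ ? _ _] := i_P I h.
have newz k' x' y' : pairs (sP sg) k' x' y' -> z <> x' /\ z <> y'.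
  by move=> /Pc0[xc yc]; split=> e; [move: xc|move: yc]; rewrite -e ltNge cz.
have pairsE k' x' y' : pairs ((k, o, x, z) :: sP sg) k' x' y' <->
    pairs (sP sg) k' x' y' \/ (k' = k /\ x' = (if o then x else z) /\ y' = (if o then z else x)).
  rewrite /pairs !inE; split=> [[/orP[/eqP|h]|/orP[/eqP|h]]|[[h|h]|[-> [-> ->]]]].
  - by case: (o) => // -[-> -> ->]; right.
  - by left; left.
  - by case: (o) => // -[-> -> ->]; right.
  - by left; right.
  - by left; rewrite h orbT.
  - by right; rewrite h orbT.
  by case: (o); [left|right]; rewrite eqxx.
have zirr y : ~ joined S y y by move=> [] []; rewrite ltxx.
have nadj x' y' : step (Rp S (sP sg)) (k, o) x' y' -> (joined S x x' <-> joined S z y').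
  move=> h; have [h1|h1] : step (low S) (k, o) x' y' \/ step (pairs (sP sg)) (k, o) x' y'.
  - by case: (o) h => -[]; [left|right|left|right].
  - have [_ y'a] := low_lt_bound G L amax h1.
    by rewrite trz ?(lu _ _ h1) //; exact: lt_le_trans y'a ac0.
  - have [_ [_ yc] _ _ _] := i_Pstep I h1.
    rewrite trz // fu //; last exact: QP h1.
    split=> [h2|[x2 h2 h3]]; first by exists x'.
    by have -> := (i_inj_step I h1 h2).2 erefl.
have nadj' x' y' : Rp S (sP sg) k x' y' ->
    (joined S (if o then x else z) x' <-> joined S (if o then z else x) y').
  by move: nadj; case: (o) => h h1; [|apply: iff_sym]; exact: h h1.
have nx x' y' : pairs (sP sg) k x' y' -> x' <> (if o then x else z) /\ y' <> (if o then z else x).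
  move=> h; have [zx zy] := newz _ _ _ h; move: nox; case: (o) => nox; split; try by apply: nesym.
    by move=> e; subst x'; apply: (nox y'); right.
  by move=> e; subst y'; apply: (nox x'); right.
exists (State (sN sg) (sE sg) t' c' ((k, o, x, z) :: sP sg)), z; split=> //.
- split=> //=.
  + exact: (i_c I').
  + exact: (i_fam I').
  + exact: (i_clos I').
  + move=> k' x' y' /pairsE[|[-> [-> ->]]]; first exact: (i_P I').
    have hz c2 : lC k c2 -> c2 <= z.1.
      by move=> /amax h; apply: le_trans h _; exact: le_trans ac0 cz.
    by case: (o) Wx Wz => Wx Wz; split=> //; auto.
  + move=> k' x1 y1 x2 y2 /pairsE[h1|[-> [-> ->]]] /pairsE[h2|[e [-> ->]]] //.
    * exact: (i_inj I h1 h2).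
    * by subst k'; have [n1 n2] := nx _ _ h1; split.
    * by have [n1 n2] := nx _ _ h2; split=> h; [case: n1|case: n2].
  + have RpE k' x' y' : Rp S ((k, o, x, z) :: sP sg) k' x' y' ->
        Rp S (sP sg) k' x' y' \/ (k' = k /\ x' = (if o then x else z) /\ y' = (if o then z else x)).
      by move=> [h|/pairsE[h|h]]; [left; left|left; right|right].
    move=> k' x1 y1 x2 y2 /pairsE[h1|[-> [-> ->]]] /RpE[h2|[e [-> ->]]].
    * exact: (i_adj I h1 h2).
    * subst k'; rewrite (adj_symP _ x1) (adj_symP _ y1).
      by apply: nadj'; right.
    * exact: nadj'.
    * by split=> /zirr.
  + move=> i k' j x' y' e /pairsE[h|[ek [-> ->]]]; first exact: (i_t I' e h).
    subst k'; have [iN jN] := forest_bound F e.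
    have tx m : (m < sN sg)%N -> (t' m x <-> t0 m x).
      by move=> mN; have /= := le_T L' mN; move=> h; exact: cut_at h xc0.
    have det m m' j' : edge o m k j' \in sE sg -> edge o m' k j' \in sE sg -> m = m'.
      move=> e1 e2; have := forest_det F (a := (k, ~~ o)) (x := j') (y := m) (z := m').
      by apply; apply/step_edge; [move: e1|move: e2]; case: (o).
    move: tf det; rewrite /fv; case: (o) => tf det.
      rewrite tf // tx //; split=> [h|[i' e' h]]; first by exists i.
      by rewrite (det i i' j).
    rewrite tf // tx //; split=> [[j' e' h]|h]; last by exists j.
    by rewrite (det j j' i).
- have /= L2 := le_st_trans L0 L'.
  by split=> //; case: L2.
- by exists c0; split.
Qed.

End Steps.

(** * Limit levels *)

(** The list is read at the exponent of two in the index, and every exponent recurs with arbitrarily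
    large odd cofactors. *)
Lemma enumerable_often (X : Type) (A : X -> Prop) : enumerable A ->
  exists e : nat -> option X, forall x, A x -> forall n, exists2 m, (n <= m)%N & e m = Some x.
Proof.
move=> [e he]; exists (fun m => e (logn 2 m)) => x /he[m em] n.
exists (2 ^ m * (n.*2).+1)%N.
  apply: leq_trans (leq_pmull _ _); last by rewrite expn_gt0.
  by rewrite -addnn leqW // leq_addr.
rewrite lognM ?expn_gt0 // pfactorK // logn_coprime ?addn0 //.
by rewrite coprime2n /= odd_double.
Qed.

Section Limit.
Context {d : Order.disp_t} {T : orderType d} (HT : omega1_like T).
Notation V := (T * nat)%type.
Notation label := (@label d T).
Notation state := (@state d T).
Notation entry := (label * bool * V * V)%type.
Implicit Types (k : label) (x y z : V) (a b c : T) (p q r : nat * V) (o : bool).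
Implicit Types (E : seq (nat * label * nat)) (s u w : set V) (sg : state).
Variables (S : @system d T) (b : T).
Hypothesis G : forall c, c < b -> good S c.
Hypothesis lim : forall a, a < b -> exists c, a < c /\ c < b.
Hypothesis gE : forall c, enumerable (guess S c).
Hypothesis hb : exists c, c < b.
Notation sound := (sound S b).

(** [RFam] serves [st_fam], [RNbr] existence of partners, [RDec] [st_dec], [RSep] uniqueness of
    partners, [RPair] totality and surjectivity of the maps, and [RRaise] cofinality of the
    levels. *)
Inductive req :=
| RRaise of T
| RFam of nat & seq (nat * label * nat) & seq nat & T & seq (nat * V) & seq (nat * V)
| RNbr of nat & label & bool
| RDec of nat & label
| RSep of nat & nat & label
| RPair of bool & label & V.

(** A prediction is not a countable datum. The requirement lists only finitely many questions [Q]
    with the positive ones [Qt], and traces by their indices; some prediction with these answers is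
    looked for when its turn comes. *)
Definition bitfam N E (ts : seq nat) c (Q Qt : seq (nat * V)) P :=
  exists2 v, fam S b (Rp S P) N E (fun i => tr S (c, nth 0%N ts i)) c v &
    forall i x, (i, x) \in Q -> (v i x <-> (i, x) \in Qt).

Definition handled rq sg sg' : Prop := match rq with
| RRaise a => a < b -> a < sc sg'
| RFam N E ts c Q Qt => c < b -> bitfam N E ts c Q Qt (sP sg) -> exists M,
    [/\ c <= sc sg', (M + N <= sN sg')%N,
      forall i, (i < N)%N -> cut c (sT sg' (M + i)%N) = tr S (c, nth 0%N ts i),
      forall i k j, (i, k, j) \in E -> ((M + i)%N, k, (M + j)%N) \in sE sg'
    & forall i x, (i, x) \in Q -> (i < N)%N -> x.1 < b ->
        x.1 < sc sg' /\ (sT sg' (M + i)%N x <-> (i, x) \in Qt)]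
| RNbr i k o => legit S b k -> (i < sN sg)%N -> l0 k <= sc sg' /\
    ((o = false -> alive S k (cut (l0 k) (sT sg' i))) ->
      exists j, edge o i k j \in sE sg')
| RDec i k => (i < sN sg)%N -> exists c, c <= sc sg' /\
    ((exists v, [/\ lW k v, v.1 = c & tr S v = cut c (sT sg' i)]) \/
      ~ (exists v, [/\ lW k v, v.1 < b & ext S c (cut c (sT sg' i)) v]))
| RSep i j k => legit S b k -> (i < sN sg)%N -> (j < sN sg)%N -> i <> j -> exists y,
    [/\ lW k y, y.1 < sc sg', sT sg' i y & ~ sT sg' j y]
| RPair o k x => legit S b k -> ~ cofinal b k -> x.1 < b -> (o = false -> lW k x) ->
    exists y, step (Rp S (sP sg')) (k, o) x y
end.

Definition valid rq : Prop := match rq with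
| RRaise a => a < b
| RFam N E ts c Q Qt => [/\ forall e, e \in E -> guess S b e.1.2, c < b,
    forall q, q \in Q -> q.2.1 < b & forall q, q \in Qt -> q.2.1 < b]
| RNbr _ k _ => guess S b k
| RDec _ k => guess S b k
| RSep _ _ k => guess S b k
| RPair _ k x => guess S b k /\ x.1 < b
end.

Lemma enumerable_valid : enumerable valid.
Proof.
have eN : enumerable (fun _ : nat => True) := enumerable_nat.
have eB : enumerable (fun _ : bool => True) by apply: enumerable_countType.
have eT := ol_init HT b.
have eL := gE b.
have eV : enumerable (fun x : V => x.1 < b /\ True) by exact: (enumerable_prod eT eN).
have eq : enumerable (fun s : seq (nat * V) => forall q, q \in s -> True /\ (q.2.1 < b /\ True)).
  exact: enumerable_seq (enumerable_prod eN eV).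
have eE : enumerable (fun E => forall e, e \in E -> (True /\ guess S b e.1.2) /\ True).
  exact: enumerable_seq (enumerable_prod (enumerable_prod eN eL) eN).
have es : enumerable (fun s : seq nat => True) by apply: enumerable_countType.
have e1 := enumerable_image (fun a => RRaise a) eT.
have e2 := enumerable_image (fun h => RFam h.1.1.1.1.1 h.1.1.1.1.2 h.1.1.1.2 h.1.1.2 h.1.2 h.2)
  (enumerable_prod (enumerable_prod (enumerable_prod (enumerable_prod (enumerable_prod eN eE) es) eT) eq) eq).
have e3 := enumerable_image (fun h => RNbr h.1.1 h.1.2 h.2) (enumerable_prod (enumerable_prod eN eL) eB).
have e4 := enumerable_image (fun h => RDec h.1 h.2) (enumerable_prod eN eL).
have e5 := enumerable_image (fun h => RSep h.1.1 h.1.2 h.2) (enumerable_prod (enumerable_prod eN eN) eL).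
have e6 := enumerable_image (fun h => RPair h.1.1 h.1.2 h.2) (enumerable_prod (enumerable_prod eB eL) eV).
have eU := enumerable_union e1 (enumerable_union e2 (enumerable_union e3 (enumerable_union e4 (enumerable_union e5 e6)))).
apply: enumerable_sub eU => -[a|N E ts c Q Qt|i k o|i k|i j k|o k x] /=.
- by move=> ab; left; exists a.
- move=> [hE cb hQ hQt]; right; left; exists (N, E, ts, c, Q, Qt) => //=.
  split; last by move=> q /hQt.
  split; last by move=> q /hQ.
  by split=> //; split=> //; split=> // e /hE ?; split.
- by move=> gk; right; right; left; exists (i, k, o).
- by move=> gk; do 3 right; left; exists (i, k).
- by move=> gk; do 4 right; left; exists (i, j, k).
- by move=> [gk xb]; do 5 right; exists (o, k, x).
Qed.

Definition new_ok Ls n sg (e : option entry) := forall k o x z, e = Some (k, o, x, z) ->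
  legit S b k /\ exists c, [/\ sc sg <= c, x.1 < c, c <= z.1
    & isolated (letR S b) Ls n (fun y => y.1 < c) z].

Definition push (e : option entry) (P : seq entry) := if e is Some p then p :: P else P.

Lemma le_st_refl sg : sound sg -> le_st sg sg.
Proof.
move=> I; have [v Fm] := i_fam I; split=> // i iN; apply: cut_id => x.
by apply: (Tr_sub G (i_c I)); exact: (fam_Tr Fm).
Qed.

Lemma handle Ls n rq sg : sound sg -> (forall e, e \in Ls -> e.1 <= b) ->
  exists sg' e, [/\ sound sg', le_st sg sg', sP sg' = push e (sP sg), new_ok Ls n sg e
    & handled rq sg sg'].
Proof.
move=> I topL.
have wrap sg' : sound sg' -> le_st sg sg' -> sP sg' = sP sg -> handled rq sg sg' ->
  exists sg' e, [/\ sound sg', le_st sg sg', sP sg' = push e (sP sg), new_ok Ls n sg e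
    & handled rq sg sg'] by move=> I' L' eP h; exists sg', None; split.
have skip : (forall sg', handled rq sg sg') -> exists sg' e,
   [/\ sound sg', le_st sg sg', sP sg' = push e (sP sg), new_ok Ls n sg e & handled rq sg sg'].
  by move=> h; apply: (wrap sg) => //; exact: le_st_refl.
case: rq wrap skip => [a|N E ts c Q Qt|i k o|i k|i j k|o k x] wrap skip.
- have [ab|ba] := ltP a b; last by apply: skip => sg' /= h; rewrite ltNge ba in h.
  have mb : Order.max (sc sg) a < b by rewrite gt_max (i_c I).
  have [c [mc cb]] := lim mb; move: mc; rewrite gt_max => /andP[/ltW sc' ac].
  have [t' [I' L']] := raise HT G I sc' cb.
  exact: (wrap (State (sN sg) (sE sg) t' c (sP sg))).
- have [[cb [v Fm hv]]|n0] := pselect (c < b /\ bitfam N E ts c Q Qt (sP sg)); last first.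
    by apply: skip => sg' /= cb h; case: n0.
  have [sg' [M [I' L' eP [h1 h2 h3 h4 h5]]]] := handle_fam HT G lim Q I cb Fm.
  apply: (wrap sg') => //= _ _; exists M; split=> // i x xQ iN xb.
  by have [h6 h7] := h5 i x xQ iN xb; split=> //; rewrite h7; exact: hv.
- have [[L iN]|n0] := pselect (legit S b k /\ (i < sN sg)%N); last first.
    by apply: skip => sg' /= L h; case: n0.
  have [sg' [I' L' eP h]] := handle_nbr HT G o I iN L.
  by apply: (wrap sg') => //.
- have [iN|n0] := pselect (i < sN sg)%N; last by apply: skip => sg' /= /n0.
  have [sg' [I' L' eP h]] := handle_dec HT G k I iN.
  by apply: (wrap sg') => //.
- have [[L iN jN ij]|n0] := pselect [/\ legit S b k, (i < sN sg)%N, (j < sN sg)%N & i <> j];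
    last by apply: skip => sg' /= L iN jN ij; case: n0.
  have [sg' [I' L' eP h]] := handle_sep HT G lim I iN jN ij L.
  by apply: (wrap sg') => //.
have [[y hy]|nox] := pselect (exists y, step (Rp S (sP sg)) (k, o) x y).
  by apply: (wrap sg) => //; [exact: le_st_refl|exists y].
have [[L nc xb Wx]|n0] := pselect [/\ legit S b k, ~ cofinal b k, x.1 < b & (o = false -> lW k x)];
  last by apply: skip => sg' /= L nc xb Wx; case: n0.
have [|sg' [z [I' L' eP [c [h1 h2 h3 h4]]]]] := handle_pair HT G lim n I L nc xb Wx _ topL.
  by move=> y h; apply: nox; exists y.
exists sg', (Some (k, o, x, z)); split=> //.
- by move=> _ _ _ _ [<- _ <- <-]; split=> //; exists c; split.
- move=> /= _ _ _ _; exists z; rewrite eP.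
  by case: (o) {L' h4 h3 h2 Wx nox skip wrap eP} => /=; right; [left|right]; rewrite mem_head.
Qed.

End Limit.

(** * The generic run and its limit *)

Section Build.
Context {d : Order.disp_t} {T : orderType d} (HT : omega1_like T).
Notation V := (T * nat)%type.
Notation label := (@label d T).
Notation state := (@state d T).
Notation entry := (label * bool * V * V)%type.
Implicit Types (k : label) (x y z : V) (a b c : T) (p q : nat * V) (o : bool).
Implicit Types (E : seq (nat * label * nat)) (s u w : set V) (sg : state).
Variables (S : @system d T) (b : T).
Hypothesis G : forall c, c < b -> good S c.
Hypothesis lim : forall a, a < b -> exists c, a < c /\ c < b.
Hypothesis gE : forall c, enumerable (guess S c).
Hypothesis hb : exists c, c < b.
Notation sound := (sound S b).

(** Step [j] looks only at the letters listed before [j] and at walks of length at most [j]; any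
    given finite set of guessed letters and any length are covered from some step on, as [st_new]
    asks. *)
Definition first_letters (el : nat -> option (letter (T:=T))) (j : nat) :=
  [seq e <- pmap el (iota 0 j) | e.1 <= b].

Definition run (g : nat -> state) (es : nat -> option entry)
    (rq : nat -> option (req (T:=T))) (el : nat -> option (letter (T:=T))) :=
  [/\ forall j, sound (g j),
     forall j, le_st (g j) (g j.+1),
     forall j, sP (g j.+1) = push (es j) (sP (g j)),
     forall j, new_ok S b (first_letters el j) j (g j) (es j)
   & sP (g 0%N) = [::] /\ forall j r, rq j = Some r -> handled S b r (g j) (g j.+1)].

Lemma run_exists rq el : exists g es, run g es rq el.
Proof.
have [c0 c0b] := hb.
pose sg0 := State 0 [::] (fun=> set0 : set V) c0 ([::] : seq entry).
have I0 : sound sg0.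
  split=> //=; try by move=> *; case: H.
  - exists (fun _ _ => False); split=> //; exact: forest0.
  - by move=> k x y [].
  - by move=> k x y x' y' [].
  - by move=> k x y x' y' [].
have /choice[f hf] : forall js : nat * state, exists h : state * option entry,
  sound js.2 -> [/\ sound h.1, le_st js.2 h.1, sP h.1 = push h.2 (sP js.2),
     new_ok S b (first_letters el js.1) js.1 js.2 h.2
   & forall r, rq js.1 = Some r -> handled S b r js.2 h.1].
  move=> [j sg] /=; have [I|nI] := pselect (sound sg); last by exists (sg, None).
  have top e : e \in first_letters el j -> e.1 <= b by rewrite mem_filter => /andP[].
  case er : (rq j) => [r|]; last first.
    by exists (sg, None) => _; split=> //; exact: (le_st_refl G I).
  have [sg' [e [h1 h2 h3 h4 h5]]] := handle HT G lim j r I top.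
  by exists (sg', e) => _; split=> // _ [<-].
pose g := fix g j := if j is i.+1 then (f (i, g i)).1 else sg0.
have Ig j : sound (g j) by elim: j => [//|j IH] /=; have [] := hf (j, g j) IH.
exists g, (fun j => (f (j, g j)).2).
split=> //; try by move=> j; have [] := hf (j, g j) (Ig j).
by split=> // j; have [] := hf (j, g j) (Ig j).
Qed.

Section Run.
Variables (g : nat -> state) (es : nat -> option entry) (rq : nat -> option (req (T:=T)))
  (el : nat -> option (letter (T:=T))).
Hypothesis hrun : run g es rq el.
Hypothesis hrq : forall r, valid S b r -> forall n, exists2 m, (n <= m)%N & rq m = Some r.
Hypothesis hel : forall e, e.1 <= b /\ guess S e.1 e.2 -> exists m, el m = Some e.

Let Ig j : sound (g j). Proof. by case: hrun. Qed.

Let Lg j j' : (j <= j')%N -> le_st (g j) (g j').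
Proof.
move=> /subnKC <-; elim: (j' - j)%N => [|n IH]; first by rewrite addn0; exact: (le_st_refl G (Ig j)).
by rewrite addnS; apply: le_st_trans IH _; case: hrun.
Qed.

Let Pmono j j' : (j <= j')%N -> {subset sP (g j) <= sP (g j')}.
Proof.
move=> /subnKC <-; elim: (j' - j)%N => [|n IH]; first by rewrite addn0.
rewrite addnS => e /IH eP; have [_ _ -> _ _] := hrun.
by rewrite /push; case: es => // e'; rewrite inE eP orbT.
Qed.

Let Pes i e : es i = Some e -> forall j, (i < j)%N -> e \in sP (g j).
Proof.
move=> ei j ij; apply: (Pmono ij); have [_ _ -> _ _] := hrun.
by rewrite ei /= mem_head.
Qed.

Let esP j e : e \in sP (g j) -> exists2 i, (i < j)%N & es i = Some e.
Proof.
elim: j => [|j IH]; first by have [_ _ _ _ [-> _]] := hrun.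
have [_ _ -> _ _] := hrun.
case ej : (es j) => [e'|] /=; last by move=> /IH[i ij ei]; exists i => //; exact: leqW.
by rewrite inE => /orP[/eqP ->|/IH[i ij ei]]; [exists j|exists i => //; exact: leqW].
Qed.

Let hnd r : valid S b r -> forall n, exists2 j, (n <= j)%N & handled S b r (g j) (g j.+1).
Proof.
move=> vr n; have [j nj ej] := hrq vr n; exists j => //.
by have [_ _ _ _ [_ h]] := hrun; exact: h.
Qed.

Let pairs_mono j j' k x y : (j <= j')%N -> pairs (sP (g j)) k x y -> pairs (sP (g j')) k x y.
Proof. by move=> jj' [] /(Pmono jj'); [left|right]. Qed.

Let late a n : a < b -> exists2 j, (n <= j)%N & a < sc (g j).
Proof.
move=> ab; have [j nj h] := @hnd (RRaise a) ab n.
by exists j.+1; [exact: leqW|exact: h].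
Qed.

Let scm j j' : (j <= j')%N -> sc (g j) <= sc (g j').
Proof. by move=> /Lg[]. Qed.

Let Nm j j' i : (j <= j')%N -> (i < sN (g j))%N -> (i < sN (g j'))%N.
Proof. by move=> /Lg[h _ _ _] ij; exact: leq_trans ij h. Qed.

Let Em j j' e : (j <= j')%N -> e \in sE (g j) -> e \in sE (g j').
Proof. by move=> /Lg[_ h _ _]; exact: h. Qed.

Definition limtrace i : set V := fun x => exists j, (i < sN (g j))%N /\ sT (g j) i x.

Let node i := exists j, (i < sN (g j))%N.

Let TrT j i : (i < sN (g j))%N -> Tr S (sc (g j)) (sT (g j) i).
Proof. by have [v Fm] := i_fam (Ig j) => iN; exact: (fam_Tr Fm). Qed.

Let subT j i x : (i < sN (g j))%N -> sT (g j) i x -> x.1 < sc (g j).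
Proof. by move=> iN; apply: (Tr_sub G (i_c (Ig j))); exact: TrT. Qed.

Let lim_cut j i : (i < sN (g j))%N -> cut (sc (g j)) (limtrace i) = sT (g j) i.
Proof.
move=> iN; apply: set_eq => x; split=> [[[j' [iN' h]] xc]|h]; last first.
  by split; [exists j | exact: subT h].
have [jj'|j'j] := leqP j j'.
  by have := le_T (Lg jj') iN => <-.
by have e := le_T (Lg (ltnW j'j)) iN'; rewrite -e in h; case: h.
Qed.

Let lim_at j i x : (i < sN (g j))%N -> x.1 < sc (g j) -> (limtrace i x <-> sT (g j) i x).
Proof. by move=> iN xc; exact: cut_at (lim_cut iN) xc. Qed.

Definition limset s := exists2 i, node i & s = limtrace i.

Definition limiso k x y := low S k x y \/ exists j, pairs (sP (g j)) k x y.

Let limiso_Rp k x y : limiso k x y -> exists n, forall j, (n <= j)%N -> Rp S (sP (g j)) k x y.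
Proof.
by case=> [h|[n h]]; [exists 0%N => j _; left|exists n => j nj; right; exact: pairs_mono nj h].
Qed.

Let Rp_limiso k x y j : Rp S (sP (g j)) k x y -> limiso k x y.
Proof. by case=> h; [left|right; exists j]. Qed.

Let limiso_lt k x y : legit S b k -> limiso k x y -> [/\ x.1 < b, y.1 < b & lW k y].
Proof.
move=> L [/(low_wf G L)[]//|[j /(i_P (Ig j))[_ [h1 h2] h3 _]]].
by split=> //; [exact: lt_trans h1 (i_c (Ig j))|exact: lt_trans h2 (i_c (Ig j))].
Qed.

Let edge_val n i k j x y : (i, k, j) \in sE (g n) -> Rp S (sP (g n)) k x y ->
  x.1 < sc (g n) -> y.1 < sc (g n) -> (limtrace i x <-> limtrace j y).
Proof.
move=> e h xc yc; have [v Fm] := i_fam (Ig n).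
have [iN jN] := forest_bound (fam_forest Fm) e.
rewrite !(lim_at (j := n)) //; case: h => h; last exact: (i_t (Ig n) e h).
by rewrite -(fam_val Fm iN xc) -(fam_val Fm jN yc); exact: (fam_inv Fm e h).
Qed.

Let edge_sends n i k j : (i, k, j) \in sE (g n) -> sends S limiso k (limtrace i) (limtrace j).
Proof.
move=> e; have [v Fm] := i_fam (Ig n).
have [iN jN] := forest_bound (fam_forest Fm) e.
have kE : k \in labs (sE (g n)) by apply/mapP; exists (i, k, j).
have [L lk] := fam_legit Fm kE.
split; first by have := fam_alive Fm e; rewrite -(lim_cut jN) cut_cut.
move=> x y h; have [xb yb _] := limiso_lt L h; have [m hm] := limiso_Rp h.
have [j1 mj1 xc] := late (maxn n m) xb; have [j2 j12 yc] := late j1 yb.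
have nj2 := leq_trans (leq_trans (leq_maxl _ _) mj1) j12.
apply: (edge_val (Em nj2 e)) => //.
  exact: hm (leq_trans (leq_trans (leq_maxr _ _) mj1) j12).
exact: lt_le_trans xc (scm j12).
Qed.

Let legit_guess k : legit S b k -> guess S b k.
Proof. by move=> L; have [h _ _] := legit_pt L (or_intror erefl); rewrite (res_id L) in h. Qed.

Let nbr i k o : node i -> legit S b k -> (o = false -> alive S k (cut (l0 k) (limtrace i))) ->
  exists j n, edge o i k j \in sE (g n).
Proof.
move=> [n iN] L al; have [m nm h] := @hnd (RNbr i k o) (legit_guess L) n.
have iNm := Nm nm iN.
have [lk h'] := h L iNm; have [|j ej] := h'; last by exists j, m.+1.
by move=> /al; rewrite -(lim_cut (Nm (leqnSn m) iNm)) cut_cut.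
Qed.

Let node_edge o i k j n : edge o i k j \in sE (g n) -> node i /\ node j.
Proof.
have [v Fm] := i_fam (Ig n) => e.
by have [h1 h2] := edge_bound (fam_forest Fm) e; split; exists n.
Qed.

Let sep_lim i j k : node i -> node j -> i <> j -> legit S b k ->
  exists y, [/\ lW k y, y.1 < b, limtrace i y & ~ limtrace j y].
Proof.
move=> [n1 i1] [n2 j2] ij L; have [m nm h] := @hnd (RSep i j k) (legit_guess L) (maxn n1 n2).
have im := Nm (leq_trans (leq_maxl _ _) nm) i1; have jm := Nm (leq_trans (leq_maxr _ _) nm) j2.
have [y [Wy yc h1 h2]] := h L im jm ij.
exists y; split=> //; first exact: lt_trans yc (i_c (Ig _)).
  by rewrite (lim_at (Nm (leqnSn m) im)).
by rewrite (lim_at (Nm (leqnSn m) jm)).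
Qed.

Let total k o x : legit S b k -> x.1 < b -> (o = false -> lW k x) ->
  exists y, step limiso (k, o) x y.
Proof.
move=> L xb Wx; have [cof|ncof] := pselect (cofinal b k).
  have [c Cc xc] := cof x.1 xb; case: o Wx => Wx.
    by have [y h] := low_dom G L Cc xc; exists y; left.
  by have [y h] := low_ran G L Cc (Wx erefl) xc; exists y; left.
have [j _ h] := @hnd (RPair o k x) (conj (legit_guess L) xb) 0%N.
have [y hy] := h L ncof xb Wx; exists y.
by case: o hy {Wx h} => /Rp_limiso.
Qed.

(** A second partner would be separated from the neighbour of [i] by a vertex of [lW k]; the
    preimage of that vertex would be both in and out of the trace at [i]. Partners are thus exactly
    neighbours, and [st_free] becomes [forest_walk]. *)
Let edge_uniq i j k : node i -> node j -> legit S b k ->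
  sends S limiso k (limtrace i) (limtrace j) -> exists n, (i, k, j) \in sE (g n).
Proof.
move=> ni nj L st; have [//|j1 [n e]] := nbr (o := true) ni L.
have [_ nj1] := node_edge e.
have [->|/eqP jj1] := eqVneq j j1; first by exists n.
have [y [Wy yb h1 h2]] := sep_lim nj nj1 jj1 L.
have [x hx] := total (o := false) L yb (fun _ => Wy).
by case: h2; apply/((edge_sends e).2 x y hx)/(st.2 x y hx).
Qed.

Let node_inj i j k : node i -> node j -> legit S b k -> limtrace i = limtrace j -> i = j.
Proof.
move=> ni nj L e; apply: contrapT => ij.
by have [y [_ _ h1]] := sep_lim ni nj ij L; rewrite -e.
Qed.

Let walk_lift l i s : node i -> (forall e, e \in l -> legit S b e.1) ->
  walk (fun k s t => [/\ limset s, limset t & sends S limiso k s t]) l (limtrace i) s ->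
  exists j n, [/\ node j, s = limtrace j & walk (nodeR (sE (g n))) l i j].
Proof.
elim: l i => [|[k o] l IH] i ni hl /=; first by move=> <-; exists i, 0%N.
have L : legit S b k by exact: (hl (k, o) (mem_head _ _)).
move=> [t st ht]; have [j [nj ej [n e]]] : exists j, [/\ node j, t = limtrace j &
    exists n, edge o i k j \in sE (g n)].
  by case: o st {hl} => -[[i1 n1 e1] [i2 n2 e2] st];
    [exists i2; split=> //; apply: edge_uniq => //; rewrite -e2|
     exists i1; split=> //; apply: edge_uniq => //; rewrite -e1].
rewrite ej in ht; have [|j' [n' [nj' es' w]]] := IH j nj _ ht.
  by move=> e' e'l; apply: hl; rewrite inE e'l orbT.
exists j', (maxn n n'); split=> //; exists j.
  by apply/step_edge; exact: Em (leq_maxl _ _) e.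
by apply: walk_mono w => k1 i1 j1; exact: Em (leq_maxr _ _).
Qed.

Lemma limit_stage : stage S b limset limiso.
Proof.
have fam_field N E (t : nat -> set V) c (v : nat -> V -> Prop) (Q : seq (nat * V)) :
    c < b -> fam S b limiso N E t c v ->
    exists t' : nat -> set V, [/\ forall i, (i < N)%N -> limset (t' i) /\ cut c (t' i) = t i,
      forall i k j, (i, k, j) \in E -> sends S limiso k (t' i) (t' j)
      & forall i x, (i, x) \in Q -> (i < N)%N -> x.1 < b -> (t' i x <-> v i x)].
  move=> cb Fm.
  have /choice[nn hnn] : forall i, exists n : nat, (i < N)%N -> t i = tr S (c, n).
    move=> i; have [iN|?] := boolP (i < N)%N; last by exists 0%N.
    by have [n ->] := fam_Tr Fm iN; exists n.
  pose ts := mkseq nn N.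
  have hts i : (i < N)%N -> tr S (c, nth 0%N ts i) = t i by move=> iN; rewrite nth_mkseq // hnn.
  pose Q1 := [seq q <- Q | q.2.1 < b].
  pose Qt := [seq q <- Q1 | `[< v q.1 q.2 >]].
  have vr : valid S b (RFam N E ts c Q1 Qt).
    split=> //.
    - move=> e eE; apply: legit_guess; have eL : e.1.2 \in labs E by exact: map_f.
      by have [] := fam_legit Fm eL.
    - by move=> q; rewrite mem_filter => /andP[].
    - by move=> q; rewrite !mem_filter => /andP[_ /andP[]].
  have [j _ h] := hnd vr 0%N.
  have [|M [h1 h2 h3 h4 h5]] := h cb.
    exists v; last by move=> i x xQ; rewrite mem_filter xQ andbT; split=> [?|/asboolP//]; apply/asboolP.
    apply: (fam_ext Fm) => //.
    - move=> i iN; split; first by exists (nth 0%N ts i).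
      rewrite hts //; apply: cut_id => x; apply: (Tr_sub G cb); exact: (fam_Tr Fm).
    - by move=> i k j' x y e /Rp_limiso; exact: (fam_inv Fm e).
    - by move=> i x iN xc; rewrite hts //; exact: (fam_val Fm).
  have MN i : (i < N)%N -> (M + i < sN (g j.+1))%N.
    by move=> iN; apply: leq_trans h2; rewrite ltn_add2l.
  exists (fun i => limtrace (M + i)%N); split.
  - move=> i iN; split; first by exists (M + i)%N => //; exists j.+1; exact: MN.
    by rewrite -(hts i iN) -(h3 i iN) -(lim_cut (MN i iN)) cut_cut.
  - by move=> i k j' e; apply: (edge_sends (h4 _ _ _ e)).
  - move=> i x xQ iN xb.
    have xQ1 : (i, x) \in Q1 by rewrite mem_filter xb xQ.
    have [xc e] := h5 i x xQ1 iN xb.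
    rewrite (lim_at (MN i iN) xc) e mem_filter xQ1 andbT.
    by split=> [/asboolP//|?]; apply/asboolP.
have entry_lt j k o x z : (k, o, x, z) \in sP (g j) -> x.1 < sc (g j) /\ z.1 < sc (g j).
  move=> h; have h' : step (pairs (sP (g j))) (k, o) x z.
    by case: o h => h; [left|right].
  by have [_ ? _ _] := i_Pstep (Ig j) h'.
have es_ok j k o x z : es j = Some (k, o, x, z) -> exists c, [/\ sc (g j) <= c, x.1 < c, c <= z.1
    & isolated (letR S b) (first_letters el j) j (fun y => y.1 < c) z].
  by move=> ej; have [_ _ _ h _] := hrun; have [_ h'] := h j k o x z ej.
split.
- have [c cb] := hb; have [s0 Ts0] := st_ne (G cb).
  have [|t' [h _ _]] := fam_field 1%N [::] (fun=> s0) c (fun=> s0) [::] cb.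
    by split=> //; exact: forest_node (forest0 _).
  by have [? _] := h 0%N erefl; exists (t' 0%N).
- by move=> _ x [i _ ->] [j [iN /(subT iN) h]]; exact: lt_trans h (i_c (Ig j)).
- move=> _ c [i [n iN] ->] cb; have [j nj cj] := late n cb.
  rewrite -(cut_cut _ (ltW cj)) (lim_cut (Nm nj iN)).
  exact: (Tr_cut_le G (ltW cj) (i_c (Ig j)) (TrT (Nm nj iN))).
- by move=> k x y L /(limiso_lt L)[].
- by move=> k x L xb; apply: (total (o := true)).
- by move=> k y L Wy; apply: (total (o := false)) => //; exact: (legit_W L Wy).
- move=> k x y y' L /limiso_Rp[n h] /limiso_Rp[n' h'].
  have {}h := h _ (leq_maxl n n'); have {}h' := h' _ (leq_maxr n n').
  case: h h' => h [] h'.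
  + exact: (low_det G L h h').
  + have [_ _ _ hc] := i_P (Ig _) h'; have [_ _ _ [c [Cc xc _]]] := low_wf G L h.
    by have [+ _] := hc c Cc; rewrite leNgt xc.
  + have [_ _ _ hc] := i_P (Ig _) h; have [_ _ _ [c [Cc xc _]]] := low_wf G L h'.
    by have [+ _] := hc c Cc; rewrite leNgt xc.
  + exact/(i_inj (Ig _) h h').
- move=> k x x' y L /limiso_Rp[n h] /limiso_Rp[n' h'].
  have {}h := h _ (leq_maxl n n'); have {}h' := h' _ (leq_maxr n n').
  case: h h' => h [] h'.
  + exact: (low_inj G L h h').
  + have [_ _ _ hc] := i_P (Ig _) h'; have [_ _ _ [c [Cc _ yc]]] := low_wf G L h.
    by have [_ +] := hc c Cc; rewrite leNgt yc.
  + have [_ _ _ hc] := i_P (Ig _) h; have [_ _ _ [c [Cc _ yc]]] := low_wf G L h'.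
    by have [_ +] := hc c Cc; rewrite leNgt yc.
  + exact/(i_inj (Ig _) h h').
- by move=> k x y L h; left.
- move=> k x y x' y' L /limiso_Rp[n h] /limiso_Rp[n' h'].
  have {}h := h _ (leq_maxl n n'); have {}h' := h' _ (leq_maxr n n').
  case: (h) => h1; last exact: (i_adj (Ig _) h1 h').
  case: (h') => h1'; first exact: (low_adj G L h1 h1').
  by rewrite (adj_symP _ x) (adj_symP _ y); exact: (i_adj (Ig _) h1' h).
- move=> k _ L [i ni ->]; have [//|j [n e]] := nbr (o := true) ni L.
  have [_ nj] := node_edge e.
  by exists (limtrace j); [exists j|exact: edge_sends e].
- move=> k _ L [i ni ->] al; have [//|j [n e]] := nbr (o := false) ni L.
  have [_ nj] := node_edge e.
  by exists (limtrace j); [exists j|exact: edge_sends e].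
- move=> k s t t' L [j nj ->] [j' nj' ->] st st'.
  have [//|/eqP jj'] := eqVneq j j'; first by move=> ->.
  have [y [Wy yb h1 h2]] := sep_lim nj nj' jj' L.
  have [x hx] := total (o := false) L yb (fun _ => Wy).
  by case: h2; apply/(st'.2 x y hx)/(st.2 x y hx).
- move=> l _ [i ni ->] rl hl w.
  have [j [n [nj ej wn]]] := walk_lift ni hl w.
  case: l rl hl w wn => // e l rl hl w wn.
  have ij := node_inj ni nj (hl e (mem_head _ _)) ej.
  have [v Fm] := i_fam (Ig n).
  by have [_ /(_ ij)] := forest_walk (fam_forest Fm) rl wn.
- move=> k _ gk [i [n iN] ->] _.
  have [j nj h] := @hnd (RDec i k) gk n.
  have iNj := Nm nj iN; have iNj1 := Nm (leqnSn j) iNj.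
  have [c [cc h']] := h iNj; exists c; first exact: le_lt_trans cc (i_c (Ig _)).
  by rewrite -(lim_cut iNj1) cut_cut in h'.
- exact: fam_field.
- exists es; split.
  + move=> k x y L [h|[n [] /esP[i _ ei]]]; [by left|right|right].
      by exists i, true, x, y.
    by exists i, false, y, x.
  + move=> j k o u z ej; have [c [c1 c2 c3 _]] := es_ok j k o u z ej.
    split=> [e|i k' o' u' z' ij ei]; first by rewrite -e ltNge c3 in c2.
    have [h1 h2] := entry_lt _ _ _ _ _ (Pes ei ij).
    by split=> e; [move: h1|move: h2]; rewrite -e ltNge (le_trans c1 c3).
  + move=> Ls n c cb.
    have [n0 _ hn0] := late 0%N cb.
    (* Letters that are not guessed carry no edge, so only the guessed ones have to be listed. *)
    have [m hm] : exists m, forall e, e \in Ls -> e.1 <= b /\ guess S e.1 e.2 ->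
        exists2 i, (i < m)%N & el i = Some e.
      elim: Ls => [|e Ls [m IH]]; first by exists 0%N.
      have [he|nhe] := pselect (e.1 <= b /\ guess S e.1 e.2); last first.
        by exists m => e'; rewrite inE => /orP[/eqP ->|/IH].
      have [i ei] := hel he; exists (maxn m i.+1) => e'.
      rewrite inE => /orP[/eqP -> _|/IH h /h[i' i'm ei']]; first by exists i => //; rewrite leq_max leqnn orbT.
      by exists i' => //; rewrite leq_max i'm.
    (* [n0] brings the current level above [c], [m] lists the letters of [Ls], and [n] covers the
       length. *)
    exists (maxn n0 (maxn m n)) => j k o u z; rewrite !geq_max => /andP[n0j /andP[mj nj]] ej.
    have [c1 [c01 uc1 c1z [iso1 iso2]]] := es_ok j k o u z ej.
    have cc1 : c < c1 := lt_le_trans hn0 (le_trans (scm n0j) c01).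
    have onF l x y : on Ls l -> walk (letR S b) l x y -> on (first_letters el j) l.
      move=> lL w; apply/allP => -[e o'] el'; have eL := allP lL _ el'.
      have [x' [y' h]] := walk_mem w el'.
      have [x'' [y'' h']] : exists x'' y'', letR S b e x'' y''.
        by case: o' h {el' eL} => h; [exists x', y'|exists y', x'].
      have he : e.1 <= b /\ guess S e.1 e.2.
        case: h' => -[h1 [h2 _]]; last by rewrite h1; split=> //; exact: legit_guess.
        split; first exact: ltW.
        by have [h3 _ _] := legit_pt h2 (or_intror erefl); rewrite (res_id h2) in h3.
      have [i im ei] := hm e eL he.
      rewrite mem_filter he.1 mem_pmap; apply/mapP; exists i => //.
      by rewrite mem_iota (leq_trans im mj).
    split=> [l x ln lL Xx w|l ln lL rl w]; last first.
      by apply: iso2 => //; [exact: leq_trans ln nj|exact: onF w].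
    apply: (iso1 l x) => //; [exact: leq_trans ln nj|exact: onF w|].
    case: Xx => [xc|[->//|[i [k' [o' [u' [z' [ij ei e]]]]]]]]; first exact: lt_trans xc cc1.
    have [h1 h2] := entry_lt _ _ _ _ _ (Pes ei ij).
    by case: e => ->; [apply: lt_le_trans h1 _|apply: lt_le_trans h2 _].
Qed.

End Run.
Lemma limit_exists : exists Tb Phi, stage S b Tb Phi /\ enumerable Tb.
Proof.
have [rq hrq] := enumerable_often (enumerable_valid HT b gE).
have [el hel] : enumerable (fun e : letter (T:=T) => e.1 <= b /\ guess S e.1 e.2).
  apply: (@enumerable_sub _ _ (fun e => exists2 a, (a < b \/ a = b) & exists2 k, guess S a k & (a, k) = e)).
    move=> [a k] /= [ab gk]; exists a; last by exists k.
    by move: ab; rewrite le_eqVlt => /orP[/eqP|]; auto.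
  apply: enumerable_bind => [|a _].
    apply: enumerable_union; first exact: (ol_init HT).
    by exists (fun=> Some b) => _ ->; exists 0%N.
  exact: enumerable_image.
have [g [es hr]] := run_exists rq el.
exists (limset g), (limiso g); split; first exact: limit_stage hr hrq hel.
apply: (@enumerable_sub _ _ (fun s => exists2 i, True & limtrace g i = s)).
  by move=> s [i _ ->]; exists i.
exact: enumerable_image enumerable_nat.
Qed.

End Build.

(** * The system of all levels *)

Section Successor.
Context {d : Order.disp_t} {T : orderType d} (HT : omega1_like T).
Notation V := (T * nat)%type.
Notation label := (@label d T).
Implicit Types (k : label) (x y z : V) (a b c : T).
Implicit Types (s u w : set V).
Variables (S : @system d T) (b : T).
Hypothesis G : forall c, c < b -> good S c.

Lemma least_stage : (forall c, ~ c < b) ->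
  stage S b (fun s => s = set0) (fun _ _ _ => False).
Proof.
move=> nb; have nL k : ~ legit S b k by move=> /legit_l0 /nb.
split; try by move=> k *; exfalso; apply: (nL k).
- by exists set0.
- by move=> s x ->.
- by move=> s c _ /nb.
- by case=> // e l s _ _ /(_ e (mem_head _ _)) /nL.
- by move=> k s _ _ [c /nb].
- by move=> N E t c v Q /nb.
- by exists (fun=> None); split=> // Ls n c /nb.
Qed.

(** Finite subsets of the top level [a] keep the traces countable and still realize every finite
    pattern. *)
Definition succ_trace a (m : nat) (Q : seq nat) : set V :=
  fun x => tr S (a, m) x \/ (x.1 = a /\ x.2 \in Q).

Lemma succ_stage a : a < b -> (forall c, c < b -> c <= a) ->
  stage S b (fun s => exists m Q, s = succ_trace a m Q) (fun _ _ _ => False).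
Proof.
move=> ab amax.
have nL k : ~ legit S b k.
  by move=> L; have [c [ac /amax]] := legit_limit L ab; rewrite leNgt ac.
have Ta m : Tr S a (tr S (a, m)) by exists m.
have cuts m Q c : c <= a -> cut c (succ_trace a m Q) = cut c (tr S (a, m)).
  move=> ca; apply: set_eq => x; split=> -[h xc]; split=> //; last by left.
  by case: h => // -[xa _]; rewrite xa ltNge ca in xc.
split; try by move=> k *; exfalso; apply: (nL k).
- by exists (succ_trace a 0 [::]), 0%N, [::].
- move=> s x [m [Q ->]] [h|[-> //]].
  exact: lt_trans (Tr_sub G ab (Ta m) h) ab.
- move=> s c [m [Q ->]] /amax ca; rewrite cuts //.
  exact: (Tr_cut_le G ca ab (Ta m)).
- by case=> // e l s _ _ /(_ e (mem_head _ _)) /nL.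
- move=> k s _ [m [Q ->]] _; exists a => //; rewrite cuts //.
  have [|n] := pselect (exists v, [/\ lW k v, v.1 = a & tr S v = cut a (tr S (a, m))]); first by left.
  right=> -[v [Wv vb [av ev]]]; apply: n; exists v.
  have va : v.1 = a by apply/eqP; rewrite eq_le av amax.
  split=> //; rewrite -ev cut_id // => x.
  by rewrite -va; apply: (Tr_sub G vb (tr_Tr S v)).
- move=> N E t c v Q cb Fm.
  have E0 : E = [::].
    case: E Fm => // e E Fm; have [|L _] := fam_legit Fm (k := e.1.2); first exact: mem_head.
    by case: (nL _ L).
  have /choice[s' hs'] : forall i, exists s', (i < N)%N -> [/\ Tr S a s', cut c s' = t i
      & forall x, x \in map snd Q -> c <= x.1 -> x.1 < a -> (s' x <-> v i x)].
    move=> i; have [iN|] := boolP (i < N)%N; last by exists set0.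
    have [s' hs'] := Tr_bits G (map snd Q) (v i) (amax c cb) ab (fam_Tr Fm iN).
    by exists s'.
  have /choice[m hm] : forall i, exists m : nat, (i < N)%N -> s' i = tr S (a, m).
    move=> i; have [iN|] := boolP (i < N)%N; last by exists 0%N.
    by have [[m ->] _ _] := hs' i iN; exists m.
  pose Qi i := [seq q.2.2 | q <- Q & (q.2.1 == a) && `[< v i q.2 >]].
  exists (fun i => succ_trace a (m i) (Qi i)); split.
  + move=> i iN; split; first by exists (m i), (Qi i).
    by have [_ h _] := hs' i iN; rewrite cuts ?amax // -hm.
  + by move=> i k j; rewrite E0.
  + move=> i x xQ iN xb; have [h1 h2 h3] := hs' i iN.
    rewrite /succ_trace -hm //.
    have [xa|ax] := ltP x.1 a.
      have -> : (s' i x \/ x.1 = a /\ x.2 \in Qi i) <-> s' i x.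
        by split=> [[//|[e _]]|]; [rewrite e ltxx in xa|left].
      have [xc|cx] := ltP x.1 c; last by apply: h3 => //; apply/mapP; exists (i, x).
      by rewrite (fam_val Fm iN xc) -h2; split=> [|[]].
    have xa : x.1 = a by apply/eqP; rewrite eq_le ax amax.
    split=> [[h|[_ /mapP[[j y]]]]|vx].
    * by have := Tr_sub G ab h1 h; rewrite xa ltxx.
    * rewrite mem_filter /= => /andP[/andP[/eqP ya /asboolP vy] _] e.
      by have -> : x = y by rewrite [x]surjective_pairing [y]surjective_pairing xa ya e.
    * right; split=> //; apply/mapP; exists (i, x) => //.
      by rewrite mem_filter xQ andbT /= xa eqxx; apply/asboolP.
- exists (fun=> None); split=> // Ls n c _.
  by exists 0%N.
Qed.

Lemma stage_exists : (forall c, enumerable (guess S c)) ->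
  exists (D : (nat -> set V) * (label -> V -> V -> Prop)),
    stage S b (fun s => exists n, s = D.1 n) D.2.
Proof.
move=> gE; have [Tb [Phi [st [e he]]]] : exists Tb Phi, stage S b Tb Phi /\ enumerable Tb.
  have [hb|nb] := pselect (exists c, c < b); last first.
    exists (fun s => s = set0), (fun _ _ _ => False); split.
      by apply: least_stage => c cb; apply: nb; exists c.
    by exists (fun=> Some set0) => _ ->; exists 0%N.
  have [lim|nlim] := pselect (forall a, a < b -> exists c, a < c /\ c < b).
    exact: limit_exists.
  have [a [ab amax]] : exists a, a < b /\ forall c, c < b -> c <= a.
    apply: contrapT => n; apply: nlim => a ab; apply: contrapT => n'; apply: n; exists a; split=> // c cb.
    by rewrite leNgt; apply/negP => ac; apply: n'; exists c.
  exists (fun s => exists m Q, s = succ_trace a m Q), (fun _ _ _ => False); split; first exact: succ_stage.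
  apply: (@enumerable_sub _ _ (fun s => exists2 q : nat * seq nat, True & succ_trace a q.1 q.2 = s)).
    by move=> _ [m [Q ->]]; exists (m, Q).
  by apply: enumerable_image; exact: enumerable_countType.
have [s0 T0] := st_ne st.
pose f n := if e n is Some s then if pselect (Tb s) is left _ then s else s0 else s0.
exists (f, Phi) => /=; have <- // : Tb = (fun s => exists n, s = f n).
apply: set_eq => s; split=> [Ts|[n ->]].
  have [n en] := he s Ts; exists n; rewrite /f en.
  by case: pselect.
by rewrite /f; case: (e n) => // u; case: pselect.
Qed.

End Successor.

(** * Locality of stages and the recursion along the levels *)

Section Agree.
Context {d : Order.disp_t} {T : orderType d} (HT : omega1_like T).
Notation V := (T * nat)%type.
Notation label := (@label d T).
Notation system := (@system d T).
Implicit Types (k : label) (x y z : V) (a b c : T) (S : system).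
Implicit Types (s u w : set V).

(** A stage at [b] depends on the system only below [b], so it can be chosen in the partial system
    known during the recursion and moved to the final one. *)
Record agree b S S' : Prop := Agree {
  ag_tr : forall y, y.1 < b -> tr S y = tr S' y;
  ag_iso : forall c k, c < b -> iso S c k = iso S' c k;
  ag_guess : guess S = guess S' }.

Lemma agree_sym b S S' : agree b S S' -> agree b S' S.
Proof. by case=> h1 h2 h3; split=> // *; rewrite ?h1 ?h2. Qed.

Lemma agree_le b c S S' : c <= b -> agree b S S' -> agree c S S'.
Proof.
move=> cb [h1 h2 h3]; split=> // [y yc|a k ac]; first by rewrite h1 //; exact: lt_le_trans yc cb.
by rewrite h2 //; exact: lt_le_trans ac cb.
Qed.

Lemma limpt_agree b n (Y Y' : set V) c : (forall y, y.1 < b -> Y y -> Y' y) -> c <= b ->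
  limpt Y n c -> limpt Y' n c.
Proof.
move=> h; elim: n c => [|n IH] c cb /= hl a.
  move=> l ac; have [y [Yy ay yc yl]] := hl a l ac.
  by exists y; split=> //; apply: h => //; exact: lt_le_trans yc cb.
move=> ac; have [c' [ac' c'c hc']] := hl a ac.
by exists c'; split=> //; apply: IH => //; exact: le_trans (ltW c'c) cb.
Qed.

Lemma big_agree b c (Y Y' : set V) : (forall y, y.1 < b -> Y y -> Y' y) -> c <= b ->
  big c Y -> big c Y'.
Proof.
move=> h cb hb n a /(hb n)[c' [ac' c'c hc']]; exists c'; split=> //.
exact: (limpt_agree h (le_trans (ltW c'c) cb) hc').
Qed.

Section Two.
Variables (b : T) (S S' : system).
Hypothesis A : agree b S S'.

Lemma Tr_agree c s : c < b -> Tr S c s -> Tr S' c s.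
Proof. by move=> cb [n ->]; exists n; rewrite (ag_tr A). Qed.

Lemma ext_agree c s y : y.1 < b -> ext S c s y -> ext S' c s y.
Proof. by move=> yb [cy e]; split=> //; rewrite -(ag_tr A). Qed.

Lemma alive_agree k s : l0 k < b -> (forall y, lW k y -> y.1 < b) ->
  alive S k s -> alive S' k s.
Proof.
move=> lb Wb [Ts [y Wy ey]]; split; first exact: Tr_agree.
by exists y => //; apply: ext_agree ey; exact: Wb.
Qed.

End Two.

Lemma rich_agree b S S' c k : agree b S S' -> c <= b -> (forall y, lW k y -> y.1 < b) ->
  rich S c k -> rich S' c k.
Proof.
move=> A cb Wb [h1 h2 h3 h4]; have A' := agree_sym A; have lb := lt_le_trans h1 cb.
split=> //.
- move=> a s la ac Ts al; apply: (@big_agree b _ (fun y => lW k y /\ ext S a s y)) => //.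
    by move=> y yb [Wy ey]; split=> //; exact: (ext_agree A yb ey).
  apply: h2 => //; first exact: (Tr_agree A' (lt_le_trans ac cb) Ts).
  exact: (alive_agree A' lb Wb al).
- move=> q f hq; have [s al hs] := h3 q f hq; exists s => //.
  exact: (alive_agree A lb Wb al).
- move=> a s ac Ts; apply: (@big_agree b _ (ext S a s)) => //.
    by move=> y yb; exact: (ext_agree A yb).
  by apply: h4 => //; exact: (Tr_agree A' (lt_le_trans ac cb) Ts).
Qed.

Lemma legit_agree b S S' c k : agree b S S' -> c <= b -> legit S c k -> legit S' c k.
Proof.
move=> A cb L; case: (L) => h1 h2 h3 h4; split=> // a ha.
have ac : a <= c by case: ha => [/h2[_ /ltW]|->].
have ab := le_trans ac cb.
have lb : l0 k < b by apply: lt_le_trans (legit_l0 L) cb.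
have Wb y : lW k y -> y.1 < b by move=> /h1 yc; exact: lt_le_trans yc cb.
have Wb' y : lW (res a k) y -> y.1 < b by move=> [/Wb].
have [g r al] := h4 a ha; split; first by rewrite -(ag_guess A).
  exact: (rich_agree A ab Wb' r).
have A' := agree_sym A.
move=> s; split=> h.
  by apply: (alive_agree A lb Wb); apply/al; exact: (alive_agree A' (k := res a k) lb Wb').
by apply: (alive_agree A (k := res a k) lb Wb'); apply/al; exact: (alive_agree A' lb Wb).
Qed.

Lemma low_agree b S S' k x y : agree b S S' -> legit S b k -> low S k x y -> low S' k x y.
Proof. by move=> A L [c Cc h]; exists c => //; rewrite -(ag_iso A) //; exact: (legit_lt L Cc). Qed.

Lemma sends_agree b S S' (R : label -> V -> V -> Prop) k s t : agree b S S' -> legit S b k ->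
  sends S R k s t -> sends S' R k s t.
Proof.
move=> A L [al h]; split=> //.
exact: (alive_agree A (legit_l0 L) (legit_W L) al).
Qed.

Lemma letR_agree b S S' e x y : agree b S S' -> letR S b e x y -> letR S' b e x y.
Proof.
move=> A [[eb [L h]]|[eb [L h]]]; [left|right]; split=> //; split.
- exact: (legit_agree A (ltW eb) L).
- by rewrite -(ag_iso A).
- exact: (legit_agree A (lexx b) L).
- exact: (low_agree A L h).
Qed.

Lemma fam_agree b S S' R N E t c (v : nat -> V -> Prop) : agree b S S' -> c < b ->
  fam S b R N E t c v -> fam S' b R N E t c v.
Proof.
move=> A cb [h1 h2 h3 h4 h5 h6 h7]; split=> //.
- by move=> k /h2[L lk]; split=> //; exact: (legit_agree A (lexx b) L).
- by move=> i /h4; exact: (Tr_agree A).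
- move=> i k j e; have [|L _] := h2 k; first by apply/mapP; exists (i, k, j).
  exact: (alive_agree A (legit_l0 L) (legit_W L) (h5 _ _ _ e)).
Qed.

Lemma adj_agree b S S' x y : agree b S S' -> x.1 < b -> y.1 < b -> (joined S x y <-> joined S' x y).
Proof. by move=> A xb yb; rewrite /joined !(ag_tr A). Qed.

Lemma stage_agree b S S' Tb Phi : agree b S S' -> stage S b Tb Phi -> stage S' b Tb Phi.
Proof.
move=> A st; have A' := agree_sym A.
have LL k : legit S' b k -> legit S b k by exact: (legit_agree A' (lexx b)).
split.
- exact: st_ne st.
- exact: st_sub st.
- by move=> s c Ts cb; apply: (Tr_agree A cb); exact: st_cut st _ _ Ts cb.
- by move=> k x y /LL; exact: st_wf st k x y.
- by move=> k x /LL; exact: st_dom st k x.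
- by move=> k y /LL; exact: st_ran st k y.
- by move=> k x y y' /LL; exact: st_fun st k x y y'.
- by move=> k x y y' /LL; exact: st_inj st k x y y'.
- move=> k x y L h; apply: (st_low st (LL _ L)); exact: (low_agree A' L h).
- move=> k x y x' y' /LL L h h'.
  have [xb /(legit_W L) yb] := st_wf st L h; have [xb' /(legit_W L) yb'] := st_wf st L h'.
  by rewrite -!(adj_agree A) //; exact: st_adj st _ _ _ _ _ L h h'.
- move=> k s /LL L Ts; have [t Tt h] := st_fwd st L Ts.
  by exists t => //; exact: (sends_agree A L h).
- move=> k t L' Tt al; have L := LL _ L'.
  have [|s Ts h] := st_bwd st L Tt.
    exact: (alive_agree A' (legit_l0 L) (legit_W L) al).
  by exists s => //; exact: (sends_agree A L h).
- move=> k s t t' L Tt Tt' h h'; apply: (st_uniq st (LL _ L) Tt Tt' (s := s)).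
    exact: (sends_agree A' L h).
  exact: (sends_agree A' L h').
- move=> l s Ts rl hl w; apply: (st_free st Ts rl).
    by move=> e /hl /LL.
  have hl' : on [seq e.1 | e <- l] l by apply/allP => e el; exact: map_f.
  apply: (walk_on_mono _ hl' w) => k u u' /mapP[e /hl L ->] [h1 h2 h3]; split=> //.
  exact: (sends_agree A' L h3).
- move=> k s; rewrite -(ag_guess A) => g Ts hb.
  have [c cb h] := st_dec st g Ts hb; exists c => //; case: h => [[v [Wv vc e]]|n].
    by left; exists v; split=> //; rewrite -(ag_tr A) // vc.
  right=> -[v [Wv vb ev]]; apply: n; exists v; split=> //; exact: (ext_agree A' vb ev).
- move=> N E t c v Q cb Fm; have Fm' := fam_agree A' cb Fm.
  have [t' [h1 h2 h3]] := st_fam st Q cb Fm'; exists t'; split=> // i k j e.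
  have [|L _] := fam_legit Fm' (k := k); first by apply/mapP; exists (i, k, j).
  exact: (sends_agree A L (h2 _ _ _ e)).
- have [es [h1 h2 h3]] := st_new st; exists es; split=> //.
    move=> k x y /LL L /(h1 k x y L)[h|]; last by right.
    by left; exact: (low_agree A L h).
  move=> Ls n c cb; have [J hJ] := h3 Ls n c cb; exists J => j k o u z Jj ej.
  have [i1 i2] := hJ j k o u z Jj ej.
  have ww l x y : walk (letR S' b) l x y -> walk (letR S b) l x y.
    by apply: walk_mono => e x' y'; exact: letR_agree.
  split=> [l x ln lL Xx /ww|l ln lL rl /ww]; first exact: i1.
  exact: i2.
Qed.

Variable gs : T -> set label.
Hypothesis gE : forall c, enumerable (gs c).

Let data := ((nat -> set V) * (label -> V -> V -> Prop))%type.

Definition sysof b (rec : forall c, c < b -> data) : system :=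
  System (fun v => if pselect (v.1 < b) is left h then (rec v.1 h).1 v.2 else set0)
    (fun c k => if pselect (c < b) is left h then (rec c h).2 k else fun _ _ => False) gs.

(** The default is never reached: the induction in [system_exists] provides a stage at every
    level. *)
Definition pick_stage S b : data :=
  if pselect (exists D : data, stage S b (fun s => exists n, s = D.1 n) D.2) is left h
  then sval (cid h) else (fun=> set0, fun _ _ _ => False).

Lemma system_exists : exists S, guess S = gs /\ forall b, good S b.
Proof.
pose D := Fix (ol_wf HT) (fun _ => data) (fun b rec => pick_stage (sysof rec) b).
have DE b : D b = pick_stage (@sysof b (fun c _ => D c)) b.
  rewrite /D Fix_eq // => {}b f g fg; congr (pick_stage (sysof _) b).
  by apply: functional_extensionality_dep => c; apply: functional_extensionality_dep => h.
pose S := System (fun v => (D v.1).1 v.2) (fun c k => (D c).2 k) gs.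
exists S; split=> //; apply: (ol_ind HT) => b IH.
have A : agree b (@sysof b (fun c _ => D c)) S.
  split=> //= [y yb|c k cb]; by case: pselect.
apply: (stage_agree A); rewrite /= /Tr /= DE /pick_stage.
case: pselect => [h|n]; first exact: (svalP (cid h)).
exfalso; apply: n; apply: stage_exists => //.
move=> c cb; have AS := agree_le (ltW cb) (agree_sym A).
have := stage_agree AS (IH c cb); rewrite /good.
have -> : Tr S c = Tr (@sysof b (fun c _ => D c)) c.
  by apply: set_eq => s; rewrite /Tr /=; case: pselect.
by have -> : iso S c = iso (@sysof b (fun c _ => D c)) c by apply: functional_extensionality_dep => k /=; case: pselect.
Qed.

End Agree.

(** * Clubs and guesses *)

Local Open Scope classical_set_scope.
Local Open Scope card_scope.
Local Open Scope order_scope.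

Lemma enumerable_countable (X : Type) (A : set X) : enumerable A <-> countable A.
Proof.
split=> [[e he]|/countable_injP[f finj]].
  apply/countable_injP.
  have /choice[n hn] : forall x, exists n : nat, A x -> e n = Some x.
    by move=> x; have [/he[n en]|nA] := pselect (A x); [exists n|exists 0%N].
  exists n => x y /set_mem Ax /set_mem Ay exy.
  by apply: Some_inj; rewrite -(hn x Ax) -(hn y Ay) exy.
exists (fun n => if pselect (exists x, A x /\ f x = n) is left h then Some (sval (cid h)) else None).
move=> x Ax; exists (f x); case: pselect => [h|[]]; last by exists x.
have [Ay fy] := svalP (cid h); congr Some; apply: finj => //; exact/mem_set.
Qed.

Section Omega1.
Context {d : Order.disp_t} {T : orderType d}.
Implicit Types (a b c : T).

Lemma omega1_like_of : is_omega1 T -> omega1_like T.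
Proof.
case=> wo unc cnt.
have least (P : T -> Prop) : (exists a, P a) -> exists m, P m /\ forall a, P a -> m <= a.
  move=> [a Pa]; have [|m [[mP hm] _]] := wo [pred x | `[< P x >]].
    by exists a; apply/asboolP.
  exists m; split; first exact/asboolP.
  by move=> x Px; apply: hm; apply/asboolP.
have ini b : enumerable (fun a => a < b) by apply/enumerable_countable; exact: cnt.
split; [|exact: ini|].
- move=> a; apply: contrapT => nA.
  have [|m [nm hm]] := least (fun a => ~ Acc (fun a b => a < b) a); first by exists a.
  apply: nm; split=> y ym; apply: contrapT => ny.
  by have := hm y ny; rewrite leNgt ym.
- move=> e; apply: contrapT => nb; apply: unc; apply/enumerable_countable.
  apply: (@enumerable_sub _ _ (fun a => exists2 n, True & (a < e n \/ a = e n))).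
    move=> a _; apply: contrapT => n; apply: nb; exists a => m.
    rewrite ltNge; apply/negP; rewrite le_eqVlt => /orP[/eqP h|h]; apply: n; exists m => //.
      by right.
    by left.
  apply: enumerable_bind enumerable_nat _ => n _; apply: enumerable_union; first exact: ini.
  by exists (fun=> Some (e n)) => _ ->; exists 0%N.
Qed.

Hypothesis HT : omega1_like T.
Hypothesis unc : ~ enumerable (fun _ : T => True).

Lemma above a : exists b, a < b.
Proof. by have [b h] := ol_bounded HT (fun=> a); exists b; exact: h 0%N. Qed.

Lemma bound_enum (I : Type) (P : I -> Prop) (R : I -> T -> Prop) x : enumerable P ->
  (forall i, P i -> exists z, R i z) ->
  exists y, x < y /\ forall i, P i -> exists2 z, z < y & R i z.
Proof.
move=> [e he] h.
have /choice[f hf] : forall n, exists z, x <= z /\ forall i, e n = Some i -> P i ->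
    exists2 z', z' <= z & R i z'.
  move=> n; have [[i [ei Pi]]|no] := pselect (exists i, e n = Some i /\ P i); last first.
    by exists x; split=> // i ei Pi; case: no; exists i.
  have [z Rz] := h i Pi; exists (Order.max x z); split; first by rewrite le_max lexx.
  by move=> j; rewrite ei => -[<-] _; exists z => //; rewrite le_max lexx orbT.
have [y hy] := ol_bounded HT f; exists y; split.
  by have [h1 _] := hf 0%N; exact: le_lt_trans h1 (hy 0%N).
move=> i Pi; have [n en] := he i Pi; have [_ h2] := hf n.
by have [z zf Rz] := h2 i en Pi; exists z => //; exact: le_lt_trans zf (hy n).
Qed.

(** [c] is the least strict upper bound of the iterates from [a] of a choice function for [R]. *)
Lemma sup_seq (R : T -> T -> Prop) a : (forall x, exists y, x < y /\ R x y) ->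
  exists c, a < c /\ forall x, x < c -> exists y z, [/\ x <= y, y < z, z < c & R y z].
Proof.
move=> /choice[F hF]; pose e n := iter n F a.
have [c [hc cmin]] : exists c, (forall n, e n < c) /\ forall c', (forall n, e n < c') -> c <= c'.
  by apply: (ol_min HT); have [c hc] := ol_bounded HT e; exists c.
exists c; split; first exact: hc 0%N.
move=> x xc; have [n xn] : exists n, x <= e n.
  apply: contrapT => no; have : c <= x; last by rewrite leNgt xc.
  by apply: cmin => n; rewrite ltNge; apply/negP => xn; apply: no; exists n.
have [h1 h2] := hF (e n); exists (e n), (e n.+1); split=> //; exact: hc n.+1.
Qed.

Lemma club_inter (C C' : set T) : club C -> club C' -> club (fun a => C a /\ C' a).
Proof.
move=> [cl unb] [cl' unb']; split.
  move=> nu [h0 h]; split; [apply: cl|apply: cl']; split=> // a /h[b [Cb C'b] hb]; by exists b.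
move=> a; have [|c [ac hc]] := @sup_seq
    (fun x y => (exists2 b, C b & x < b < y) /\ (exists2 b, C' b & x < b < y)) a.
  move=> x; have [b Cb xb] := unb x; have [b' C'b bb'] := unb' b.
  have [y by'] := above b'; exists y; split; first exact: lt_trans xb (lt_trans bb' by').
  split; first by exists b => //; rewrite xb (lt_trans bb' by').
  by exists b' => //; rewrite by' (lt_trans xb bb').
have lp (P : set T) : (forall x y, (exists2 b, C b & x < b < y) /\ (exists2 b, C' b & x < b < y) ->
    exists2 b, P b & x < b < y) -> limit_point P c.
  move=> hP; split; first by exists a.
  move=> x /hc[y [z [xy yz zc /hP[b Pb /andP[yb bz]]]]].
  by exists b => //; rewrite (le_lt_trans xy yb) (lt_trans bz zc).
by exists c => //; split; [apply: cl|apply: cl']; apply: lp => x y [].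
Qed.

Lemma closure_club (R : T -> T -> Prop) : (forall x, exists y, R x y) ->
  (forall x x' y y', x' <= x -> y <= y' -> R x y -> R x' y') ->
  club (fun c => (exists a, a < c) /\ forall x, x < c -> exists2 y, y < c & R x y).
Proof.
move=> hR mR; split.
  move=> nu [h0 h]; split=> // x xn.
  have [b [_ hb] /andP[xb bn]] := h x xn.
  by have [y yb Rxy] := hb x xb; exists y => //; exact: lt_trans yb bn.
move=> a; have [|c [ac hc]] := @sup_seq R a.
  move=> x; have [y Rxy] := hR x; have [z xz] := above x.
  exists (Order.max y z); split; first by rewrite lt_max xz orbT.
  by apply: mR Rxy => //; rewrite le_max lexx.
exists c => //; split; first by exists a.
move=> x /hc[y [z [xy yz zc Ryz]]]; exists z => //; exact: mR Ryz.
Qed.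

Lemma enumerable_le c : enumerable (fun a => a <= c).
Proof.
have [b cb] := above c; apply: enumerable_sub (ol_init HT b) => a ac.
exact: le_lt_trans ac cb.
Qed.

(** Disjoint blocks of order type omega: the block of [a] starts at [st a], chosen above all points
    of the earlier blocks. *)
Lemma lex_injection : exists h : T * nat -> T, injective h.
Proof.
have /choice[sc hsc] : forall a, exists b, a < b by exact: above.
pose F a (rec : forall a', a' < a -> T) : T :=
  if pselect (exists y, forall a' (h : a' < a) n, iter n sc (rec a' h) < y) is left h
  then sval (cid h) else a.
pose st := Fix (ol_wf HT) (fun _ => T) F.
have stE a : st a = F a (fun a' _ => st a').
  rewrite /st Fix_eq // => {}a f g fg; congr F.
  by apply: functional_extensionality_dep => c; apply: functional_extensionality_dep.
have stP a a' n : a' < a -> iter n sc (st a') < st a.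
  move=> a'a; rewrite (stE a) /F; case: pselect => [h|[]]; first exact: (svalP (cid h) a' a'a n).
  have en : enumerable (fun p : T * nat => p.1 < a /\ True) := enumerable_prod (ol_init HT a) enumerable_nat.
  have [|y [_ hy]] := @bound_enum _ _ (fun p z => z = iter p.2 sc (st p.1)) a en.
    by move=> p _; exists (iter p.2 sc (st p.1)).
  by exists y => c ca m; have [|z zy <-] := hy (c, m).
exists (fun p => iter p.2 sc (st p.1)) => -[a n] [a' n'] /=.
have mono c m m' : (m < m')%N -> iter m sc (st c) < iter m' sc (st c).
  elim: m' => // m' IH; rewrite ltnS leq_eqVlt => /orP[/eqP ->|/IH h]; first exact: hsc.
  exact: lt_trans h (hsc _).
have base c m : st c <= iter m sc (st c).
  by case: m => // m; apply: ltW; exact: (mono c 0%N m.+1).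
move=> e; have [aa'|a'a|ea] := ltgtP a a'.
- by have := lt_le_trans (stP _ _ n aa') (base a' n'); rewrite e ltxx.
- by have := lt_le_trans (stP _ _ n' a'a) (base a n); rewrite e ltxx.
- subst a'; have [nn'|n'n|->//] := ltngtP n n'.
    by have := mono a _ _ nn'; rewrite e ltxx.
  by have := mono a _ _ n'n; rewrite e ltxx.
Qed.

Lemma product_bijection : exists f : T -> T * nat, bijective f.
Proof.
have [h hinj] := lex_injection.
have [a0 _] : exists a : T, True.
  apply: contrapT => n; apply: unc; exists (fun=> None) => x _; case: n; by exists x.
have : [set: T] #= [set: T * nat].
  have inj_le (X Y : Type) (f : X -> Y) : injective f -> [set: X] #<= [set: Y].
    move=> finj; have e : f @` [set: X] #= [set: X] by apply: inj_card_eq; move=> x y _ _; exact: finj.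
    by rewrite -(card_le_eql e); apply: subset_card_le.
  apply: Cantor_Bernstein; first by apply: (inj_le _ _ (fun a : T => (a, 0%N))) => x y [].
  exact: inj_le hinj.
move=> /card_bijP[f [g fK gK]].
pose inT (X : Type) (x : X) : set_type [set: X] := SigSub (mem_set (I : [set: X] x)).
have inTK (X : Type) (z : set_type [set: X]) : inT X (val z) = z by exact: val_inj.
exists (fun a => val (f (inT _ a))), (fun y => val (g (inT _ y))) => x.
  by rewrite inTK fK.
by rewrite inTK gK.
Qed.

Variable SS : T -> set (set T).
Hypothesis SSc : forall a, countable (SS a).
Hypothesis SSP : forall X : set T, exists C : set T,
  club C /\ forall nu, C nu -> SS nu (X `&` below nu) /\ SS nu (C `&` below nu).

(** The final club is thinner than the club [C'] of the guessing principle, so its initial segments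
    must be computable from guessed sets. For this [C0] is coded into [X] along with [W], while [K],
    the closure points of the coding [h], is the same for all guesses. *)
Lemma diamond_labels : exists gs : T -> set (@label d T),
  (forall c, enumerable (gs c)) /\ forall (W : set (T * nat)) (C0 : set T), club C0 ->
  exists C : set T, [/\ club C, (forall c, C c -> C0 c) & forall l c, l < c -> C c ->
    gs c (res c (Label W (fun a => C a /\ l < a) l))].
Proof.
have [h hinj] := lex_injection.
have [K [cK hK]] : exists K : set T, club K /\ forall c v, K c -> v.1 < c -> h v < c.
  exists (fun c => (exists a, a < c) /\ forall x, x < c -> exists2 y, y < c &
    forall n, h (x, n) < y); split; last first.
    by move=> c [a n] [_ hc] /= /hc[y yc hy]; exact: lt_trans (hy n) yc.
  have [||h1 h2] := @closure_club (fun x y => forall x', x' <= x -> forall n, h (x', n) < y).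
  - move=> x.
    have en := enumerable_prod (enumerable_le x) enumerable_nat.
    have [|y [_ hy]] := @bound_enum _ _ (fun p z => z = h p) x en.
      by move=> p _; exists (h p).
    by exists y => x' xx' n; have [|z zy <-] := hy (x', n).
  - move=> x x' y y' xx yy hh x1 x1x n; apply: lt_le_trans yy; apply: hh.
    exact: le_trans x1x xx.
  split.
    move=> nu [h0 hl]; split=> // x xn; have [b [_ hb] /andP[xb bn]] := hl x xn.
    by have [y yb hy] := hb x xb; exists y => //; exact: lt_trans yb bn.
  move=> a; have [c [h0 hc] ac] := h2 a; exists c => //; split=> // x /hc[y yc hy].
  by exists y => // n; exact: hy.
(* The point [h (a, 0)] codes whether [a] is in [C0], and [h (a, n.+1)] whether [(a, n)] is in
   [W]. *)
pose dec nu (A A' : set T) l : @label d T := Label (fun v => A (h (v.1, v.2.+1)) /\ v.1 < nu)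
  (fun a => ([/\ A' a, A (h (a, 0%N)) & K a] /\ l < a) /\ a < nu) l.
exists (fun nu k => exists2 q : set T * set T * T, (SS nu q.1.1 /\ SS nu q.1.2) /\ q.2 < nu &
  dec nu q.1.1 q.1.2 q.2 = k); split.
  move=> c; apply: enumerable_image (enumerable_prod (enumerable_prod _ _) (ol_init HT c));
  exact/enumerable_countable.
move=> W C0 cC0.
pose W' (v : T * nat) := if v.2 is n.+1 then W (v.1, n) else C0 v.1.
pose X : set T := fun t => exists2 v, W' v & h v = t.
have Xh v : X (h v) <-> W' v by split=> [[v' hv' /hinj <-]|hv]; last by exists v.
have [C' [cC' hC']] := SSP X.
exists (fun c => (C' c /\ C0 c) /\ K c); split.
- exact: club_inter (club_inter cC' cC0) cK.
- by move=> c [[]].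
move=> l c lc [[C'c C0c] Kc]; have [h1 h2] := hC' c C'c.
exists (X `&` below c, C' `&` below c, l) => //=.
rewrite /dec /res; congr Label; apply: set_eq; [case=> a n|move=> a] => /=.
  split=> [[[/Xh Wa _] ac]|[Wa /= ac]]; split=> //.
  by split; [apply/Xh|exact: hK].
split=> [[[[[C'a _] [/Xh C0a _] Ka] la] ac]|[[[[C'a C0a] Ka] la] ac]]; first by split.
split=> //; split=> //; split=> //; split; first by apply/Xh.
exact: hK.
Qed.

End Omega1.

(** * The graph *)

Section Core.
Context {d : Order.disp_t} {T : orderType d} (HT : omega1_like T).
Hypothesis unc : ~ enumerable (fun _ : T => True).
Notation V := (T * nat)%type.
Notation label := (@label d T).
Implicit Types (k : label) (x y z v : V) (a b c l : T) (s u W Y : set V).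
Variable S : @system d T.
Hypothesis G : forall b, good S b.
Hypothesis gP : forall W (C0 : set T), club C0 -> exists C : set T,
  [/\ club C, (forall c, C c -> C0 c) & forall l c, l < c -> C c ->
    guess S c (res c (Label W (fun a => C a /\ l < a) l))].

Let Gb b : forall c, c < b -> good S c. Proof. by move=> c _. Qed.

Let subTr c s x : Tr S c s -> s x -> x.1 < c.
Proof. by move=> Ts; exact: (st_sub (G c) Ts). Qed.

Lemma cut_tr y : cut y.1 (tr S y) = tr S y.
Proof. by apply: cut_id => x; apply: subTr; exact: tr_Tr. Qed.

Lemma ext_cut a c s y : a <= c -> ext S c s y -> ext S a (cut a s) y.
Proof. by move=> ac [cy <-]; split; [exact: le_trans cy|rewrite cut_cut]. Qed.

Lemma vertex_ext a s c (Q : seq V) (f : V -> Prop) : Tr S a s -> a <= c ->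
  exists v, [/\ v.1 = c, ext S a s v &
    forall x, x \in Q -> a <= x.1 -> x.1 < c -> (tr S v x <-> f x)].
Proof.
move=> Ts ac; have [b cb] := above HT c.
have [u [[n ->] eu hu]] := Tr_bits (@Gb b) Q f ac cb Ts.
by exists (c, n); split.
Qed.

(** The closure points at which a trace of lower level that extends into [Y] at all does so below
    [c]. This turns the bounded alternative of [st_dec] into an unbounded one. *)
Definition catches Y : set T := fun c => (exists a, a < c) /\ forall x : T, x < c ->
  exists2 y : T, y < c & forall a s, a <= x -> Tr S a s -> (exists v, Y v /\ ext S a s v) ->
    exists v, [/\ Y v, v.1 < y & ext S a s v].

Lemma catches_club Y : club (catches Y).
Proof.
apply: (closure_club HT) => [x|x x' y y' xx yy h a s ax' Ts hv].
  have [|y [_ hy]] := bound_enum HT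
    (R := fun (p : V) (z : T) => (exists v, Y v /\ ext S p.1 (tr S p) v) ->
       exists v, [/\ Y v, v.1 <= z & ext S p.1 (tr S p) v])
    x (enumerable_prod (enumerable_le HT x) enumerable_nat).
    move=> p _; have [[v [Yv ev]]|n] := pselect (exists v, Y v /\ ext S p.1 (tr S p) v).
      by exists v.1 => _; exists v.
    by exists x => h; case: n.
  exists y => a s ax [n ->] hv; have [//|z zy h] := hy (a, n).
  by have [v [Yv vz ev]] := h hv; exists v; split=> //; exact: le_lt_trans vz zy.
have [v [Yv vy ev]] := h a s (le_trans ax' xx) Ts hv.
by exists v; split=> //; exact: lt_le_trans vy yy.
Qed.

Lemma catchesP Y c a s : catches Y c -> a < c -> Tr S a s ->
  (exists v, Y v /\ ext S a s v) -> exists v, [/\ Y v, v.1 < c & ext S a s v].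
Proof.
move=> [_ h] /h[y yc hy] Ts /(hy a s (lexx a) Ts)[v [Yv vy ev]].
by exists v; split=> //; exact: lt_trans vy yc.
Qed.

Definition unbd Y := forall a, exists v, Y v /\ a <= v.1.

Lemma limpt_exists Y n a : unbd Y -> exists c, a < c /\ limpt Y n c.
Proof.
move=> hY; elim: n a => [|n IH] a.
  have [|c [ac hc]] := @sup_seq _ _ HT (fun x y : T => exists v, [/\ Y v, x < v.1 & v.1 < y]) a.
    move=> x; have [x' xx'] := above HT x; have [v [Yv xv]] := hY x'.
    have [y vy] := above HT v.1; have xv' := lt_le_trans xx' xv.
    by exists y; split; [exact: lt_trans vy|exists v].
  exists c; split=> // a' l' a'c.
  have [||c' [c'c ac' hc']] := @seq_bound _ _ _ l' (fun z c' => z.1 < c -> z.1 <= c') c a' a'c.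
  - move=> z _; have [zc|cz] := ltP z.1 c; first by exists z.1.
    by exists a' => // h; rewrite ltNge cz in h.
  - by move=> z c1 c2 h c12 /h h'; exact: le_trans h' c12.
  have [y [z [c'y yz zc [v [Yv yv vz]]]]] := hc c' c'c.
  have c'v := le_lt_trans c'y yv; have vc := lt_trans vz zc.
  exists v; split=> //; first by apply: le_trans (ltW c'v).
  by apply/negP => /hc' /(_ vc); rewrite leNgt c'v.
have [|c [ac hc]] := @sup_seq _ _ HT (fun x y : T => exists c, [/\ x < c, c < y & limpt Y n c]) a.
  move=> x; have [c [xc lc]] := IH x; have [y cy] := above HT c.
  by exists y; split; [exact: lt_trans xc cy|exists c].
exists c; split=> // a' /hc[y [z [a'y yz zc [c1 [yc1 c1z l1]]]]].
by exists c1; split=> //; [exact: le_lt_trans a'y yc1|exact: lt_trans c1z zc].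
Qed.

Definition through Y a s := fun v => Y v /\ ext S a s v.

(** The closure points at which unboundedly many extensions into [Y] become a [big] set of them, as
    [rich] requires. *)
Definition fills Y : set T := fun c => (exists a, a < c) /\ forall x : T, x < c ->
  exists2 y : T, y < c & forall a s a' n, a <= x -> a' <= x -> Tr S a s -> unbd (through Y a s) ->
    exists c', [/\ a' < c', c' < y & limpt (through Y a s) n c'].

Lemma fills_club Y : club (fills Y).
Proof.
apply: (closure_club HT) => [x|x x' y y' xx yy h a s a' n ax' a'x' Ts hv].
  have en := enumerable_prod (enumerable_le HT x) enumerable_nat.
  have [|y [_ hy]] := bound_enum HT
    (R := fun h (z : T) => unbd (through Y h.1.1 (tr S h.1)) ->
       exists c', [/\ h.2.1 < c', c' <= z & limpt (through Y h.1.1 (tr S h.1)) h.2.2 c'])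
    x (enumerable_prod en en).
    move=> [p [a' n]] _; have [hu|nu] := pselect (unbd (through Y p.1 (tr S p))).
      by have [c' [h1 h2]] := limpt_exists n a' hu; exists c' => _; exists c'.
    by exists x => h; case: nu.
  exists y => a s a' n ax a'x [m ->] hv; have [//|z zy h] := hy ((a, m), (a', n)).
  by have [c' [h1 h2 h3]] := h hv; exists c'; split=> //; exact: le_lt_trans h2 zy.
have [c' [h1 h2 h3]] := h a s a' n (le_trans ax' xx) (le_trans a'x' xx) Ts hv.
by exists c'; split=> //; exact: lt_le_trans h2 yy.
Qed.

Lemma fillsP Y c a s : fills Y c -> a < c -> Tr S a s -> unbd (through Y a s) ->
  big c (through Y a s).
Proof.
move=> [_ h] ac Ts hu n a' a'c.
have mc : Order.max a a' < c by rewrite gt_max ac a'c.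
have [y yc hy] := h _ mc.
have [||c' [h1 h2 h3]] := hy a s a' n _ _ Ts hu; rewrite ?le_max ?lexx ?orbT //.
by exists c'; split=> //; exact: lt_trans h2 yc.
Qed.

Definition hered W a s := forall c u, a <= c -> Tr S c u -> cut a u = s ->
  exists y, W y /\ ext S c u y.

Lemma unbd_all a s : Tr S a s -> unbd (through (fun=> True) a s).
Proof.
move=> Ts c; have [|v [vc ev _]] := vertex_ext [::] (fun=> True) Ts (c := Order.max a c).
  by rewrite le_max lexx.
by exists v; split=> //; rewrite vc le_max lexx orbT.
Qed.

Lemma unbd_hered W a s : Tr S a s -> hered W a s -> unbd (through W a s).
Proof.
move=> Ts h c; have ac : a <= Order.max a c by rewrite le_max lexx.
have [v [vc [_ ev] _]] := vertex_ext [::] (fun=> True) Ts ac.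
have [|y [Wy ey]] := h _ (tr S v) ac _ ev; first by rewrite -vc; exact: tr_Tr.
exists y; split; last by case: ey => cy _; apply: le_trans cy; rewrite le_max lexx orbT.
by split=> //; rewrite -ev; exact: ext_cut ac ey.
Qed.

Lemma hered_cut W l a s : l <= a -> hered W l (cut l s) -> hered W a s.
Proof.
move=> la h c u ac Tu eu; apply: h => //; first exact: le_trans la ac.
by rewrite -eu cut_cut.
Qed.

Definition dead W : set V := fun v => ~ exists y, W y /\ ext S v.1 (tr S v) y.

Definition decided W c := forall s, Tr S c s ->
  hered W c s \/ ~ exists y, W y /\ ext S c s y.

(** Apply [st_dec] to guesses of [dead W]. If a cut of [s] is the trace of a dead vertex, [s] has no
    extension in [W]; if no dead vertex extends some cut, every extension of [s] still leads into
    [W]. *)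
Lemma decided_club W : exists C : set T, club C /\ forall c, C c -> decided W c.
Proof.
have [C [cC CC gC]] := gP (dead W) (catches_club (dead W)).
exists C; split=> // c Cc s Ts; have hc := CC c Cc; have [[l lc] _] := hc.
have [c1 c1c h] := st_dec (G c) (gC l c lc Cc) Ts (ex_intro _ l lc).
have [h1|h1] := h; [right|left].
  have [v [[dv _] vc1 ev]] := h1; move=> [y [Wy ey]]; apply: dv; exists y; split=> //.
  by rewrite vc1 ev; exact: ext_cut (ltW c1c) ey.
have Tc1 := Tr_cut_le (@Gb (sval (cid (above HT c)))) (ltW c1c) (svalP (cid (above HT c))) Ts.
move=> c' u cc' [n ->] eu; apply: contrapT => nd; apply: h1.
have [|v [dv vc ev]] := catchesP hc c1c Tc1.
  exists (c', n); split; first exact: nd.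
  by split; [exact: le_trans (ltW c1c) cc'|rewrite -eu cut_cut // ltW].
by exists v.
Qed.

Definition bits_dense W l := forall (q : seq V) (f : V -> Prop),
  (forall x, x \in q -> W x /\ x.1 < l) -> exists s,
  [/\ Tr S l s, exists y, W y /\ ext S l s y & forall x, x \in q -> (s x <-> f x)].

(** If one pattern failed for [W] and another for the complement, a trace of level [l] realizing
    both would itself be the trace of a vertex [(l, n)], which lies on one of the two sides and
    refutes the failure there. *)
Lemma bits_dense_or W l : bits_dense W l \/ bits_dense (~` W) l.
Proof.
apply: contrapT => /not_orP[].
move=> /existsNP[q /existsNP[f /not_implyP[hq nq]]].
move=> /existsNP[q' /existsNP[f' /not_implyP[hq' nq']]].
have [b lb] := above HT l.
have [s [Ts hs]] := Tr_bits0 HT (@Gb b) (q ++ q') (fun x => (W x /\ f x) \/ (~ W x /\ f' x)) lb.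
have [n en] := Ts.
have es : ext S l s (l, n) by rewrite en; split=> //; exact: (cut_tr (l, n)).
have [Wl|nWl] := pselect (W (l, n)).
  apply: nq; exists s; split=> //; first by exists (l, n).
  move=> x xq; have [Wx xl] := hq x xq.
  rewrite hs ?mem_cat ?xq //; split=> [[[]//|[]//]|fx]; by left.
apply: nq'; exists s; split=> //; first by exists (l, n).
move=> x xq; have [nWx xl] := hq' x xq.
rewrite hs ?mem_cat ?xq ?orbT //; split=> [[[]//|[]//]|fx]; by right.
Qed.

Lemma embed W l : decided W l -> bits_dense W l ->
  exists f : V -> V, [/\ injective f, forall x, W (f x),
    forall y, W y -> exists x, f x = y & forall x y, joined S x y <-> joined S (f x) (f y)].
Proof.
move=> dec bits.
(* These clubs make the guesses rich: alive traces have witnesses below [c], and traces leading into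
   [W], as well as all traces in the full vertex set, have big sets of extensions. *)
have [C [cC CC gC]] := gP W (club_inter HT (club_inter HT (catches_club W) (fills_club W))
  (fills_club (fun=> True))).
pose K := Label W (fun a => C a /\ l < a) l.
have lCK a : lC K a <-> C a /\ l < a by [].
have al c s : C c -> l < c -> (alive S (res c K) s <-> Tr S l s /\ exists y, W y /\ ext S l s y).
  move=> Cc lc; split=> [[Ts [y [Wy _] ey]]|[Ts h]]; first by split=> //; exists y.
  have [[catW _] _] := CC c Cc.
  by have [y [Wy yc ey]] := catchesP catW lc Ts h; split=> //; exists y.
have richK c : C c -> l < c -> rich S c (res c K).
  move=> Cc lc; have [[catW fillW] fillT] := CC c Cc; split=> //=.
  - move=> b s lb bc Ts /(al c _ Cc lc)[Tl [y [Wy ey]]].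
    have hl : hered W l (cut l s) by case: (dec _ Tl) => // n; case: n; exists y.
    have hu := unbd_hered Ts (hered_cut lb hl).
    apply: (@big_agree _ _ c _ _ _ _ _ (fillsP fillW bc Ts hu)) => //.
    by move=> v vc [Wv ev]; split.
  - move=> q f hq; have [|s [Ts hy hs]] := bits q f.
      by move=> x /hq[[Wx _] xl].
    by exists s => //; apply/(al c s Cc lc).
  - move=> b s bc Ts; apply: (big_sub _ (fillsP fillT bc Ts (unbd_all Ts))).
    by move=> v [].
have legitK b : C b -> l < b -> legit S b (res b K).
  move=> Cb lb; split=> /=.
  - by move=> y [].
  - by move=> c [[]].
  - move=> c cb [a [[Ca la] _] ac] h.
    have lc := lt_trans la ac.
    split=> //; split=> //; apply: cC.1; split; first by exists a.
    by move=> a' /h[a1 [[[Ca1 _] _] h1 h2]]; exists a1 => //; rewrite h1.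
  - move=> c hc; have [Cc lc cb] : [/\ C c, l < c & c <= b].
      by case: hc => [[[? ?] /ltW ?]|->].
    rewrite res_res //; split; [exact: gC|exact: richK|].
    by move=> s; rewrite al // al.
have lowK b b' x y : C b -> l < b -> C b' -> b <= b' -> iso S b (res b K) x y ->
    iso S b' (res b' K) x y.
  move=> Cb lb Cb'; rewrite le_eqVlt => /orP[/eqP <-//|bb'] h.
  apply: (st_low (G b') (legitK _ Cb' (lt_trans lb bb'))).
  by exists b; [split|rewrite res_res // ltW].
pose R x y := exists b, [/\ C b, l < b & iso S b (res b K) x y].
have R2 x y x' y' : R x y -> R x' y' ->
    exists b, [/\ C b, l < b, iso S b (res b K) x y & iso S b (res b K) x' y'].
  move=> [b [Cb lb h]] [b' [Cb' lb' h']]; have [bb'|b'b] := leP b b'.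
    by exists b'; split=> //; exact: lowK h.
  by exists b; split=> //; apply: lowK h' => //; exact: ltW.
have Cabove a : exists2 b, C b & l < b /\ a < b.
  have [b Cb hb] := cC.2 (Order.max l a); exists b => //.
  by move: hb; rewrite gt_max => /andP.
have /choice[f hf] : forall x, exists y, R x y.
  move=> x; have [b Cb [lb xb]] := Cabove x.1.
  by have [y h] := st_dom (G b) (legitK _ Cb lb) xb; exists y, b.
exists f; split.
- move=> x x' e; have := hf x'; rewrite -e => h'.
  have [b [Cb lb h1 h2]] := R2 _ _ _ _ (hf x) h'.
  exact: (st_inj (G b) (legitK _ Cb lb) h1 h2).
- move=> x; have [b [Cb lb h]] := hf x.
  by have [_ []] := st_wf (G b) (legitK _ Cb lb) h.
- move=> y Wy; have [b Cb [lb yb]] := Cabove y.1.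
  have [x h] := st_ran (G b) (legitK _ Cb lb) (conj Wy yb); exists x.
  have [b' [Cb' lb' h1 h2]] : exists b, [/\ C b, l < b, iso S b (res b K) x (f x) & iso S b (res b K) x y].
    by apply: R2 => //; exists b.
  exact: (st_fun (G b') (legitK _ Cb' lb') h1 h2).
- move=> x y; have [b [Cb lb h1 h2]] := R2 _ _ _ _ (hf x) (hf y).
  exact: (st_adj (G b) (legitK _ Cb lb) h1 h2).
Qed.

Lemma smooth W : exists W', (W' = W \/ W' = ~` W) /\ exists f : V -> V,
  [/\ injective f, forall x, W' (f x),
    forall y, W' y -> exists x, f x = y & forall x y, joined S x y <-> joined S (f x) (f y)].
Proof.
have [C1 [cC1 h1]] := decided_club W; have [C2 [cC2 h2]] := decided_club (~` W).
have [a0 _] : exists a : T, True.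
  by apply: contrapT => n; apply: unc; exists (fun=> None) => x _; case: n; exists x.
have [l [C1l C2l] _] := (club_inter HT cC1 cC2).2 a0.
have [bW|bW] := bits_dense_or W l.
  by exists W; split; [left|apply: embed bW; exact: h1].
by exists (~` W); split; [right|apply: embed bW; exact: h2].
Qed.

(** [D] collects the vertices that break the colour [o] with an earlier vertex of [A]. A vertex of
    [A] high up has a trace that cannot be that of a member of [D] at any cut, yet flipping one bit
    at a vertex of [A] extends the cut to a member of [D]; this contradicts [st_dec]. *)
Lemma no_homogeneous (o : bool) (A : set V) : unbd A ->
  (forall x y, A x -> A y -> x.1 < y.1 -> (tr S y x <-> o)) -> False.
Proof.
move=> uA hom.
pose D v := exists x, [/\ A x, x.1 < v.1 & ~ (tr S v x <-> o)].
have [C [cC CC gC]] := gP D (catches_club D).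
have [a0 _] : exists a : T, True.
  by apply: contrapT => n; apply: unc; exists (fun=> None) => x _; case: n; exists x.
have [b Cb _] := cC.2 a0; have hb := CC b Cb; have [[l lb] _] := hb.
have [y [Ay by_]] := uA b.
have [b' yb'] := above HT y.1.
have Ts := Tr_cut_le (@Gb b') by_ yb' (tr_Tr S y).
have [c cb [[v [[[x [Ax xv nx]] _] vc ev]]|n]] := st_dec (G b) (gC l b lb Cb) Ts (ex_intro _ l lb).
  apply: nx; have xc : x.1 < c by rewrite -vc.
  have xy : x.1 < y.1 by exact: lt_le_trans (lt_trans xc cb) by_.
  rewrite -(hom x y Ax Ay xy) ev cut_cut ?ltW //.
  by split=> [[]|].
have Tc := Tr_cut_le (@Gb b') (le_trans (ltW cb) by_) yb' (tr_Tr S y).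
apply: n; rewrite cut_cut ?ltW //.
have [|v [Dv vb ev]] := catchesP hb cb Tc; last by exists v.
have [x [Ax cx]] := uA c; have [c' xc'] := above HT x.1.
have [v [vc' ev hv]] := vertex_ext [:: x] (fun=> ~~ o) Tc (ltW (le_lt_trans cx xc')).
exists v; split=> //; exists x; split=> //; first by rewrite vc'.
rewrite hv ?inE ?vc' //.
by case: (o) => /= -[h1 h2]; [have := h2 isT|have := h1 isT].
Qed.

End Core.

Theorem theorem3p1 (d : Order.disp_t) (Omega1 : orderType d)
    (homega1 : is_omega1 Omega1) :
  diamond_plus Omega1 ->
  exists G : graph Omega1, nontrivial_graph G /\ quasi_smooth G.
Proof.
move=> [SS [SSc SSP]]; have HT := omega1_like_of homega1.
have unc : ~ enumerable (fun _ : Omega1 => True).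
  by move=> e; case: homega1 => _ h _; apply: h; apply/enumerable_countable.
have [gs [gE gP]] := diamond_labels HT SSc SSP.
have [S [gS GS]] := system_exists HT gE; rewrite -gS in gP.
have [p [p' pK p'K]] := product_bijection HT unc.
pose e : rel Omega1 := fun x y => `[< joined S (p x) (p y) >].
have esym : symmetric e by move=> x y; apply: asbool_equiv_eq; exact: adj_symP.
have eirr : irreflexive e by move=> x; apply/asboolP => -[] []; rewrite ltxx.
pose H := @Graph Omega1 e esym eirr.
have hom (o : bool) A : A #= [set: Omega1] ->
    (forall x y, A x -> A y -> x <> y -> (e x y <-> o)) -> False.
  move=> cA hA.
  have Abij : ~ enumerable A.
    move=> /enumerable_countable/countable_injP cA'; apply: unc.
    apply/enumerable_countable; rewrite /countable -(card_le_eql cA).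
    exact/countable_injP.
  (* An uncountable set has vertices of arbitrarily high level, because only countably many vertices
     lie below a given one. *)
  apply: (@no_homogeneous _ _ HT unc S GS gP o (fun v => A (p' v))).
    move=> a; apply: contrapT => n; apply: Abij.
    apply: (@enumerable_sub _ _ (fun x => exists2 v : Omega1 * nat, v.1 < a /\ True & p' v = x)).
      move=> x Ax; exists (p x); last exact: pK.
      split=> //; rewrite ltNge; apply/negP => ax; apply: n; exists (p x).
      by rewrite pK.
    exact: enumerable_image (enumerable_prod (ol_init HT a) enumerable_nat).
  move=> x y Ax Ay xy; rewrite -(hA _ _ Ax Ay).
    rewrite -(adj_lt S xy) /e !p'K; split=> [h|/asboolP//]; exact/asboolP.
  by move=> /(can_inj p'K) exy; rewrite exy ltxx in xy.
exists H; split.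
  split=> -[A cA hA].
    by apply: (hom true A cA) => x y Ax Ay xy; split=> // _; exact: hA.
  by apply: (hom false A cA) => x y Ax Ay xy; split=> // h; case: (hA x y Ax Ay).
have iso_of (W : set Omega1) (f : Omega1 * nat -> Omega1 * nat) : injective f ->
    (forall v, W (p' (f v))) -> (forall v, W (p' v) -> exists u, f u = v) ->
    (forall u v, joined S u v <-> joined S (f u) (f v)) -> isomorphic H (induced H W).
  move=> finj fW fsurj fadj.
  pose g (x : Omega1) : set_type W := SigSub (mem_set (fW (p x))).
  have ginj : injective g.
    by move=> x y /(congr1 val) /= /(can_inj p'K) /finj /(can_inj pK).
  have /choice[g' hg'] : forall z : set_type W, exists x, g x = z.
    move=> z; have [|u hu] := fsurj (p (val z)); first by rewrite pK; apply/set_mem; exact: (valP z).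
    by exists (p' u); apply: val_inj; rewrite /= p'K hu pK.
  exists g; first by exists g' => [x|z]; [apply: ginj; rewrite hg'|exact: hg'].
  move=> x y /=; rewrite /e /= !p'K; apply: asbool_equiv_eq.
  by apply: iff_sym; exact: fadj.
move=> W; have [W' [WW [f [f1 f2 f3 f4]]]] := smooth HT unc GS gP (fun v => W (p' v)).
case: WW => eW; subst W'; [left|right]; exact: iso_of f1 f2 f3 f4.
Qed.
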